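(* For each of the fifteen profiles $c$ in the table below, with the corresponding $p_c=p_c(r_1,r_2,r_3,s_1,s_2,s_3,q)$ and $(i_1,\dots,i_7)$, $$\sum_{\substack{r_1\geq r_2\geq r_3\geq 0\\ s_1\geq s_2\geq s_3\geq 0}} \frac{q^{r_1^2-r_1s_1+s_1^2+r_2^2-r_2s_2+s_2^2+r_3^2+r_3s_3+s_3^2}\;p_c(r_1,r_2,r_3,s_1,s_2,s_3,q)}{(q;q)_{r_1-r_2}(q;q)_{r_2-r_3}(q;q)_{r_3}(q;q)_{s_1-s_2}(q;q)_{s_2-s_3}(q;q)_{s_3}(q;q)_{r_3+s_3+1}} = \frac{1}{(q;q)_\infty}\,\frac{1}{\theta(q^{i_1},q^{i_2},q^{i_3},q^{i_4},q^{i_5},q^{i_6},q^{i_7};q^{11})}.$$ $$\begin{array}{ccc} c & p_c(r_1,r_2,r_3,s_1,s_2,s_3,q) & (i_1,\dots,i_7)\\ \hline (8,0,0) & q^{r_1+r_2+r_3+s_1+s_2+s_3} & (2,3,3,4,4,5,5)\\ (7,1,0) & q^{r_2+r_3+s_1+s_2+s_3} & (1,2,3,4,4,5,5)\\ (7,0,1) & q^{r_1+r_2+r_3+s_2+s_3} & (1,2,3,4,4,5,5)\\ (6,2,0) & q^{r_3+s_1+s_2+s_3} & (1,2,2,3,4,5,5)\\ (6,1,1) & q^{r_2+r_3+s_2+s_3}(1-q^{r_1+s_1+1}) & (1,1,3,3,4,5,5)\\ (6,0,2) & q^{r_1+r_2+r_3+s_3} & (1,2,2,3,4,5,5)\\ (5,3,0)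 & q^{s_1+s_2+s_3} & (1,2,2,3,3,4,5)\\ (5,2,1) & q^{r_3+s_2+s_3}(1-q^{r_2+s_1+1}) & (1,1,2,3,4,4,5)\\ (5,1,2) & q^{r_2+r_3+s_3}(1-q^{r_1+s_2+1}) & (1,1,2,3,4,4,5)\\ (5,0,3) & q^{r_1+r_2+r_3} & (1,2,2,3,3,4,5)\\ (4,3,1) & q^{s_2+s_3}(1-q^{r_3+s_1+1}) & (1,1,2,3,3,4,5)\\ (4,2,2) & q^{r_3+s_3}(1-q^{r_2+s_2+1}) & (1,1,2,2,4,4,5)\\ (4,1,3) & q^{r_2+r_3}(1-q^{r_1+s_3+1}) & (1,1,2,3,3,4,5)\\ (3,3,2) & q^{s_3}(1-q^{r_3+s_2+1}) & (1,1,2,2,3,5,5)\\ (4,4,0) & q^{r_1}(q^{s_2+s_3}-q^{r_3+s_1+s_2+s_3+1}+q^{r_1+r_2+r_3+1}) & (1,2,2,3,3,4,4) \end{array}$$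
   Context: For an integer $L\ge 0$, $(a;q)_L:=(1-a)(1-aq)\cdots(1-aq^{L-1})$ and $(a;q)_\infty:=\lim_{L\to\infty}(a;q)_L$. The (modified) theta function is $\theta(a;q):=(a;q)_\infty(q/a;q)_\infty$, and $\theta(a_1,\dots,a_k;q):=\theta(a_1;q)\cdots\theta(a_k;q)$. The triples $c$ (profiles of cylindric partitions) serve here only as labels of the rows. The identities are identities of formal series in $q$. *)

(* Defs.v *)
From HB Require Import structures.
From mathcomp Require Import all_boot all_order all_algebra.
From mathcomp Require Import boolp classical_sets functions cardinality fsbigop.

Set Implicit Arguments.
Unset Strict Implicit.
Unset Printing Implicit Defensive.

Import GRing.Theory.
Local Open Scope classical_set_scope.
Local Open Scope ring_scope.

(* Formal power series. A record rather than an alias of nat -> R, because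
   functions already carry the pointwise ring structure. *)
Record fps (R : Type) := Fps { fps_coef :> nat -> R }.

Lemma fpsP (R : Type) (f g : fps R) : (forall n, f n = g n) <-> f = g.
Proof.
split=> [|-> //]; case: f g => [f] [g] /= fg.
by congr Fps; apply/funext.
Qed.

HB.instance Definition _ (R : Type) := gen_eqMixin (fps R).
HB.instance Definition _ (R : Type) := gen_choiceMixin (fps R).

Section FpsRing.
Variable R : comNzRingType.
Implicit Types f g h : fps R.

Definition fps_zero : fps R := Fps (fun=> 0).
Definition fps_one : fps R := Fps (fun n => (n == 0%N)%:R).
Definition fps_opp f : fps R := Fps (fun n => - f n).
Definition fps_add f g : fps R := Fps (fun n => f n + g n).
Definition fps_mul f g : fps R :=
  Fps (fun n => \sum_(i < n.+1) f i * g (n - i)%N).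

Fact fps_addA : associative fps_add.
Proof. by move=> f g h; apply/fpsP => n /=; rewrite addrA. Qed.
Fact fps_addC : commutative fps_add.
Proof. by move=> f g; apply/fpsP => n /=; rewrite addrC. Qed.
Fact fps_add0 : left_id fps_zero fps_add.
Proof. by move=> f; apply/fpsP => n /=; rewrite add0r. Qed.
Fact fps_addN : left_inverse fps_zero fps_opp fps_add.
Proof. by move=> f; apply/fpsP => n /=; rewrite addNr. Qed.

HB.instance Definition _ :=
  GRing.isZmodule.Build (fps R) fps_addA fps_addC fps_add0 fps_addN.

Let trunc m f : {poly R} := \poly_(i < m) f i.

Let mul_trunc f g n m : (n < m)%N ->
  fps_mul f g n = (trunc m f * trunc m g)`_n.
Proof.
move=> nm; rewrite coefM; apply: eq_bigr => i _; rewrite !coef_poly.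
rewrite (leq_ltn_trans _ nm) ?(leq_ltn_trans _ nm) ?leq_subr //.
by rewrite -ltnS.
Qed.

Fact fps_mulC : commutative fps_mul.
Proof.
by move=> f g; apply/fpsP => n; rewrite !(mul_trunc _ _ (ltnSn n)) mulrC.
Qed.

Fact fps_mulA : associative fps_mul.
Proof.
move=> f g h; apply/fpsP => n.
transitivity ((trunc n.+1 f * trunc n.+1 g * trunc n.+1 h)`_n).
  rewrite -mulrA coefM; apply: eq_bigr => i _; rewrite coef_poly ltn_ord.
  by rewrite (@mul_trunc _ _ _ n.+1) // ltnS leq_subr.
rewrite coefM; apply: eq_bigr => i _; rewrite coef_poly ltnS leq_subr.
by rewrite (@mul_trunc _ _ _ n.+1).
Qed.

Fact fps_mul1 : left_id fps_one fps_mul.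
Proof.
move=> f; apply/fpsP => n /=; rewrite big_ord_recl /= subn0 mul1r.
by rewrite big1 ?addr0 // => i _; rewrite mul0r.
Qed.

Fact fps_mulDl : left_distributive fps_mul fps_add.
Proof.
move=> f g h; apply/fpsP => n /=; rewrite -big_split /=.
by apply: eq_bigr => i _; rewrite mulrDl.
Qed.

Fact fps_1neq0 : fps_one != 0.
Proof. by apply/eqP => /fpsP/(_ 0%N)/eqP; rewrite oner_eq0. Qed.

HB.instance Definition _ := GRing.Zmodule_isComNzRing.Build (fps R)
  fps_mulA fps_mulC fps_mul1 fps_mulDl fps_1neq0.

Lemma coef_fps0 n : (0 : fps R) n = 0. Proof. by []. Qed.
Lemma coef_fps1 n : (1 : fps R) n = (n == 0%N)%:R. Proof. by []. Qed.
Lemma coef_fpsN f n : (- f) n = - f n. Proof. by []. Qed.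
Lemma coef_fpsD f g n : (f + g) n = f n + g n. Proof. by []. Qed.
Lemma coef_fpsB f g n : (f - g) n = f n - g n. Proof. by []. Qed.
Lemma coef_fpsM f g n : (f * g) n = \sum_(i < n.+1) f i * g (n - i)%N.
Proof. by []. Qed.

Definition fps_unit : pred (fps R) := fun f => `[< exists g, g * f = 1 >].
Definition fps_inv f : fps R :=
  if fps_unit f then xget 0 [set g | g * f = 1] else f.

Fact fps_mulVr : {in fps_unit, left_inverse 1 fps_inv *%R}.
Proof.
move=> f uf; rewrite /fps_inv (uf : fps_unit f); case/asboolP: uf => g gf.
exact: (@xgetPex _ 0 [set g | g * f = 1] (ex_intro _ g gf)).
Qed.
Fact fps_unitPl f g : g * f = 1 -> fps_unit f.
Proof. by move=> gf; apply/asboolP; exists g. Qed.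
Fact fps_inv_out : {in [predC fps_unit], fps_inv =1 id}.
Proof. by move=> f nuf; rewrite /fps_inv; case: ifP => // uf; case/negP: nuf. Qed.

HB.instance Definition _ := GRing.ComNzRing_hasMulInverse.Build (fps R)
  fps_mulVr fps_unitPl fps_inv_out.

Definition fpsX : fps R := Fps (fun n => (n == 1%N)%:R).

(* Convergence of sequences in the X-adic topology. *)
Definition fps_cvg (u : nat -> fps R) (l : fps R) : Prop :=
  forall n, exists N, forall L, (N <= L)%N -> u L n = l n.

(* The limit, or 0 if there is none. *)
Definition fps_lim (u : nat -> fps R) : fps R := xget 0 [set l | fps_cvg u l].

(* Unordered summation in the X-adic topology: every coefficient is a finite
   sum. The value of fps_sum is meaningful for summable families only. *)
Definition fps_summable (I : choiceType) (D : set I) (F : I -> fps R) : Prop :=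
  forall n, finite_set [set i | D i /\ F i n != 0].

Definition fps_sum (I : choiceType) (D : set I) (F : I -> fps R) : fps R :=
  Fps (fun n => \sum_(i \in D) F i n).

Definition qpoch (a q : fps R) (L : nat) : fps R :=
  \prod_(0 <= k < L) (1 - a * q ^+ k).

Definition qpoch_inf (a q : fps R) : fps R := fps_lim (qpoch a q).

(* The exact quotient b / a of b by a divisor a of b in the ring of power
   series. In b / a, a would have to be invertible, which a power of the
   variable is not. *)
Definition fps_quot (b a : fps R) : fps R := xget 0 [set c | a * c = b].

Definition theta (a q : fps R) : fps R :=
  qpoch_inf a q * qpoch_inf (fps_quot q a) q.

Definition thetas (s : seq (fps R)) (q : fps R) : fps R :=
  \prod_(a <- s) theta a q.

(* The next lemmas check that the denominators, infinite products and
   quotients occurring in the identities are not junk values. *)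

Lemma coef_fpsXM f n : (fpsX * f) n = if n is m.+1 then f m else 0.
Proof.
rewrite coef_fpsM big_ord_recl /= mul0r add0r.
case: n => [|m]; first by rewrite big_ord0.
rewrite big_ord_recl /= mul1r subSS subn0 big1 ?addr0 // => i _.
by rewrite mul0r.
Qed.

Lemma fpsX_lreg : GRing.lreg fpsX.
Proof.
by move=> f g /fpsP fg; apply/fpsP => n; have := fg n.+1; rewrite !coef_fpsXM.
Qed.

Lemma fps_quotX i m : (i <= m)%N ->
  fps_quot (fpsX ^+ m) (fpsX ^+ i) = fpsX ^+ (m - i).
Proof.
move=> im; apply: xget_unique => /=; first by rewrite -exprD subnKC.
by move=> g gE; apply: (lregX (n := i) fpsX_lreg); rewrite gE -exprD subnKC.
Qed.

Lemma coef_fpsX_small f g k n : f 0%N = 0 -> (n < k)%N -> (f ^+ k * g) n = 0.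
Proof.
move=> f0; elim: k g n => [//|k IH] g n nk.
rewrite exprS -mulrA coef_fpsM big1 // => i _.
have [->|i0] := posnP i; first by rewrite f0 mul0r.
rewrite IH ?mulr0 //; rewrite ltnS in nk; apply: leq_trans nk.
by rewrite ltn_subrL i0 (leq_trans i0) // -ltnS.
Qed.

Lemma fps_unitP f : f 0%N = 1 -> f \is a GRing.unit.
Proof.
move=> f1; pose g := 1 - f.
have g0 : g 0%N = 0 by rewrite coef_fpsB f1 subrr.
pose S m := \sum_(k < m) g ^+ k.
have SE n m : (n < m)%N -> S m n = S n.+1 n.
  move=> /subnKC <-; elim: (m - n.+1)%N => [|d IH]; first by rewrite addn0.
  rewrite addnS /S big_ord_recr coef_fpsD /= -[g ^+ _]mulr1.
  by rewrite coef_fpsX_small ?addr0 // addSn ltnS leq_addr.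
suff Sf : Fps (fun n => S n.+1 n) * f = 1.
  by apply/unitrP; exists (Fps (fun n => S n.+1 n)); split=> //; rewrite mulrC.
apply/fpsP => n; transitivity ((S n.+1 * f) n).
  rewrite !coef_fpsM; apply: eq_bigr => i _ /=; congr (_ * _).
  by rewrite (@SE i n.+1).
have -> : S n.+1 * f = 1 - g ^+ n.+1 * 1.
  by rewrite mulr1 -(expr1n _ n.+1) subrXX mulrC subKr; congr (_ * _);
     apply: eq_bigr => i _; rewrite expr1n mul1r.
by rewrite coef_fpsB coef_fpsX_small ?subr0.
Qed.

Lemma fps_limE u l : fps_cvg u l -> fps_lim u = l.
Proof.
move=> ul; apply: xget_unique => //= l' ul'; apply/fpsP => n.
have [N HN] := ul n; have [N' HN'] := ul' n.
by rewrite -(HN (maxn N N')) ?leq_maxl // HN' ?leq_maxr.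
Qed.

Lemma qpochS (a q : fps R) L :
  qpoch a q L.+1 = qpoch a q L * (1 - a * q ^+ L).
Proof. by rewrite /qpoch big_nat_recr. Qed.

Lemma qpoch_inf_cvg (a q : fps R) : q 0%N = 0 ->
  fps_cvg (qpoch a q) (qpoch_inf a q).
Proof.
move=> q0; pose l := Fps (fun n => qpoch a q n.+1 n).
suff ql : fps_cvg (qpoch a q) l by rewrite /qpoch_inf (fps_limE ql).
move=> n; exists n.+1 => L /subnKC <-.
elim: (L - n.+1)%N => [|d IH]; first by rewrite addn0.
rewrite addnS qpochS mulrBr mulr1.
rewrite coef_fpsB IH (mulrC a) mulrCA coef_fpsX_small ?subr0 //.
by rewrite addSn ltnS leq_addr.
Qed.

End FpsRing.

Arguments fpsX R : clear implicits.

Definition index_set : set ((nat * nat * nat) * (nat * nat * nat)) :=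
  [set x | let: ((r1, r2, r3), (s1, s2, s3)) := x in
     [&& (r3 <= r2)%N, (r2 <= r1)%N, (s3 <= s2)%N & (s2 <= s1)%N]].

(* The negative terms come last, since subtraction on nat is truncated;
   r ^ 2 + s ^ 2 >= r * s. *)
Definition quad_form (r1 r2 r3 s1 s2 s3 : nat) : nat :=
  (r1 ^ 2 + s1 ^ 2 - r1 * s1 + (r2 ^ 2 + s2 ^ 2 - r2 * s2)
   + (r3 ^ 2 + r3 * s3 + s3 ^ 2))%N.

Definition factor : Type :=
  nat -> nat -> nat -> nat -> nat -> nat -> fps int -> fps int.

Definition summand (p : factor) (q : fps int)
    (x : (nat * nat * nat) * (nat * nat * nat)) : fps int :=
  let: ((r1, r2, r3), (s1, s2, s3)) := x in
  (q ^+ quad_form r1 r2 r3 s1 s2 s3 * p r1 r2 r3 s1 s2 s3 q)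
  / (qpoch q q (r1 - r2) * qpoch q q (r2 - r3) * qpoch q q r3
     * qpoch q q (s1 - s2) * qpoch q q (s2 - s3) * qpoch q q s3
     * qpoch q q (r3 + s3 + 1)).

(* table c p_c (i_1, ..., i_7) *)
Inductive table : nat * nat * nat -> factor -> seq nat -> Prop :=
| row800 : table (8, 0, 0)%N
    (fun r1 r2 r3 s1 s2 s3 q => q ^+ (r1 + r2 + r3 + s1 + s2 + s3))
    [:: 2; 3; 3; 4; 4; 5; 5]%N
| row710 : table (7, 1, 0)%N
    (fun r1 r2 r3 s1 s2 s3 q => q ^+ (r2 + r3 + s1 + s2 + s3))
    [:: 1; 2; 3; 4; 4; 5; 5]%N
| row701 : table (7, 0, 1)%N
    (fun r1 r2 r3 s1 s2 s3 q => q ^+ (r1 + r2 + r3 + s2 + s3))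
    [:: 1; 2; 3; 4; 4; 5; 5]%N
| row620 : table (6, 2, 0)%N
    (fun r1 r2 r3 s1 s2 s3 q => q ^+ (r3 + s1 + s2 + s3))
    [:: 1; 2; 2; 3; 4; 5; 5]%N
| row611 : table (6, 1, 1)%N
    (fun r1 r2 r3 s1 s2 s3 q =>
       q ^+ (r2 + r3 + s2 + s3) * (1 - q ^+ (r1 + s1 + 1)))
    [:: 1; 1; 3; 3; 4; 5; 5]%N
| row602 : table (6, 0, 2)%N
    (fun r1 r2 r3 s1 s2 s3 q => q ^+ (r1 + r2 + r3 + s3))
    [:: 1; 2; 2; 3; 4; 5; 5]%N
| row530 : table (5, 3, 0)%N
    (fun r1 r2 r3 s1 s2 s3 q => q ^+ (s1 + s2 + s3))
    [:: 1; 2; 2; 3; 3; 4; 5]%N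
| row521 : table (5, 2, 1)%N
    (fun r1 r2 r3 s1 s2 s3 q =>
       q ^+ (r3 + s2 + s3) * (1 - q ^+ (r2 + s1 + 1)))
    [:: 1; 1; 2; 3; 4; 4; 5]%N
| row512 : table (5, 1, 2)%N
    (fun r1 r2 r3 s1 s2 s3 q =>
       q ^+ (r2 + r3 + s3) * (1 - q ^+ (r1 + s2 + 1)))
    [:: 1; 1; 2; 3; 4; 4; 5]%N
| row503 : table (5, 0, 3)%N
    (fun r1 r2 r3 s1 s2 s3 q => q ^+ (r1 + r2 + r3))
    [:: 1; 2; 2; 3; 3; 4; 5]%N
| row431 : table (4, 3, 1)%N
    (fun r1 r2 r3 s1 s2 s3 q =>
       q ^+ (s2 + s3) * (1 - q ^+ (r3 + s1 + 1)))
    [:: 1; 1; 2; 3; 3; 4; 5]%N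
| row422 : table (4, 2, 2)%N
    (fun r1 r2 r3 s1 s2 s3 q =>
       q ^+ (r3 + s3) * (1 - q ^+ (r2 + s2 + 1)))
    [:: 1; 1; 2; 2; 4; 4; 5]%N
| row413 : table (4, 1, 3)%N
    (fun r1 r2 r3 s1 s2 s3 q =>
       q ^+ (r2 + r3) * (1 - q ^+ (r1 + s3 + 1)))
    [:: 1; 1; 2; 3; 3; 4; 5]%N
| row332 : table (3, 3, 2)%N
    (fun r1 r2 r3 s1 s2 s3 q =>
       q ^+ s3 * (1 - q ^+ (r3 + s2 + 1)))
    [:: 1; 1; 2; 2; 3; 5; 5]%N
| row440 : table (4, 4, 0)%N
    (fun r1 r2 r3 s1 s2 s3 q =>
       q ^+ r1 * (q ^+ (s2 + s3) - q ^+ (r3 + s1 + s2 + s3 + 1)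
                  + q ^+ (r1 + r2 + r3 + 1)))
    [:: 1; 2; 2; 3; 3; 4; 4]%N.

(* Main.v *)
Require Import Defs.
From HB Require Import structures.
From mathcomp Require Import all_boot all_order all_algebra.
From mathcomp Require Import boolp classical_sets functions cardinality fsbigop.
From mathcomp Require Import zify ring.

Set Implicit Arguments.
Unset Strict Implicit.
Unset Printing Implicit Defensive.

Import Order.TTheory GRing.Theory Num.Theory.
Local Open Scope ring_scope.

(* The summands are chains of three A2 Bailey steps, in (r3, s3), (r2, s2) and
   (r1, s1), applied to q^(2 r s) / ((q)_r (q)_s (q)_(r+s+1)). The A2 Bailey
   kernel
     (q)_(n+m) / prod_(x in {a, b, c}) (q)_(n-x) (q)_(m+x)
   is a joint eigenfunction of two commuting q-Toda type operators. These
   commute with a Bailey step, and so the step multiplies the kernel by a power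
   of q. The initial sequence is an alternating sum of kernels over the root
   lattice of A2, and contiguous relations between three such sums (S11, S01
   and S00 below) account for the linear exponents of p_c. In the limit n, m ->
   oo the left-hand side becomes (q)_oo^-3 times a signed theta series of A2.
   The latter equals (q^11; q^11)_oo^2 theta(q^i, q^j, q^(i+j); q^11), since the
   product of three Jacobi triple products can be summed along lines by the
   pentagonal number theorem.

   For the row (4,4,0) let n be fixed and m -> oo in the identities behind the
   rows (4,3,1) and (5,0,3). Summed over n with the weight q^n, the right-hand
   sides telescope, and the left-hand sides add up to the required sum because
   sum_(n <= N) q^n / (q)_(n-r) = q^r / (q)_(N-r). *)

(** * Unordered sums of power series *)

(** The modulus 11 is 2 + 3 + 3 + 3. The alternating sum for the initial sequence carries the weight
    q^(2 Q) with Q = (a^2 + a c + c^2 - 1) / 3. A step multiplies a kernel by q^(3 Q) up to a linear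
    exponent, so each of the three steps adds 3 to the coefficient of Q. A step that lacks the
    exponent r or s acts on a shifted kernel, and the shift increases the linear parameters i, j of
    the theta series. These start at 1 and three steps bring them to 4 at most. The product for
    (4,4,0) belongs to (i, j) = (1, 5), which no chain reaches; hence its separate treatment. The
    finite identities contain negative powers of q and are proved by cancelling factors 1 - q^z.
    They are therefore stated over a field in which q is not a root of unity, applied to the
    fractions of Z[[q]], and brought back to power series before any limit is taken. All finite sums
    are cut at bounds beyond the supports of their terms, so no truncation error occurs. *)

Section FpsSum.
Variable R : comNzRingType.

Lemma coef_fps_sumr (I : Type) (s : seq I) (F : I -> fps R) n :
  (\sum_(i <- s) F i) n = \sum_(i <- s) F i n.
Proof.
by elim: s => [|i s IH]; rewrite ?big_nil // !big_cons coef_fpsD IH.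
Qed.

Lemma eq_coef_fpsM (f f' g g' : fps R) n :
    (forall k, (k <= n)%N -> f k = f' k) -> (forall k, (k <= n)%N -> g k = g' k) ->
  (f * g) n = (f' * g') n.
Proof.
move=> ff gg; rewrite !coef_fpsM; apply: eq_bigr => i _.
by rewrite ff ?gg ?leq_subr // -ltnS.
Qed.

(** One finite set serves all coefficients up to n, so that a family can be cut modulo X^(n+1)
    before it is multiplied. This form survives multiplication by arbitrary factors and implies
    [fps_summable]. *)
Definition summable (I : choiceType) (F : I -> fps R) : Prop :=
  forall n, exists s : seq I, uniq s /\
    forall i, i \notin s -> forall k, (k <= n)%N -> F i k = 0.

Definition fsum (I : choiceType) (F : I -> fps R) : fps R := fps_sum setT F.

Lemma coef_fsum (I : choiceType) (F : I -> fps R) (s : seq I) n : uniq s ->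
  (forall i, i \notin s -> F i n = 0) -> fsum F n = \sum_(i <- s) F i n.
Proof.
move=> us F0; rewrite /fsum /fps_sum /= (fsbigE s) //; last by move=> i _; exact: F0.
by apply: eq_bigl => i; rewrite in_setT.
Qed.

Lemma summableP (I : choiceType) (D : set I) (F : I -> fps R) :
  summable (fun i => if i \in D then F i else 0) -> fps_summable D F.
Proof.
move=> sF n; have [s [_ F0]] := sF n.
apply: (sub_finite_set (B := [set` s])); last exact: finite_seq.
move=> i [Di nz]; apply: contraT => /F0/(_ n (leqnn n)).
by rewrite mem_set // => /eqP; rewrite (negPf nz).
Qed.

Lemma fps_sum_cond (I : choiceType) (D : set I) (F : I -> fps R) :
  fps_sum D F = fsum (fun i => if i \in D then F i else 0).
Proof.
apply/fpsP => n; rewrite /fsum /fps_sum /= fsbig_mkcond; apply: eq_fsbigr => i _.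
by rewrite /patch; case: ifP.
Qed.

Lemma eq_fsum (I : choiceType) (F G : I -> fps R) : F =1 G -> fsum F = fsum G.
Proof. by move=> /funext->. Qed.

Lemma coef_fsum_le (I : choiceType) (F : I -> fps R) (s : seq I) n : uniq s ->
    (forall i, i \notin s -> forall k, (k <= n)%N -> F i k = 0) ->
  forall k, (k <= n)%N -> fsum F k = (\sum_(i <- s) F i) k.
Proof.
move=> us F0 k kn; rewrite coef_fps_sumr; apply: coef_fsum => // i si.
exact: F0.
Qed.

Lemma fsum_seq (I : choiceType) (F : I -> fps R) (s : seq I) : uniq s ->
  (forall i, i \notin s -> F i = 0) -> fsum F = \sum_(i <- s) F i.
Proof.
move=> us F0; apply/fpsP => n; rewrite coef_fps_sumr; apply: coef_fsum => // i si.
by rewrite F0.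
Qed.

Lemma coef_mulr0 (f g : fps R) n : (forall k, (k <= n)%N -> g k = 0) ->
  forall k, (k <= n)%N -> (f * g) k = 0.
Proof.
move=> g0 k kn; rewrite coef_fpsM big1 // => i _.
by rewrite g0 ?mulr0 // (leq_trans (leq_subr _ _)).
Qed.

Lemma coef_mul0r (f g : fps R) n : (forall k, (k <= n)%N -> f k = 0) ->
  forall k, (k <= n)%N -> (f * g) k = 0.
Proof. by move=> f0 k kn; rewrite mulrC; apply: coef_mulr0 f0 _ kn. Qed.

Lemma summableM (I : choiceType) (c F : I -> fps R) :
  summable F -> summable (fun i => c i * F i).
Proof.
move=> sF n; have [s [us F0]] := sF n; exists s; split=> // i /F0.
exact: coef_mulr0.
Qed.

Lemma summable_comp (I J : choiceType) (h : I -> J) (g : J -> I) (F : J -> fps R) :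
  cancel h g -> summable F -> summable (F \o h).
Proof.
move=> hK sF n; have [s [us F0]] := sF n.
exists (undup (map g s)); split; first exact: undup_uniq.
move=> i; rewrite mem_undup => si; apply: F0; apply: contra si => /(map_f g).
by rewrite hK.
Qed.

Lemma fsum_reindex (I J : choiceType) (h : I -> J) (F : J -> fps R) :
  bijective h -> fsum F = fsum (F \o h).
Proof.
by move=> bh; apply/fpsP => n; rewrite /fsum /fps_sum /= (reindex_fsbigT h).
Qed.

Lemma fsumZ (I : choiceType) (c : fps R) (F : I -> fps R) : summable F ->
  c * fsum F = fsum (fun i => c * F i).
Proof.
move=> sF; apply/fpsP => n; have [s [us F0]] := sF n.
rewrite (@coef_fsum _ _ s) //; last first.
  by move=> i /F0 Fi; apply: coef_mulr0 Fi _ (leqnn n).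
rewrite -coef_fps_sumr -mulr_sumr; apply: eq_coef_fpsM => // k.
exact: coef_fsum_le.
Qed.

Lemma summable_common (I : choiceType) (F G : I -> fps R) n :
    summable F -> summable G ->
  exists s : seq I, [/\ uniq s,
    forall i, i \notin s -> forall k, (k <= n)%N -> F i k = 0 &
    forall i, i \notin s -> forall k, (k <= n)%N -> G i k = 0].
Proof.
move=> sF sG; have [s [_ F0]] := sF n; have [t [_ G0]] := sG n.
exists (undup (s ++ t)); split; first exact: undup_uniq.
  by move=> i; rewrite mem_undup mem_cat negb_or => /andP[/F0].
by move=> i; rewrite mem_undup mem_cat negb_or => /andP[_ /G0].
Qed.

Lemma fsumD (I : choiceType) (F G : I -> fps R) : summable F -> summable G ->
  fsum (fun i => F i + G i) = fsum F + fsum G.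
Proof.
move=> sF sG; apply/fpsP => n; have [s [us F0 G0]] := summable_common n sF sG.
rewrite coef_fpsD !(@coef_fsum _ _ s) //.
- by rewrite -big_split.
- by move=> i /G0; apply.
- by move=> i /F0; apply.
- by move=> i si; rewrite coef_fpsD F0 ?G0 ?addr0.
Qed.

Lemma summable_prod (I J : choiceType) (F : I -> fps R) (G : J -> fps R) :
  summable F -> summable G -> summable (fun ij : I * J => F ij.1 * G ij.2).
Proof.
move=> sF sG n; have [s [us F0]] := sF n; have [t [ut G0]] := sG n.
exists [seq (i, j) | i <- s, j <- t]; split.
  by apply: allpairs_uniq => // -[i j] [i' j'] _ _ [-> ->].
move=> [i j] /= ij; have [si|/F0] := boolP (i \in s); last exact: coef_mul0r.
have [tj|/G0] := boolP (j \in t); last exact: coef_mulr0.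
by case/allpairsP: ij; exists (i, j).
Qed.

Lemma fsum_prod (I J : choiceType) (F : I -> fps R) (G : J -> fps R) :
    summable F -> summable G ->
  fsum F * fsum G = fsum (fun ij : I * J => F ij.1 * G ij.2).
Proof.
move=> sF sG; apply/fpsP => n; have [s [us F0]] := sF n; have [t [ut G0]] := sG n.
rewrite (@coef_fsum _ _ [seq (i, j) | i <- s, j <- t]).
- transitivity (((\sum_(i <- s) F i) * (\sum_(j <- t) G j)) n).
    by apply: eq_coef_fpsM; apply: coef_fsum_le.
  rewrite big_allpairs mulr_suml coef_fps_sumr; apply: eq_bigr => i _.
  by rewrite mulr_sumr coef_fps_sumr.
- by apply: allpairs_uniq => // -[i j] [i' j'] _ _ [-> ->].
move=> [i j] /= ij; have [si|/F0 h] := boolP (i \in s);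
  last by apply: coef_mul0r h _ (leqnn n).
have [tj|/G0 h] := boolP (j \in t); last by apply: coef_mulr0 h _ (leqnn n).
by case/allpairsP: ij; exists (i, j).
Qed.

Lemma fsum_pair (I J : choiceType) (F : I * J -> fps R) : summable F ->
  fsum F = fsum (fun i => fsum (fun j => F (i, j))).
Proof.
move=> sF; apply/fpsP => n; have [s [us F0]] := sF n.
pose s1 := undup (map fst s); pose s2 := undup (map snd s).
have F1 i j : i \notin s1 -> F (i, j) n = 0.
  move=> si; apply: F0 => //; apply: contra si => /(map_f fst).
  by rewrite mem_undup.
have F2 i j : j \notin s2 -> F (i, j) n = 0.
  move=> sj; apply: F0 => //; apply: contra sj => /(map_f snd).
  by rewrite mem_undup.
rewrite [RHS](@coef_fsum _ _ s1) ?undup_uniq //; last first.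
  move=> i si; rewrite (@coef_fsum _ _ [::]) ?big_nil // => j _.
  exact: F1.
rewrite (@coef_fsum _ _ [seq (i, j) | i <- s1, j <- s2]).
- rewrite big_allpairs; apply: eq_bigr => i _.
  by rewrite (@coef_fsum _ _ s2) ?undup_uniq // => j; apply: F2.
- by apply: allpairs_uniq; rewrite ?undup_uniq // => -[i j] [i' j'] _ _ [-> ->].
move=> [i j] /= ij; have [si|/F1 //] := boolP (i \in s1).
have [tj|/F2 //] := boolP (j \in s2).
by case/allpairsP: ij; exists (i, j).
Qed.

Lemma fps_cvg_le (u : nat -> fps R) l n : fps_cvg u l ->
  exists N, forall L, (N <= L)%N -> forall k, (k <= n)%N -> u L k = l k.
Proof.
move=> ul; elim: n => [|n [M IHn]].
  have [M HM] := ul 0%N; exists M => L /HM h k.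
  by rewrite leqn0 => /eqP->.
have [M' HM'] := ul n.+1; exists (maxn M M') => L.
rewrite geq_max => /andP[ML M'L] k; rewrite leq_eqVlt => /orP[/eqP->|].
  exact: HM'.
exact: IHn.
Qed.

(** Exchange of limit and sum. No uniformity in i is required of u, since modulo X^(n+1) the family
    G leaves only finitely many terms. *)
Lemma fsum_cvg (I : choiceType) (G c : I -> fps R) (u : nat -> I -> fps R) :
    summable G -> (forall i, fps_cvg (fun L => u L i) (c i)) ->
  fps_cvg (fun L => fsum (fun i => u L i * G i)) (fsum (fun i => c i * G i)).
Proof.
move=> sG uc n; have [s [us G0]] := sG n.
have [N HN] : exists N, forall L, (N <= L)%N -> forall i, i \in s ->
    forall k, (k <= n)%N -> u L i k = c i k.
  elim: s {us G0} => [|i s [N IH]]; first by exists 0%N.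
  have [N' HN'] := fps_cvg_le n (uc i).
  exists (maxn N N') => L; rewrite geq_max => /andP[NL N'L] j.
  by rewrite in_cons => /orP[/eqP->|sj]; [exact: HN' | exact: IH].
exists N => L NL; rewrite !(@coef_fsum _ _ s) //.
- apply: eq_big_seq => i si; apply: eq_coef_fpsM => // k kn; exact: HN.
- by move=> i /G0 h; apply: coef_mulr0 h _ (leqnn n).
- by move=> i /G0 h; apply: coef_mulr0 h _ (leqnn n).
Qed.

Lemma fps_cvg_unique (u : nat -> fps R) l l' : fps_cvg u l -> fps_cvg u l' -> l = l'.
Proof. by move=> /fps_limE <- /fps_limE. Qed.

Lemma fps_cvgM (u v : nat -> fps R) l l' :
  fps_cvg u l -> fps_cvg v l' -> fps_cvg (fun L => u L * v L) (l * l').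
Proof.
move=> ul vl n.
have [N HN] := fps_cvg_le n ul; have [N' HN'] := fps_cvg_le n vl.
exists (maxn N N') => L; rewrite geq_max => /andP[NL N'L].
by apply: eq_coef_fpsM => k kn; [exact: HN | exact: HN'].
Qed.

End FpsSum.

(** * The A2 Bailey kernel and its alternating sums *)

(** The nonprincipal character modulo 3. When a + b + c = 0, the differences a - c, c - b and b - a
    are congruent modulo 3; so the value at a - c is nonzero exactly for a, b, c distinct modulo 3,
    and it changes sign under transpositions. *)
Definition chi3 (d : int) : int :=
  if (d %% 3)%Z == 1 then 1 else if (d %% 3)%Z == 2 then - 1 else 0.

Lemma chi3_mod (d : int) : exists k r : int, d = 3 * k + r /\
  [\/ r = 0 /\ chi3 d = 0, r = 1 /\ chi3 d = 1 | r = - 1 /\ chi3 d = - 1].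
Proof.
have := divz_eq d 3; have := @modz_ge0 d 3 isT; have := @ltz_pmod d 3 isT.
rewrite /chi3; move: (d %% 3)%Z (d %/ 3)%Z => r k r3 r0 dE.
have [rE | [rE | rE]] : r = 0 \/ r = 1 \/ r = 2 by lia.
- by exists k, 0; split; [lia | rewrite rE; apply: Or31].
- by exists k, 1; split; [lia | rewrite rE; apply: Or32].
- by exists (k + 1), (- 1); split; [lia | rewrite rE; apply: Or33].
Qed.

Lemma chi3D (d e k : int) : d - e = 3 * k -> chi3 e = chi3 d.
Proof.
move=> /(canRL (subrK _)) ->; rewrite /chi3 mulrC.
by rewrite modzMDl.
Qed.

Lemma chi3N (d e k : int) : d + e = 3 * k -> chi3 e = - chi3 d.
Proof.
move=> de; have [m [r [dE h]]] := chi3_mod d.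
have [m' [r' [eE h']]] := chi3_mod e.
by move: h h' => [] [rE ->] [] [r'E ->] //; lia.
Qed.

(** With b = - a - c this is (a^2 + b^2 + c^2 - 2) / 6, hence symmetric in a, b, c. The division is
    exact where [chi3 (a - c)] is nonzero, because a^2 + a c + c^2 is congruent to (a - c)^2 modulo
    3; elsewhere the value is rounded and gets the coefficient 0. *)
Definition qexp (a c : int) : int := ((a * a + a * c + c * c - 1) %/ 3)%Z.

Lemma qexpE a c : chi3 (a - c) != 0 ->
  3 * qexp a c = a * a + a * c + c * c - 1.
Proof.
have [k [r [d h]]] := chi3_mod (a - c) => nz.
have ac : a = c + 3 * k + r by lia.
have [m mE] : exists m, a * a + a * c + c * c - 1 = 3 * m.
  case: h nz => [[_ ->] //|[r1 _] _|[r1 _] _].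
    by exists (3 * k * k + 3 * k * c + c * c + 2 * k + c); rewrite ac r1; ring.
  by exists (3 * k * k + 3 * k * c + c * c - 2 * k - c); rewrite ac r1; ring.
by rewrite /qexp mE mulKz.
Qed.

Definition zrange (B : nat) : seq int := [seq i%:Z - B%:Z | i <- iota 0 (2 * B).+1].

Lemma mem_zrange B x : (x \in zrange B) = (- B%:Z <= x <= B%:Z).
Proof.
apply/mapP/idP => [[i]|h]; first by rewrite mem_iota; lia.
by exists `|(x + B%:Z)%R|%N; [rewrite mem_iota; lia | lia].
Qed.

Lemma zrange_uniq B : uniq (zrange B).
Proof. by rewrite map_inj_uniq ?iota_uniq // => i j; lia. Qed.

Lemma qexpC a c : qexp c a = qexp a c.
Proof. by rewrite /qexp; congr (_ %/ _)%Z; ring. Qed.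

Lemma qexp_sum0 (a b c : int) : a + b + c = 0 -> qexp b c = qexp a c.
Proof.
move=> abc; rewrite (_ : b = - a - c); last by lia.
by rewrite /qexp; congr (_ %/ _)%Z; ring.
Qed.

Lemma qexp_sum0r (a b c : int) : a + b + c = 0 -> qexp a b = qexp a c.
Proof. by move=> abc; rewrite qexpC (@qexp_sum0 c b a) 1?qexpC //; lia. Qed.

Lemma qexp_shift a c : qexp (a + 1) (c - 2) = qexp a c + (1 - c).
Proof.
rewrite /qexp (_ : _ - 1 = (1 - c) * 3 + (a * a + a * c + c * c - 1)); last by ring.
by rewrite divzMDl // addrC.
Qed.

Definition sgnz (x : int) : int := (- 1) ^+ `|x|%N.

Lemma sgnzS x : sgnz (x + 1) = - sgnz x.
Proof.
rewrite /sgnz; case: (intP x) => [|n|n].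
- by [].
- by rewrite (_ : `|(n.+1%:Z + 1)%R|%N = n.+2); [rewrite exprS mulN1r | lia].
- rewrite (_ : `|(- n.+1%:Z + 1)%R|%N = n); last by lia.
  by rewrite abszN absz_nat exprS mulN1r opprK.
Qed.

Lemma sgnzB1 x : sgnz (x - 1) = - sgnz x.
Proof. by rewrite -{2}[x](subrK 1) sgnzS opprK. Qed.

Lemma sgnzD x y : sgnz (x + y) = sgnz x * sgnz y.
Proof.
case: (intP y) => [|n|n]; first by rewrite addr0 /sgnz expr0 mulr1.
  elim: n => [|n IH]; first by rewrite sgnzS mulrN1.
  by rewrite -[n.+2]addn1 PoszD addrA !sgnzS IH mulrN.
elim: n => [|n IH]; first by rewrite sgnzB1 mulrN1.
rewrite (_ : - n.+2%:Z = - n.+1%:Z - 1); last by lia.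
by rewrite addrA !sgnzB1 IH mulrN.
Qed.

Lemma sgnz_sqr x : sgnz x * sgnz x = 1.
Proof. by rewrite /sgnz -expr2 sqrr_sign. Qed.

Lemma sgnzN x : sgnz (- x) = sgnz x.
Proof. by rewrite /sgnz abszN. Qed.

Definition tri (x : int) : int := ((x * (x - 1)) %/ 2)%Z.

Lemma triE x : 2 * tri x = x * (x - 1).
Proof.
have [k [->|->]] : exists k : int, x = 2 * k \/ x = 2 * k + 1.
- have := divz_eq x 2; have := @modz_ge0 x 2 isT; have := @ltz_pmod x 2 isT.
  move: (x %% 2)%Z (x %/ 2)%Z => r k r2 r0 xE; exists k; lia.
- by rewrite /tri (_ : 2 * k * _ = 2 * (k * (2 * k - 1))) ?mulKz //; ring.
- by rewrite /tri (_ : (2 * k + 1) * _ = 2 * ((2 * k + 1) * k)) ?mulKz //; ring.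
Qed.

Lemma triS x : tri (x + 1) = tri x + x.
Proof. have := triE x; have := triE (x + 1); lia. Qed.

(** * Generic q and q-factorials at integer arguments *)

(** The last condition lets a sum that equals its own opposite be zero. *)
Definition generic (F : fieldType) (q : F) : Prop :=
  [/\ q != 0, forall k, (0 < k)%N -> q ^+ k != 1 & 2%:R != 0 :> F].

Section QField.
Variables (F : fieldType) (q : F).
Hypothesis gq : generic q.

Lemma q_neq0 : q != 0. Proof. by case: gq. Qed.

Lemma q_free k : (0 < k)%N -> q ^+ k != 1. Proof. by case: gq => _ qf _ /qf. Qed.

Lemma two_neq0 : 2%:R != 0 :> F. Proof. by case: gq. Qed.

Hint Resolve q_neq0 q_free two_neq0 : core.

Lemma qzD (a b : int) : q ^ (a + b) = q ^ a * q ^ b.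
Proof. exact: expfzDr. Qed.

Lemma qzN (a : int) : q ^ (- a) = (q ^ a)^-1.
Proof. by rewrite -invr_expz. Qed.

Lemma qz_neq0 (a : int) : q ^ a != 0.
Proof. exact: expfz_neq0. Qed.

Lemma qz_eq1 (a : int) : (q ^ a == 1) = (a == 0).
Proof.
case: (intP a) => [|n|n]; first by rewrite expr0z !eqxx.
  by rewrite -exprnP (negPf (q_free _)).
rewrite qzN -[1]invr1 (inj_eq invr_inj) -exprnP (negPf (q_free _)) //.
Qed.

Lemma subr_qz_neq0 (a : int) : a != 0 -> 1 - q ^ a != 0.
Proof. by rewrite subr_eq0 [1 == _]eq_sym qz_eq1. Qed.

Definition qfac (k : nat) : F := \prod_(i < k) (1 - q ^+ i.+1).

(** The value 0 at z < 0 is a default, and the recurrence of the q-factorial breaks at z = 0. For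
    [iq] the value 0 is the genuine convention 1 / (q)_z = 0, with a recurrence valid at every
    integer. *)
Definition qfacz (z : int) : F := if z is Posz k then qfac k else 0.

Definition iq (z : int) : F := if z is Posz k then (qfac k)^-1 else 0.

Lemma qfac_neq0 k : qfac k != 0.
Proof.
apply/prodf_neq0 => i _.
by rewrite (_ : q ^+ i.+1 = q ^ i.+1%:Z) // subr_qz_neq0.
Qed.

Lemma qfacS k : qfac k.+1 = (1 - q ^ (k.+1)%:Z) * qfac k.
Proof. by rewrite /qfac big_ord_recr mulrC. Qed.

Lemma iq_lt0 (z : int) : z < 0 -> iq z = 0.
Proof. by case: z. Qed.

Lemma iq0 : iq 0 = 1.
Proof. by rewrite /iq /= /qfac big_ord0 invr1. Qed.

Lemma iq_pred (z : int) : iq (z - 1) = (1 - q ^ z) * iq z.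
Proof.
case: (intP z) => [|n|n].
- by rewrite expr0z subrr mul0r iq_lt0.
- rewrite (_ : n.+1%:Z - 1 = n%:Z); last by lia.
  rewrite /iq qfacS invfM mulrA divff ?mul1r //.
  exact: subr_qz_neq0.
- by rewrite !iq_lt0 ?mulr0 //; lia.
Qed.

Lemma qfacz_pred (z : int) : 0 < z -> qfacz z = (1 - q ^ z) * qfacz (z - 1).
Proof.
case: z => // -[|n] // _; rewrite (_ : n.+1%:Z - 1 = n%:Z); last by lia.
exact: qfacS.
Qed.

Lemma iq_mul_lt0 (x y : int) : x + y < 0 -> iq x * iq y = 0.
Proof.
move=> xy; have [x0|x0] := ltP x 0; first by rewrite iq_lt0 ?mul0r.
by rewrite [iq y]iq_lt0 ?mulr0 //; lia.
Qed.

Definition kern (n m a b c : int) : F :=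
  qfacz (n + m) *
    (iq (n - a) * iq (n - b) * iq (n - c) *
     (iq (m + a) * iq (m + b) * iq (m + c))).

Lemma kern_flip n m a b c : kern n m a b c = kern m n (- a) (- b) (- c).
Proof. by rewrite /kern !opprK [n + m]addrC [X in _ * X = _]mulrC. Qed.

Lemma kern_swap12 n m a b c : kern n m a b c = kern n m b a c.
Proof. rewrite /kern; ring. Qed.

Lemma kern_swap23 n m a b c : kern n m a b c = kern n m a c b.
Proof. rewrite /kern; ring. Qed.

Lemma kern0 n m a b c : (n < a) || (m < - a) -> kern n m a b c = 0.
Proof.
case/orP=> h; rewrite /kern.
  by rewrite (@iq_lt0 (n - a)) ?(mul0r, mulr0) //; lia.
by rewrite (@iq_lt0 (m + a)) ?(mul0r, mulr0) //; lia.
Qed.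

Lemma kern_lt0 n m a b c : n + m < 0 -> kern n m a b c = 0.
Proof. by move=> h; apply: kern0; lia. Qed.

Lemma kern_predl n m a b c :
  (1 - q ^ (n + m)) * kern (n - 1) m a b c =
  (1 - q ^ (n - a)) * (1 - q ^ (n - b)) * (1 - q ^ (n - c)) * kern n m a b c.
Proof.
have [h|h] := ltP 0 (n + m).
  rewrite /kern (qfacz_pred h) (_ : n - 1 + m = n + m - 1); last by ring.
  rewrite !(_ : forall x : int, n - 1 - x = n - x - 1); try by move=> x; ring.
  rewrite !iq_pred; ring.
(* Now n + m <= 0 and the left-hand side is 0. On the right, 1 - q^(n-a) lowers the argument of
   [iq (n - a)]; its sum with m + a is then negative, so one of the two factors vanishes. *)
rewrite kern_lt0 ?mulr0; last by lia.
rewrite /kern; have := @iq_mul_lt0 (n - a - 1) (m + a).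
rewrite iq_pred => /(_ _) e.
transitivity ((1 - q ^ (n - a)) * iq (n - a) * iq (m + a) *
  ((1 - q ^ (n - b)) * (1 - q ^ (n - c)) * (qfacz (n + m) *
    (iq (n - b) * iq (n - c) * (iq (m + b) * iq (m + c)))))); last by ring.
by rewrite e ?mul0r //; lia.
Qed.

Lemma kern_predr n m a b c :
  (1 - q ^ (n + m)) * kern n (m - 1) a b c =
  (1 - q ^ (m + a)) * (1 - q ^ (m + b)) * (1 - q ^ (m + c)) * kern n m a b c.
Proof.
rewrite [kern n (m - 1) _ _ _]kern_flip [kern n m _ _ _]kern_flip [n + m]addrC.
by rewrite kern_predl !opprK.
Qed.

(* The first of the two commuting q-Toda type operators having the kernels as
   joint eigenfunctions; the second one is its mirror image. *)
Definition toda (x1 x2 x3 : F) (f : int -> int -> F) : Prop := forall r s : int,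
  (x1 + x2 + x3) * f r s =
  (q ^ (- s) + q ^ (s - r) * (x1 * x2 * x3) + q ^ r) * f r s
  - q ^ (s - r) * (x1 * x2 * x3) * f (r - 1) s - q ^ (- s) * f r (s - 1).

(** For r + s nonzero both lowered kernels are rational multiples of [kern r s a b c], which turns
    the equation into an identity of rational functions in q^r, q^s, q^a, q^b, q^c. *)
Lemma kern_toda a b c :
  toda (q ^ a) (q ^ b) (q ^ c) (fun r s => kern r s a b c).
Proof.
move=> r s /=; case: (eqVneq (r + s) 0) => [rs|rs].
  (* The factor 1 - q^(r+s) cannot be cancelled here, but the kernel is nonzero only at a = b = c =
     r. *)
  rewrite [kern (r - 1) s _ _ _]kern_lt0; last by lia.
  rewrite [kern r (s - 1) _ _ _]kern_lt0; last by lia.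
  rewrite !mulr0 !subr0.
  case: (eqVneq a r) => [->|ar]; last by rewrite kern0 ?mulr0 //; lia.
  case: (eqVneq b r) => [->|br]; last by rewrite kern_swap12 kern0 ?mulr0 //; lia.
  case: (eqVneq c r) => [->|cr];
    last by rewrite kern_swap23 kern_swap12 kern0 ?mulr0 //; lia.
  have -> : s = - r by lia.
  rewrite !(qzD, qzN) invrK; have := qz_neq0 r; set R := q ^ r => R0; field.
  exact: R0.
apply: (mulfI (subr_qz_neq0 rs)).
have ea : (1 - q ^ (r + s)) * kern (r - 1) s a b c = _ := kern_predl _ _ _ _ _.
have eb : (1 - q ^ (r + s)) * kern r (s - 1) a b c = _ := kern_predr _ _ _ _ _.
transitivity ((1 - q ^ (r + s)) * 
  ((q ^ (- s) + q ^ (s - r) * (q ^ a * q ^ b * q ^ c) + q ^ r) * kern r s a b c)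
  - q ^ (s - r) * (q ^ a * q ^ b * q ^ c) * 
    ((1 - q ^ (r + s)) * kern (r - 1) s a b c)
  - q ^ (- s) * ((1 - q ^ (r + s)) * kern r (s - 1) a b c)); last by ring.
rewrite ea eb !(qzD, qzN).
have := qz_neq0 r; have := qz_neq0 s; have := qz_neq0 a; have := qz_neq0 b.
have := qz_neq0 c; move: (kern _ _ _ _ _) => k c0 b0 a0 s0 r0; field.
by rewrite r0 s0 a0 b0 c0.
Qed.

(** * The Bailey step and its eigenvalues on the kernels *)

Definition chain_wt (sigma r s : int) : F :=
  q ^ (r * r - r * s + s * s - sigma * (r - s)).

Definition chain_coef (sigma n m r s : int) : F :=
  chain_wt sigma r s * (iq (n - r) * iq (m - s)).

(** Here sigma stands for a + b + c of the kernel in question. For n, m < B the cut is exact, since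
    [iq] kills the summands with r > n or s > m. *)
Definition chain (sigma : int) (B : nat) (f : int -> int -> F) (n m : int) : F :=
  \sum_(r < B) \sum_(s < B) chain_coef sigma n m r s * f r s.

Lemma chain_coefSl sigma n m r s :
  chain_coef sigma n m (r + 1) s * q ^ (s - (r + 1) + sigma) =
  q ^ r * (1 - q ^ (n - r)) * chain_coef sigma n m r s.
Proof.
rewrite /chain_coef (_ : n - (r + 1) = n - r - 1); last by ring.
rewrite iq_pred.
suff -> : chain_wt sigma (r + 1) s =
    q ^ r * chain_wt sigma r s / q ^ (s - (r + 1) + sigma).
  by have := qz_neq0 (s - (r + 1) + sigma); set T := q ^ _ => T0; field.
by rewrite /chain_wt -qzN -!qzD; congr (q ^ _); ring.
Qed.

Lemma chain_coefSr sigma n m r s :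
  chain_coef sigma n m r (s + 1) * q ^ (- (s + 1)) =
  q ^ (s - r + sigma) * (1 - q ^ (m - s)) * chain_coef sigma n m r s.
Proof.
rewrite /chain_coef (_ : m - (s + 1) = m - s - 1); last by ring.
rewrite iq_pred.
suff -> : chain_wt sigma r (s + 1) =
    q ^ (s - r + sigma) * chain_wt sigma r s / q ^ (- (s + 1)).
  by have := qz_neq0 (- (s + 1)); set T := q ^ (- (s + 1)) => T0; field.
by rewrite /chain_wt -qzN -!qzD; congr (q ^ _); ring.
Qed.

Lemma chain_coef_predl sigma n m r s :
  chain_coef sigma (n - 1) m r s = (1 - q ^ (n - r)) * chain_coef sigma n m r s.
Proof.
rewrite /chain_coef (_ : n - 1 - r = n - r - 1); last by ring.
by rewrite iq_pred; ring.
Qed.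

Lemma chain_coef_predr sigma n m r s :
  chain_coef sigma n (m - 1) r s = (1 - q ^ (m - s)) * chain_coef sigma n m r s.
Proof.
rewrite /chain_coef (_ : m - 1 - s = m - s - 1); last by ring.
by rewrite iq_pred; ring.
Qed.

Lemma chain_coef0l sigma n m r s : n < r -> chain_coef sigma n m r s = 0.
Proof. by move=> h; rewrite /chain_coef iq_lt0 ?(mul0r, mulr0) //; lia. Qed.

Lemma chain_coef0r sigma n m r s : m < s -> chain_coef sigma n m r s = 0.
Proof.
by move=> h; rewrite /chain_coef [iq (m - s)]iq_lt0 ?(mul0r, mulr0) //; lia.
Qed.

Lemma sum_ord_shift B (g h : int -> F) : h (- 1) = 0 -> g B%:Z = 0 ->
  \sum_(r < B) g r%:Z * h (r%:Z - 1) = \sum_(r < B) g (r%:Z + 1) * h r%:Z.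
Proof.
move=> h0 gB; transitivity (\sum_(r < B.+1) g r%:Z * h (r%:Z - 1)).
  by rewrite big_ord_recr /= gB mul0r addr0.
rewrite big_ord_recl /= sub0r h0 mulr0 add0r; apply: eq_bigr => r _.
rewrite (_ : (bump 0 r)%:Z = r%:Z + 1); last by rewrite /bump /=; lia.
by rewrite addrK.
Qed.

(* The q-Toda operator commutes with the chain, termwise after a shift of the
   summation indices. *)
Lemma chain_toda (sigma : int) B x1 x2 x3 (f : int -> int -> F) : x1 * x2 * x3 = q ^ sigma ->
    (forall s : int, f (- 1) s = 0) -> (forall r : int, f r (- 1) = 0) ->
    toda x1 x2 x3 f -> forall n m : int, n < B%:Z -> m < B%:Z ->
  (x1 + x2 + x3) * chain sigma B f n m =
  (q ^ (- m) + q ^ (m - n) * (x1 * x2 * x3) + q ^ n) * chain sigma B f n m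
  - q ^ (m - n) * (x1 * x2 * x3) * chain sigma B f (n - 1) m
  - q ^ (- m) * chain sigma B f n (m - 1).
Proof.
move=> xs fl fr ft n m nB mB; rewrite xs.
(* Summation by parts moves the shifts from f to the coefficients, where they become multipliers.
   The right-hand side reduces to the same multiplier by [chain_coef_predl] and
   [chain_coef_predr]. *)
have lhsE : (x1 + x2 + x3) * chain sigma B f n m =
    \sum_(r < B) \sum_(s < B) chain_coef sigma n m r s *
      (q ^ (- s%:Z) + q ^ n + q ^ (m - r%:Z + sigma)) * f r s.
  transitivity (\sum_(r < B) \sum_(s < B) chain_coef sigma n m r s *
      (q ^ (- s%:Z) + q ^ (s%:Z - r%:Z + sigma) + q ^ r%:Z) * f r s
    - \sum_(s < B) \sum_(r < B) chain_coef sigma n m r s *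
        q ^ (s%:Z - r%:Z + sigma) * f (r%:Z - 1) s
    - \sum_(r < B) \sum_(s < B) chain_coef sigma n m r s *
        q ^ (- s%:Z) * f r (s%:Z - 1)).
    rewrite [X in _ = _ - X - _]exchange_big -!sumrB /chain mulr_sumr.
    apply: eq_bigr => r _; rewrite -!sumrB mulr_sumr; apply: eq_bigr => s _.
    by rewrite mulrCA ft xs [q ^ (_ + sigma)]qzD; ring.
  under [X in _ - X - _]eq_bigr => s _.
    rewrite (@sum_ord_shift B
      (fun r => chain_coef sigma n m r s * q ^ (s%:Z - r + sigma))
      (fun r => f r s)) ?fl //; last by rewrite chain_coef0l ?mul0r.
    under eq_bigr => r _ do rewrite chain_coefSl.
    over.
  under [X in _ - _ - X]eq_bigr => r _.
    rewrite (@sum_ord_shift B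
      (fun s => chain_coef sigma n m r s * q ^ (- s))
      (fun s => f r s)) ?fr //; last by rewrite chain_coef0r ?mul0r.
    under eq_bigr => s _ do rewrite chain_coefSr.
    over.
  rewrite [X in _ - X - _]exchange_big -!sumrB; apply: eq_bigr => r _.
  rewrite -!sumrB; apply: eq_bigr => s _.
  rewrite !(qzD, qzN); move: (qz_neq0 r%:Z) (qz_neq0 s%:Z).
  move: (chain_coef _ _ _ _ _) (f r s) (q ^ sigma) (q ^ n) (q ^ m).
  by move=> c y S N M r0 s0; field; rewrite r0 s0.
rewrite lhsE /chain !mulr_sumr -!sumrB; apply: eq_bigr => r _.
rewrite !mulr_sumr -!sumrB; apply: eq_bigr => s _.
rewrite chain_coef_predl chain_coef_predr !(qzD, qzN).
move: (qz_neq0 r%:Z) (qz_neq0 s%:Z) (qz_neq0 n) (qz_neq0 m).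
move: (chain_coef _ _ _ _ _) (f r s) (q ^ sigma).
by move=> c y S r0 s0 n0 m0; field; rewrite r0 s0 n0 m0.
Qed.

Lemma chain_flip sigma B f n m :
  chain sigma B f n m = chain (- sigma) B (fun r s => f s r) m n.
Proof.
rewrite /chain exchange_big; apply: eq_bigr => s _; apply: eq_bigr => r _.
rewrite /chain_coef /chain_wt [iq _ * _]mulrC; congr (q ^ _ * _ * _); ring.
Qed.
(** The value L n (m - 1) is eliminated between the Toda equation and its mirror image. What remains
    is a recurrence in n alone, the same as that of the kernel in [kern_predl]. *)
Lemma chain_kern_predl (sigma : int) B (a b c : int) : a + b + c = sigma ->
    (forall s : int, kern (- 1) s a b c = 0) ->
    (forall r : int, kern r (- 1) a b c = 0) ->
    forall n m : int, n < B%:Z -> m < B%:Z ->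
  let L := chain sigma B (fun r s => kern r s a b c) in
  (1 - q ^ (n + m)) * L (n - 1) m =
  (1 - q ^ (n - a)) * (1 - q ^ (n - b)) * (1 - q ^ (n - c)) * L n m.
Proof.
move=> abc kl kr n m nB mB L.
have xs : q ^ a * q ^ b * q ^ c = q ^ sigma by rewrite -!qzD abc.
have := chain_toda xs kl kr (kern_toda a b c) nB mB.
have xs' : q ^ (- a) * q ^ (- b) * q ^ (- c) = q ^ (- sigma).
  by rewrite -!qzD -abc; congr (q ^ _); ring.
have kl' s : kern (- 1) s (- a) (- b) (- c) = 0.
  by rewrite kern_flip !opprK.
have kr' r : kern r (- 1) (- a) (- b) (- c) = 0.
  by rewrite kern_flip !opprK.
have := chain_toda xs' kl' kr' (kern_toda (- a) (- b) (- c)) mB nB.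
have LE x y : chain (- sigma) B (fun r s => kern r s (- a) (- b) (- c)) x y
    = L y x.
  rewrite /L [RHS]chain_flip; apply: eq_bigr => r _; apply: eq_bigr => s _.
  by rewrite [kern s r _ _ _]kern_flip.
rewrite !LE -/L !(qzD, qzN).
have := qz_neq0 a; have := qz_neq0 b; have := qz_neq0 c.
have := qz_neq0 n; have := qz_neq0 m.
move: (L n m) (L (n - 1) m) (L n (m - 1)) => l l1 l2.
move: (q ^ a) (q ^ b) (q ^ c) (q ^ n) (q ^ m) => x y z N M M0 N0 z0 y0 x0 t' t.
have e1 : N * M * x * y * z * ((x + y + z) * l) = N * M * x * y * z *
   ((M^-1 + M / N * (x * y * z) + N) * l - M / N * (x * y * z) * l1 - M^-1 * l2).
  by rewrite t.
have e2 : N * M * x * y * z * ((x^-1 + y^-1 + z^-1) * l) = N * M * x * y * z *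
   ((N^-1 + N / M * (x^-1 * y^-1 * z^-1) + M) * l
   - N / M * (x^-1 * y^-1 * z^-1) * l2 - N^-1 * l1).
  by rewrite t'.
apply/eqP; rewrite -subr_eq0; apply/eqP.
have xyz0 : x * y * z != 0 by rewrite !mulf_neq0.
apply: (mulfI xyz0); rewrite mulr0.
(* The combination in which l2 cancels: the second equation divided by M minus the first one times N
   / (M x y z). *)
have -> : x * y * z * ((1 - N * M) * l1 -
    (1 - N / x) * (1 - N / y) * (1 - N / z) * l) =
  (N * M * x * y * z * ((x^-1 + y^-1 + z^-1) * l) - N * M * x * y * z *
   ((N^-1 + N / M * (x^-1 * y^-1 * z^-1) + M) * l
   - N / M * (x^-1 * y^-1 * z^-1) * l2 - N^-1 * l1)) / M
  - (N * M * x * y * z * ((x + y + z) * l) - N * M * x * y * z *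
   ((M^-1 + M / N * (x * y * z) + N) * l - M / N * (x * y * z) * l1
    - M^-1 * l2)) * N / (M * x * y * z).
  by field; rewrite x0 y0 z0 N0 M0.
by rewrite e1 e2 !subrr !mul0r subr0.
Qed.

Lemma chain_kern_predr (sigma : int) B (a b c : int) : a + b + c = sigma ->
    (forall s : int, kern (- 1) s a b c = 0) ->
    (forall r : int, kern r (- 1) a b c = 0) ->
    forall n m : int, n < B%:Z -> m < B%:Z ->
  let L := chain sigma B (fun r s => kern r s a b c) in
  (1 - q ^ (n + m)) * L n (m - 1) =
  (1 - q ^ (m + a)) * (1 - q ^ (m + b)) * (1 - q ^ (m + c)) * L n m.
Proof.
move=> abc kl kr n m nB mB L.
have LE x y : L x y =
    chain (- sigma) B (fun r s => kern r s (- a) (- b) (- c)) y x.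
  rewrite /L chain_flip; apply: eq_bigr => r _; apply: eq_bigr => s _.
  by rewrite [kern s r _ _ _]kern_flip.
rewrite !LE [n + m]addrC chain_kern_predl ?opprK //.
- by rewrite -abc; ring.
- by move=> s; rewrite kern_flip !opprK.
- by move=> r; rewrite kern_flip !opprK.
Qed.

(* A joint eigenfunction of the two q-Toda operators is determined by its value
   at the corner n = a, m = - c of the support of the kernel, where a single
   summand of the chain survives. *)
Lemma chain_kern_sorted (sigma : int) B (a b c n m : int) : a + b + c = sigma ->
    c <= b <= a -> 0 <= a -> c <= 0 -> n < B%:Z -> m < B%:Z ->
  chain sigma B (fun r s => kern r s a b c) n m =
  q ^ (- (a * b + a * c + b * c)) * kern n m a b c.
Proof.
move=> abc /andP[cb ba] a0 c0.
have ker0 r s : (r < a) || (s < - c) -> kern r s a b c = 0.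
  case/orP=> h; first by rewrite kern0 // h.
  by rewrite kern_swap23 kern_swap12 kern0 ?h ?orbT.
have kl s : kern (- 1) s a b c = 0 by apply: ker0; lia.
have kr r : kern r (- 1) a b c = 0 by apply: ker0; lia.
have [h nB mB|] := boolP ((n < a) || (m < - c)).
  rewrite ker0 // mulr0 /chain big1 // => r _; rewrite big1 // => s _.
  case/orP: h => h.
    have [rn|nr] := ltP n r%:Z; first by rewrite chain_coef0l ?mul0r.
    by rewrite ker0 ?mulr0 //; lia.
  have [sm|ms] := ltP m s%:Z; first by rewrite chain_coef0r ?mul0r.
  by rewrite ker0 ?mulr0 //; lia.
rewrite negb_or -!leNgt => /andP[an cm].
have [k] := ubnP (`|(n - a)%R| + `|(m + c)%R|)%N.
elim: k => // k IH in n m an cm * => hk nB mB.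
have [na|na] := ltP a n.
  have P0 : (1 - q ^ (n - a)) * (1 - q ^ (n - b)) * (1 - q ^ (n - c)) != 0.
    by rewrite !mulf_neq0 // subr_qz_neq0 //; lia.
  apply: (mulfI P0); rewrite -chain_kern_predl // mulrCA -kern_predl IH //.
  + by rewrite mulrCA.
  + by lia.
  + by lia.
  + by lia.
have [mc|mc] := ltP (- c) m.
  have P0 : (1 - q ^ (m + a)) * (1 - q ^ (m + b)) * (1 - q ^ (m + c)) != 0.
    by rewrite !mulf_neq0 // subr_qz_neq0 //; lia.
  apply: (mulfI P0); rewrite -chain_kern_predr // mulrCA -kern_predr IH //.
  + by rewrite mulrCA.
  + by lia.
  + by lia.
  + by lia.
have ea : n = `|a|%N%:Z by lia.
have ec : m = `|c|%N%:Z by lia.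
have aB : (`|a| < B)%N by lia.
have cB : (`|c| < B)%N by lia.
rewrite /chain (bigD1 (Ordinal aB)) //= (bigD1 (Ordinal cB)) //=.
rewrite [X in _ + X + _ = _]big1 ?addr0 => [|s sc]; last first.
  have {}sc : s%:Z != m by rewrite ec; apply: contra sc => /eqP[e]; apply/eqP/val_inj.
  have [sm|ms] := ltP m s%:Z; first by rewrite chain_coef0r ?mul0r.
  by rewrite ker0 ?mulr0 //; lia.
rewrite [X in _ + X = _]big1 ?addr0 => [|r ra]; last first.
  rewrite big1 // => s _.
  have {}ra : r%:Z != n by rewrite ea; apply: contra ra => /eqP[e]; apply/eqP/val_inj.
  have [rn|nr] := ltP n r%:Z; first by rewrite chain_coef0l ?mul0r.
  by rewrite ker0 ?mulr0 //; lia.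
rewrite -ea -ec /chain_coef !subrr iq0 !mulr1 /chain_wt; congr (q ^ _ * _).
by rewrite (_ : n = a) 1?(_ : m = - c) -?abc; [ring|lia|lia].
Qed.

(** Both sides are symmetric in a, b, c, which may thus be sorted. A sum equal to 0 or - 1 then
    forces c <= 0 <= a, so that the kernel vanishes at r = - 1 and at s = - 1, as the summation by
    parts demands. *)
Lemma chain_kern (sigma : int) B (a b c n m : int) : a + b + c = sigma ->
    sigma = 0 \/ sigma = - 1 -> n < B%:Z -> m < B%:Z ->
  chain sigma B (fun r s => kern r s a b c) n m =
  q ^ (- (a * b + a * c + b * c)) * kern n m a b c.
Proof.
have E12 x y z : chain sigma B (fun r s => kern r s x y z) n m =
    chain sigma B (fun r s => kern r s y x z) n m.
  by apply: eq_bigr => r _; apply: eq_bigr => s _; rewrite kern_swap12.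
have E23 x y z : chain sigma B (fun r s => kern r s x y z) n m =
    chain sigma B (fun r s => kern r s x z y) n m.
  by apply: eq_bigr => r _; apply: eq_bigr => s _; rewrite kern_swap23.
wlog ab : a b / b <= a => [H abc|].
  have [|/ltW] := leP b a; first by move=> ba; apply: H.
  move=> ab s01 nB mB; rewrite E12 H // 1?addrC 1?addrA // 1?[b + a]addrC //.
    by rewrite kern_swap12; congr (q ^ _ * _); ring.
  by rewrite -abc; ring.
wlog bc : a b c ab / c <= b => [H abc s01 nB mB|].
  have [cb|/ltW bc] := leP c b; first exact: H.
  have [ca|/ltW ac] := leP c a.
    rewrite E23 H //; last by rewrite -abc; ring.
    by rewrite kern_swap23; congr (q ^ _ * _); ring.
  rewrite E23 E12 H //; last by rewrite -abc; ring.
  by rewrite kern_swap12 kern_swap23; congr (q ^ _ * _); ring.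
move=> abc s01 nB mB; apply: chain_kern_sorted => //; first by rewrite bc ab.
  by case: s01; lia.
by case: s01; lia.
Qed.

(* The sum over the points of the hexagon max |a|, |b|, |c| <= B of the root
   lattice a + b + c = 0 of A2, weighted by the sign of the Weyl group element
   taking the residue class of (a, b, c) modulo 3 to that of (-1, 0, 1). *)
Definition tsum (B : nat) (g : int -> int -> int -> F) : F :=
  \sum_(a <- zrange B) \sum_(b <- zrange B) \sum_(c <- zrange B)
    if a + b + c == 0 then (chi3 (a - c))%:~R * g a b c else 0.

Lemma eq_tsum B g h :
    (forall a b c : int, a + b + c = 0 -> chi3 (a - c) != 0 ->
       g a b c = h a b c) ->
  tsum B g = tsum B h.
Proof.
move=> gh; apply: eq_bigr => a _; apply: eq_bigr => b _; apply: eq_bigr => c _.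
case: eqP => // s0; have [-> | nz] := eqVneq (chi3 (a - c)) 0.
  by rewrite !mul0r.
by rewrite gh.
Qed.

Lemma tsum_swap12 B g : tsum B (fun a b c => g b a c) = - tsum B g.
Proof.
rewrite /tsum exchange_big -sumrN; apply: eq_bigr => a _.
rewrite -sumrN; apply: eq_bigr => b _; rewrite -sumrN; apply: eq_bigr => c _.
rewrite [b + a]addrC; case: eqP => [s0|]; last by rewrite oppr0.
by rewrite (@chi3N (a - c) (b - c) (- c)) ?rmorphN ?mulNr //; lia.
Qed.

Lemma tsum_swap23 B g : tsum B (fun a b c => g a c b) = - tsum B g.
Proof.
rewrite /tsum -sumrN; apply: eq_bigr => a _.
rewrite exchange_big -sumrN; apply: eq_bigr => b _.
rewrite -sumrN; apply: eq_bigr => c _.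
rewrite addrAC; case: eqP => [s0|]; last by rewrite oppr0.
by rewrite (@chi3N (a - c) (a - b) a) ?rmorphN ?mulNr //; lia.
Qed.

Lemma tsumD B g h : tsum B (fun a b c => g a b c + h a b c) = tsum B g + tsum B h.
Proof.
rewrite /tsum -big_split; apply: eq_bigr => a _; rewrite -big_split.
apply: eq_bigr => b _; rewrite -big_split; apply: eq_bigr => c _ /=.
by case: ifP => _; rewrite ?mulrDr ?addr0.
Qed.

Lemma tsumZ B x g : tsum B (fun a b c => x * g a b c) = x * tsum B g.
Proof.
rewrite /tsum mulr_sumr; apply: eq_bigr => a _; rewrite mulr_sumr.
apply: eq_bigr => b _; rewrite mulr_sumr; apply: eq_bigr => c _.
by case: ifP => _; rewrite ?mulr0 // mulrCA.
Qed.

Lemma tsumN B g : tsum B (fun a b c => - g a b c) = - tsum B g.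
Proof.
by rewrite -[RHS]mulN1r -tsumZ; apply: eq_tsum => a b c _ _; rewrite mulN1r.
Qed.

Lemma tsumB B g h : tsum B (fun a b c => g a b c - h a b c) = tsum B g - tsum B h.
Proof. by rewrite tsumD tsumN. Qed.

Lemma tsum_sum B (I : Type) (s : seq I) (h : I -> int -> int -> int -> F) :
  tsum B (fun a b c => \sum_(r <- s) h r a b c) = \sum_(r <- s) tsum B (h r).
Proof.
elim: s => [|r s IH]; last first.
  rewrite big_cons -IH -tsumD.
  by apply: eq_tsum => a b c _ _; rewrite big_cons.
rewrite [RHS]big_nil -[RHS](mul0r (tsum B (fun _ _ _ => 1))) -tsumZ.
by apply: eq_tsum => a b c _ _; rewrite big_nil mul0r.
Qed.

Lemma self_opp_eq0 (x : F) : x = - x -> x = 0.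
Proof.
move/eqP; rewrite -addr_eq0 -mulr2n -mulr_natl mulf_eq0 (negPf two_neq0) /=.
by move/eqP.
Qed.

(** The contiguous relations below rest on this and its two companions: a difference is split into
    parts, each fixed by one transposition. *)
Lemma tsum_sym12 B g :
    (forall a b c : int, a + b + c = 0 -> chi3 (a - c) != 0 ->
       g b a c = g a b c) ->
  tsum B g = 0.
Proof.
move=> gs; apply: self_opp_eq0; rewrite -tsum_swap12.
by apply: eq_tsum => a b c s0 nz; rewrite [RHS]gs.
Qed.

Lemma tsum_sym23 B g :
    (forall a b c : int, a + b + c = 0 -> chi3 (a - c) != 0 ->
       g a c b = g a b c) ->
  tsum B g = 0.
Proof.
move=> gs; apply: self_opp_eq0; rewrite -tsum_swap23.
by apply: eq_tsum => a b c s0 nz; rewrite [RHS]gs.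
Qed.

Lemma tsum_sym13 B g :
    (forall a b c : int, a + b + c = 0 -> chi3 (a - c) != 0 ->
       g c b a = g a b c) ->
  tsum B g = 0.
Proof.
move=> gs; apply: self_opp_eq0.
rewrite -[X in - X]opprK -tsum_swap12 -tsum_swap23 -tsum_swap12.
by apply: eq_tsum => a b c s0 nz; rewrite [RHS]gs.
Qed.

(** * Three alternating sums of kernels and the action of a step on them *)

(** Normalised to 1 at (a, b, c) = (- 1, 0, 1), where [qexp] is 0 and the sign is 1. *)
Definition wt (k i j a c : int) : F := q ^ (k * qexp a c + i * (a + 1) + j * (1 - c)).

(** The two digits are the linear exponents of r and s in the step under which the sum is stable;
    see [qsum_S11], [qsum_S01] and [qsum_S00]. *)
Definition S11 B k i j n m : F :=
  tsum B (fun a b c => wt k i j a c * kern (n + 1) (m + 1) a b c).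

Definition S01 B k i j n m : F :=
  tsum B (fun a b c => wt k i j a c * kern n (m + 1) a b (c - 1)).

Definition S00 B k i j n m : F :=
  tsum B (fun a b c => wt k i j a c * kern n m (a + 1) b (c - 1)).

Definition qsum (N : nat) (i j : int) (f : int -> int -> F) (n m : int) : F :=
  \sum_(r < N) \sum_(s < N)
     q ^ (r%:Z * r%:Z - r%:Z * s%:Z + s%:Z * s%:Z + i * r%:Z + j * s%:Z) *
     (iq (n - r%:Z) * iq (m - s%:Z)) * f r s.

Lemma qsum_tsum N B i j (w : int -> int -> int -> F)
    (f : int -> int -> int -> int -> int -> F) n m :
  qsum N i j (fun r s => tsum B (fun a b c => w a b c * f r s a b c)) n m =
  tsum B (fun a b c => w a b c * qsum N i j (fun r s => f r s a b c) n m).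
Proof.
rewrite /qsum; under [RHS]eq_tsum => a b c _ _.
  rewrite mulr_sumr; under eq_bigr => r _ do rewrite mulr_sumr.
  over.
rewrite tsum_sum; apply: eq_bigr => r _; rewrite tsum_sum.
apply: eq_bigr => s _; rewrite -tsumZ; apply: eq_tsum => a b c _ _.
by rewrite mulrCA.
Qed.

Lemma kern_out n m a b c : [|| n < a, n < b, n < c, m < - a, m < - b | m < - c] ->
  kern n m a b c = 0.
Proof.
rewrite /kern => h.
have : [|| n - a < 0, n - b < 0, n - c < 0, m + a < 0, m + b < 0 | m + c < 0].
  by lia.
by do ![case/orP=> [/iq_lt0->|]; first by rewrite ?(mul0r, mulr0)];
   move=> /iq_lt0->; rewrite ?(mul0r, mulr0).
Qed.

(** The chain with sigma = 0, at r + 1 and s + 1 in place of r and s: its quadratic form becomes r^2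
    - r s + s^2 + r + s + 1. The extra 1 makes up for the - 1 in [qexp]. *)
Lemma qsum11_kern N (a b c n m : int) : a + b + c = 0 -> chi3 (a - c) != 0 ->
    n < N%:Z -> m < N%:Z ->
  qsum N 1 1 (fun r s => kern (r + 1) (s + 1) a b c) n m =
  q ^ (3 * qexp a c) * kern (n + 1) (m + 1) a b c.
Proof.
move=> abc ac nN mN; have ac0 : a != c.
  by apply: contra ac => /eqP->; rewrite subrr.
apply: (mulfI (qz_neq0 1)); rewrite mulrA -qzD qexpE //.
have := @chain_kern 0 N.+1 a b c (n + 1) (m + 1) abc (or_introl erefl).
rewrite (_ : 1 + _ = - (a * b + a * c + b * c)); last first.
  by rewrite (_ : b = - a - c); [ring | lia].
move=> <-; [|lia|lia].
(* The terms of the chain at r = 0 or s = 0 have no counterpart in [qsum]. They vanish because a, b,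
   c add up to 0 and are not all 0, so one is positive and one is negative. *)
rewrite /chain big_ord_recl big1 ?add0r => [|s _]; last first.
  by rewrite kern_out ?mulr0 //=; lia.
rewrite /qsum mulr_sumr; apply: eq_bigr => r _.
rewrite big_ord_recl /= kern_out ?mulr0 ?add0r; last by lia.
rewrite mulr_sumr; apply: eq_bigr => s _.
rewrite !(_ : forall x, (bump 0 x)%:Z = x%:Z + 1); try by move=> x; rewrite /bump; lia.
rewrite mulrA /chain_coef /chain_wt; congr (_ * _).
rewrite [LHS]mulrA -qzD; congr (q ^ _ * (iq _ * iq _)); ring.
Qed.

(** Only s is shifted, and the kernel has sigma = - 1. The resulting term - r of the quadratic form
    cancels against the linear part of [chain_wt]. *)
Lemma qsum01_kern N (a b c n m : int) : a + b + c = 0 -> chi3 (a - c) != 0 ->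
    n < N%:Z -> m < N%:Z ->
  qsum N 0 1 (fun r s => kern r (s + 1) a b (c - 1)) n m =
  q ^ (3 * qexp a c + (1 - c)) * kern n (m + 1) a b (c - 1).
Proof.
move=> abc ac nN mN.
have abc' : a + b + (c - 1) = - 1 by lia.
have := @chain_kern (- 1) N.+1 a b (c - 1) n (m + 1) abc' (or_intror erefl).
rewrite qexpE // (_ : _ + (1 - c) = - (a * b + a * (c - 1) + b * (c - 1))); last first.
  by rewrite (_ : b = - a - c); [ring | lia].
move=> <-; [|lia|lia].
rewrite /chain big_ord_recr /= [X in _ = _ + X]big1 ?addr0 => [|s _]; last first.
  by rewrite chain_coef0l ?mul0r //; lia.
apply: eq_bigr => r _.
rewrite big_ord_recl /= kern_out ?mulr0 ?add0r; last by lia.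
apply: eq_bigr => s _.
rewrite (_ : (bump 0 s)%:Z = s%:Z + 1); last by rewrite /bump; lia.
rewrite /chain_coef /chain_wt; congr (q ^ _ * (iq _ * iq _) * _); ring.
Qed.

Lemma qsum00_kern N (a b c n m : int) : a + b + c = 0 -> chi3 (a - c) != 0 ->
    n < N%:Z -> m < N%:Z ->
  qsum N 0 0 (fun r s => kern r s (a + 1) b (c - 1)) n m =
  q ^ (3 * qexp a c + (a + 1) + (1 - c)) * kern n m (a + 1) b (c - 1).
Proof.
move=> abc ac nN mN.
have abc' : a + 1 + b + (c - 1) = 0 by lia.
have := @chain_kern 0 N (a + 1) b (c - 1) n m abc' (or_introl erefl).
rewrite qexpE //.
rewrite (_ : _ + (1 - c) = - ((a + 1) * b + (a + 1) * (c - 1) + b * (c - 1))); last first.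
  by rewrite (_ : b = - a - c); [ring | lia].
move=> <- //; apply: eq_bigr => r _; apply: eq_bigr => s _.
rewrite /chain_coef /chain_wt; congr (q ^ _ * (iq _ * iq _) * _); ring.
Qed.

Lemma qsum_S11 N B k i j n m : n < N%:Z -> m < N%:Z ->
  qsum N 1 1 (S11 B k i j) n m = S11 B (k + 3) i j n m.
Proof.
move=> nN mN; rewrite /S11 qsum_tsum; apply: eq_tsum => a b c abc ac.
rewrite qsum11_kern // mulrA; congr (_ * _).
by rewrite /wt -qzD; congr (q ^ _); ring.
Qed.

Lemma qsum_S01 N B k i j n m : n < N%:Z -> m < N%:Z ->
  qsum N 0 1 (S01 B k i j) n m = S01 B (k + 3) i (j + 1) n m.
Proof.
move=> nN mN; rewrite /S01 qsum_tsum; apply: eq_tsum => a b c abc ac.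
rewrite qsum01_kern // mulrA; congr (_ * _).
by rewrite /wt -qzD; congr (q ^ _); ring.
Qed.

Lemma qsum_S00 N B k i j n m : n < N%:Z -> m < N%:Z ->
  qsum N 0 0 (S00 B k i j) n m = S00 B (k + 3) (i + 1) (j + 1) n m.
Proof.
move=> nN mN; rewrite /S00 qsum_tsum; apply: eq_tsum => a b c abc ac.
rewrite qsum00_kern // mulrA; congr (_ * _).
by rewrite /wt -qzD; congr (q ^ _); ring.
Qed.

(** * Contiguous relations between the alternating sums *)

Lemma kern01E n m a b c :
    n + m + 1 + 1 != 0 ->
  kern n (m + 1) a b (c - 1) = (1 - q ^ (n + 1 - a)) * (1 - q ^ (n + 1 - b)) *
    (1 - q ^ (m + 1 + c)) * kern (n + 1) (m + 1) a b c / (1 - q ^ (n + m + 1 + 1)).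
Proof.
move=> nm0; have nm1 := subr_qz_neq0 nm0; apply: (mulIf nm1); rewrite divfK //.
have [h|h] := ltP 0 (n + m + 1 + 1); last by rewrite !kern_lt0 ?(mulr0, mul0r) //; lia.
rewrite /kern !(_ : forall x, n - x = n + 1 - x - 1); try by move=> x; ring.
rewrite (_ : m + 1 + (c - 1) = m + 1 + c - 1); last by ring.
rewrite (_ : n + 1 - (c - 1) - 1 = n + 1 - c); last by ring.
rewrite (_ : n + 1 + (m + 1) = n + m + 1 + 1); last by ring.
rewrite (_ : n + (m + 1) = n + m + 1 + 1 - 1); last by ring.
rewrite !iq_pred [qfacz (n + m + 1 + 1)]qfacz_pred //; ring.
Qed.

Lemma kern00E n m a b c : n + m + 1 != 0 ->
  kern n m (a + 1) b (c - 1) = (1 - q ^ (n - a)) * (1 - q ^ (m + 1 + b)) *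
    (1 - q ^ (m + c)) * kern n (m + 1) a b (c - 1) / (1 - q ^ (n + m + 1)).
Proof.
move=> nm0; have nm1 := subr_qz_neq0 nm0; apply: (mulIf nm1); rewrite divfK //.
have [h|h] := ltP 0 (n + m + 1); last by rewrite !kern_lt0 ?(mulr0, mul0r) //; lia.
rewrite /kern.
rewrite (_ : n - (a + 1) = n - a - 1); last by ring.
rewrite (_ : m + b = m + 1 + b - 1); last by ring.
rewrite (_ : m + (a + 1) = m + 1 + a); last by ring.
rewrite (_ : m + 1 + (c - 1) = m + c); last by ring.
rewrite (_ : m + (c - 1) = m + c - 1); last by ring.
rewrite (_ : n + (m + 1) = n + m + 1); last by ring.
rewrite !iq_pred [qfacz (n + m + 1)]qfacz_pred // addrK; ring.
Qed.

Lemma qz_sum0 (a b c : int) : a + b + c = 0 -> q ^ b = (q ^ a * q ^ c)^-1.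
Proof. by move=> abc; rewrite -qzD -qzN; congr (q ^ _); lia. Qed.

(** Expressed by the common kernel, which is symmetric in a, b, c, and multiplied by 1 - q^(n+m+2),
    the difference splits into three parts. They are invariant under the exchange of b and c, of a
    and b, and of a and c. *)
Lemma S11_S01 B k n m : n + m + 1 + 1 != 0 -> S11 B k 1 1 n m = S01 B k 1 1 n m.
Proof.
move=> nm0; have nm1 := subr_qz_neq0 nm0.
pose G a b c : F := q ^ (k * qexp a c) * kern (n + 1) (m + 1) a b c.
pose N := q ^ (n + 1); pose M := q ^ (m + 1).
apply/eqP; rewrite -subr_eq0 /S11 /S01 -tsumB; apply/eqP.
apply: (mulfI nm1); rewrite mulr0 -tsumZ.
transitivity (tsum B (fun a b c => (N * (q ^ a) ^+ 2 - N ^+ 2 * q ^ a + M * q ^ a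
     - N * M * (q ^ a) ^+ 2 * (q ^ b + q ^ c)) * (q ^+ 2 * G a b c))
  + tsum B (fun a b c => N * (q ^ a * q ^ b) * (q ^+ 2 * G a b c))
  + tsum B (fun a b c => (N ^+ 2 * M * (q ^ a * q ^ c) - N * M) *
       (q ^+ 2 * G a b c))); last first.
  rewrite tsum_sym23;
    last by move=> a b c abc ac; rewrite /G (qexp_sum0r abc) kern_swap23; ring.
  rewrite add0r tsum_sym12;
    last by move=> a b c abc ac; rewrite /G (qexp_sum0 abc) kern_swap12; ring.
  rewrite add0r tsum_sym13 //;
    by move=> a b c abc ac; rewrite /G qexpC (kern_swap12 _ _ c) kern_swap23
      (kern_swap12 _ _ b); ring.
rewrite -!tsumD; apply: eq_tsum => a b c abc ac.
rewrite kern01E // /wt /G (_ : _ + 1 * (1 - c) = k * qexp a c + (2 + a - c)); last by ring.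
rewrite (qzD (k * _)); move: (kern _ _ _ _ _) (q ^ (k * _)) nm1 => K Q.
rewrite (_ : n + m + 1 + 1 = (n + 1) + (m + 1)); last by ring.
rewrite (_ : q ^ (2 + a - c) = q ^+ 2 * q ^ a / q ^ c); last first.
  by rewrite !qzD qzN.
rewrite !(qzD (n + 1)) !(qzD (m + 1)) !qzN -/N -/M (qz_sum0 abc).
have := qz_neq0 a; have := qz_neq0 c; move: (q ^ a) (q ^ c) N M => x z N M z0 x0 h.
by field; rewrite x0 z0 h ?oner_eq0.
Qed.

(** Here the whole difference, multiplied by 1 - q^(n+m+1), is symmetric in a and b. *)
Lemma S01_S00 B k j n m : n + m + 1 != 0 ->
  S01 B k 1 (j + 1) n m - q ^ (m + 1) * S01 B k 1 j n m = S00 B k 1 (j + 1) n m.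
Proof.
move=> nm0; have nm1 := subr_qz_neq0 nm0.
pose G a b c : F := q ^ (k * qexp a c + 1 + (j + 1) * (1 - c)) *
  (1 - q ^ (m + c)) * kern n (m + 1) a b (c - 1).
pose N := q ^ n; pose M := q ^ (m + 1).
apply/eqP; rewrite -subr_eq0 /S01 /S00 -tsumZ -!tsumB; apply/eqP.
apply: (mulfI nm1); rewrite mulr0 -tsumZ.
transitivity (tsum B (fun a b c =>
    (N - N * M * (q ^ a + q ^ b) + M * (q ^ a * q ^ b)) * G a b c)); last first.
  rewrite tsum_sym12 // => a b c abc ac.
  by rewrite /G (qexp_sum0 abc) kern_swap12; ring.
apply: eq_tsum => a b c abc ac.
have -> : wt k 1 (j + 1) a c =
    q ^ (k * qexp a c + 1 + (j + 1) * (1 - c)) * q ^ a.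
  by rewrite -qzD; congr (q ^ _); ring.
have -> : wt k 1 j a c =
    q ^ (k * qexp a c + 1 + (j + 1) * (1 - c)) * q ^ a * (q ^ (m + c) / q ^ (m + 1)).
  by rewrite -qzN -!qzD; congr (q ^ _); ring.
rewrite kern00E // /G.
rewrite (_ : n + m + 1 = n + (m + 1)) in nm1 *; last by ring.
move: (kern _ _ _ _ _) (q ^ (k * qexp a c + 1 + (j + 1) * (1 - c))) => K Q.
move: (q ^ (m + c)) nm1 => E.
rewrite !(qzD n) !(qzD (m + 1)) !qzN -/N -/M (qz_sum0 abc).
have := qz_neq0 a; have := qz_neq0 c; have : M != 0 := qz_neq0 (m + 1).
move: (q ^ a) (q ^ c) N M => x z N M M0 z0 x0 h.
by field; rewrite x0 z0 h M0 ?oner_eq0.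
Qed.

(** Two parts occur, one symmetric in b and c and one in a and c. The relation serves to eliminate
    the sum with j = 0 in [S11_S00]. *)
Lemma S01_10 B k n m : n + m + 1 + 1 != 0 ->
  S01 B k 1 0 n m = q ^ n * S01 B k 1 1 n m.
Proof.
move=> nm0; have nm1 := subr_qz_neq0 nm0.
pose N := q ^ (n + 1); pose M := q ^ (m + 1).
pose G a b c : F := q * (1 - N / q ^ a) * (1 - N / q ^ b) * (1 - N / q ^ c) *
   q ^ (k * qexp a c) * kern (n + 1) (m + 1) a b c.
apply/eqP; rewrite -subr_eq0 /S01 -tsumZ -!tsumB; apply/eqP.
apply: (mulfI nm1); rewrite mulr0 -tsumZ.
transitivity (tsum B (fun a b c => q ^ a * G a b c)
  - tsum B (fun a b c => M * (q ^ a * q ^ c) * G a b c)); last first.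
  rewrite tsum_sym23;
    last by move=> a b c abc ac; rewrite /G (qexp_sum0r abc) kern_swap23; ring.
  rewrite sub0r tsum_sym13 ?oppr0 //;
    by move=> a b c abc ac; rewrite /G qexpC (kern_swap12 _ _ c) kern_swap23
      (kern_swap12 _ _ b); ring.
rewrite -!tsumB; apply: eq_tsum => a b c abc ac.
rewrite kern01E // /wt /G.
rewrite (_ : _ + 0 * (1 - c) = k * qexp a c + (1 + a)); last by ring.
rewrite (_ : _ + 1 * (1 - c) = k * qexp a c + (2 + a - c)); last by ring.
rewrite !(qzD (k * _)); move: (kern _ _ _ _ _) (q ^ (k * _)) nm1 => K Q.
rewrite (_ : n + m + 1 + 1 = (n + 1) + (m + 1)); last by ring.
rewrite (_ : q ^ (2 + a - c) = q ^+ 2 * q ^ a / q ^ c); last first.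
  by rewrite !qzD qzN.
rewrite (_ : q ^ n = N / q); last by rewrite /N qzD mulfK.
rewrite (_ : q ^ (1 + a) = q * q ^ a); last by rewrite qzD.
rewrite !(qzD (n + 1)) !(qzD (m + 1)) !qzN -/N -/M (qz_sum0 abc).
have := qz_neq0 a; have := qz_neq0 c; rewrite {}/G.
move: (q ^ a) (q ^ c) N M => x z N M z0 x0 h.
by field; rewrite x0 z0 h ?q_neq0 ?oner_eq0.
Qed.

Lemma S11_S00 B k n m : n + m + 1 != 0 -> n + m + 1 + 1 != 0 ->
  (1 - q ^ (n + m + 1)) * S11 B k 1 1 n m = S00 B k 1 1 n m.
Proof.
move=> h1 h2; have := @S01_S00 B k 0 n m h1; rewrite add0r => <-.
rewrite S11_S01 // S01_10 // mulrA -qzD (_ : m + 1 + n = n + m + 1); last by ring.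
by rewrite mulrBl mul1r.
Qed.

(** * Lattice translations and the evaluation of the initial alternating sum *)

Lemma big_uniq_supp (I : eqType) (s t : seq I) (f : I -> F) : uniq s -> uniq t ->
    (forall x, x \in s -> x \notin t -> f x = 0) ->
    (forall x, x \in t -> x \notin s -> f x = 0) ->
  \sum_(x <- s) f x = \sum_(x <- t) f x.
Proof.
move=> us ut st ts.
rewrite (bigID (mem t)) /= [X in _ + X]big_seq_cond [X in _ + X]big1 ?addr0.
  rewrite [RHS](bigID (mem s)) /= [X in _ = _ + X]big_seq_cond.
  rewrite [X in _ = _ + X]big1 ?addr0.
    rewrite -[LHS]big_filter -[RHS]big_filter; apply: perm_big; apply: uniq_perm.
    - exact: filter_uniq.
    - exact: filter_uniq.
    - by move=> x; rewrite !mem_filter andbC.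
  by move=> x /andP[]; exact: ts.
by move=> x /andP[]; exact: st.
Qed.

Lemma sum_zrange_shift B d (f : int -> F) : `|d| <= B%:Z ->
    (forall x, B%:Z < `|x| + `|d| -> f x = 0) ->
  \sum_(x <- zrange B) f (x + d) = \sum_(x <- zrange B) f x.
Proof.
move=> dB f0; rewrite -(big_map (fun x => x + d) predT f).
have addI : injective (fun x : int => x + d) by exact: addIr.
apply: big_uniq_supp; rewrite ?(map_inj_uniq addI) ?zrange_uniq //.
  by move=> _ /mapP[x _ ->]; rewrite mem_zrange => h; apply: f0; lia.
move=> x; rewrite mem_zrange => h h'.
have : x - d \notin zrange B.
  by apply: contra h' => xd; apply/mapP; exists (x - d); rewrite ?subrK.
by rewrite mem_zrange => h''; apply: f0; lia.
Qed.

(** The translation by (1, 1, - 2) moves a - c by 3 and so keeps the sign; a summand that vanishes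
    near the boundary does not notice that the hexagon is moved. *)
Lemma tsum_shift B (g : int -> int -> int -> F) : (2 <= B)%N ->
    (forall a b c : int, a + b + c = 0 ->
       [|| B%:Z < `|a| + 2, B%:Z < `|b| + 2 | B%:Z < `|c| + 2] -> g a b c = 0) ->
  tsum B (fun a b c => g (a + 1) (b + 1) (c - 2)) = tsum B g.
Proof.
move=> B2 g0; pose h a b c : F :=
  if a + b + c == 0 then (chi3 (a - c))%:~R * g a b c else 0.
have h0 a b c : [|| B%:Z < `|a| + 2, B%:Z < `|b| + 2 | B%:Z < `|c| + 2] ->
    h a b c = 0.
  by rewrite /h; case: eqP => // abc /(g0 _ _ _ abc)->; rewrite mulr0.
transitivity (\sum_(a <- zrange B) \sum_(b <- zrange B) \sum_(c <- zrange B)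
    h (a + 1) (b + 1) (c - 2)).
  apply: eq_bigr => a _; apply: eq_bigr => b _; apply: eq_bigr => c _.
  rewrite /h (_ : a + 1 + (b + 1) + (c - 2) = a + b + c); last by ring.
  by rewrite (@chi3D (a - c) (a + 1 - (c - 2)) (- 1)) //; ring.
rewrite (@sum_zrange_shift B 1 (fun a => \sum_(b <- zrange B)
  \sum_(c <- zrange B) h a (b + 1) (c - 2))); [|lia|]; last first.
  by move=> a aB; rewrite big1 // => b _; rewrite big1 // => c _; rewrite h0 //; lia.
apply: eq_bigr => a _.
rewrite (@sum_zrange_shift B 1 (fun b => \sum_(c <- zrange B) h a b (c - 2)));
  [|lia|]; last first.
  by move=> b bB; rewrite big1 // => c _; rewrite h0 //; lia.
apply: eq_bigr => b _.
rewrite (@sum_zrange_shift B (- 2) (fun c => h a b c)) => [//||c cB].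
  by lia.
by rewrite h0 //; lia.
Qed.

(** An alternating trilinear form, because the sign is antisymmetric and [qexp] symmetric. It is
    computed with like a determinant: repeated entries give 0. *)
Definition alt3 B (f g h : int -> F) : F :=
  tsum B (fun a b c => q ^ (2 * qexp a c) * (f a * g b * h c)).

Lemma alt3_swap12 B f g h : alt3 B g f h = - alt3 B f g h.
Proof.
rewrite /alt3 -tsum_swap12; apply: eq_tsum => a b c abc _.
by rewrite (qexp_sum0 abc); ring.
Qed.

Lemma alt3_swap23 B f g h : alt3 B f h g = - alt3 B f g h.
Proof.
rewrite /alt3 -tsum_swap23; apply: eq_tsum => a b c abc _.
by rewrite (qexp_sum0r abc); ring.
Qed.

Lemma alt3_12 B f h : alt3 B f f h = 0.
Proof. by apply: self_opp_eq0; rewrite -alt3_swap12. Qed.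

Lemma alt3_23 B f h : alt3 B h f f = 0.
Proof. by apply: self_opp_eq0; rewrite -alt3_swap23. Qed.

Lemma alt3_13 B f h : alt3 B f h f = 0.
Proof. by rewrite alt3_swap23 alt3_12 oppr0. Qed.

Lemma alt3_shift B f g h : (2 <= B)%N ->
    (forall x, B%:Z < `|x| + 2 -> [/\ f x = 0, g x = 0 & h (x + 3) = 0]) ->
  alt3 B f g (fun x => q ^ (2 * x) * h (x + 3)) =
  q ^ (- 2) * alt3 B (fun x => f (x + 1)) (fun x => g (x + 1)) (fun x => h (x + 1)).
Proof.
move=> B2 supp; rewrite /alt3 -tsum_shift //.
  rewrite -tsumZ; apply: eq_tsum => a b c _ _.
  rewrite qexp_shift (_ : c - 2 + 3 = c + 1); last by ring.
  rewrite (_ : q ^ (2 * (qexp a c + (1 - c))) =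
     q ^ (- 2) * q ^ (2 * qexp a c) / q ^ (2 * (c - 2))).
    have := qz_neq0 (2 * (c - 2)); move: (q ^ (2 * (c - 2))) (q ^ (2 * qexp a c)).
    by move: (q ^ (- 2)) => U T V T0; field.
  by rewrite -qzN -!qzD; congr (q ^ _); ring.
by move=> a b c _ /or3P[] /supp[e1 e2 e3]; rewrite ?e1 ?e2 ?e3 ?(mul0r, mulr0).
Qed.

(** The q-binomial coefficient of n + m over n - x, without its factor (q)_(n+m), and with a linear
    weight q^(t x) that the two q-Pascal rules change. *)
Definition ubin (n m t x : int) : F := q ^ (t * x) * (iq (n - x) * iq (m + x)).

Lemma ubin0 n m t x : (n < x) || (x < - m) -> ubin n m t x = 0.
Proof.
rewrite /ubin => h; have [h1|h1] := ltP (n - x) 0.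
  by rewrite (iq_lt0 h1) ?(mul0r, mulr0).
by rewrite (@iq_lt0 (m + x)) ?(mul0r, mulr0) //; lia.
Qed.

Lemma ubin_pascal1 n m t x : (1 - q ^ (n + m)) * ubin n m t x =
  ubin n (m - 1) t x + q ^ m * ubin (n - 1) m (t + 1) x.
Proof.
rewrite /ubin (_ : n - 1 - x = n - x - 1); last by ring.
rewrite (_ : m - 1 + x = m + x - 1); last by ring.
rewrite (_ : (t + 1) * x = t * x + x); last by ring.
rewrite !iq_pred !qzD !qzN.
by have := qz_neq0 x; set X := q ^ x => X0; field.
Qed.

Lemma ubin_pascal2 n m t x : (1 - q ^ (n + m)) * ubin n m t x =
  q ^ n * ubin n (m - 1) (t - 1) x + ubin (n - 1) m t x.
Proof.
rewrite /ubin (_ : n - 1 - x = n - x - 1); last by ring.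
rewrite (_ : m - 1 + x = m + x - 1); last by ring.
rewrite (_ : (t - 1) * x = t * x - x); last by ring.
rewrite !iq_pred !qzD !qzN.
by have := qz_neq0 x; set X := q ^ x => X0; field.
Qed.

Lemma ubinS n m t x : ubin n m t (x + 1) = q ^ t * ubin (n - 1) (m + 1) t x.
Proof.
rewrite /ubin mulrDr mulr1 qzD (_ : n - (x + 1) = n - 1 - x); last by ring.
rewrite (_ : m + (x + 1) = m + 1 + x); last by ring.
by ring.
Qed.

Lemma ubin_shift3 n m t x : ubin (n - 3) (m + 3) (t + 2) x =
  q ^ (- (3 * t)) * (q ^ (2 * x) * ubin n m t (x + 3)).
Proof.
rewrite /ubin (_ : n - (x + 3) = n - 3 - x); last by ring.
rewrite (_ : m + (x + 3) = m + 3 + x); last by ring.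
rewrite !mulrA -!qzD; congr (q ^ _ * _ * _); ring.
Qed.

Lemma eq_alt3 B f f' g g' h h' : f =1 f' -> g =1 g' -> h =1 h' ->
  alt3 B f g h = alt3 B f' g' h'.
Proof. by move=> ff gg hh; apply: eq_tsum => a b c _ _; rewrite ff gg hh. Qed.

Lemma alt3Z B x y z f g h :
  alt3 B (fun a => x * f a) (fun b => y * g b) (fun c => z * h c) =
  x * y * z * alt3 B f g h.
Proof. by rewrite /alt3 -tsumZ; apply: eq_tsum => a b c _ _; ring. Qed.

Lemma alt3_ubinD B d n1 n2 n3 m1 m2 m3 t1 t2 t3 :
  alt3 B (ubin n1 m1 (t1 + d)) (ubin n2 m2 (t2 + d)) (ubin n3 m3 (t3 + d)) =
  alt3 B (ubin n1 m1 t1) (ubin n2 m2 t2) (ubin n3 m3 t3).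
Proof.
apply: eq_tsum => a b c abc _; rewrite /ubin !mulrDl !qzD.
have -> : q ^ (d * b) = (q ^ (d * a) * q ^ (d * c))^-1.
  by rewrite -qzD -qzN (_ : b = - a - c); [congr (q ^ _); ring | lia].
have := qz_neq0 (d * a); have := qz_neq0 (d * c).
move: (q ^ (d * a)) (q ^ (d * c)) => x z z0 x0; field.
by rewrite x0 z0.
Qed.

(** An entry three places away from the others is brought close to them. The bounds on n and m keep
    the supports inside the hexagon under the translation. *)
Lemma alt3_ubin_shift B n1 n2 n3 m1 m2 m3 t1 t2 t3 : (2 <= B)%N ->
    [/\ n1 + 1 < B%:Z, n2 + 1 < B%:Z & n3 + 1 < B%:Z + 3] ->
    [/\ m1 + 1 < B%:Z, m2 + 1 < B%:Z & m3 + 4 < B%:Z] ->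
  alt3 B (ubin n1 m1 t1) (ubin n2 m2 t2) (ubin (n3 - 3) (m3 + 3) (t3 + 2)) =
  q ^ (t1 + t2 - 2 * t3 - 2) *
  alt3 B (ubin (n1 - 1) (m1 + 1) t1) (ubin (n2 - 1) (m2 + 1) t2)
         (ubin (n3 - 1) (m3 + 1) t3).
Proof.
move=> B2 [nB1 nB2 nB3] [mB1 mB2 mB3].
transitivity (q ^ (- (3 * t3)) * alt3 B (ubin n1 m1 t1) (ubin n2 m2 t2)
    (fun x => q ^ (2 * x) * ubin n3 m3 t3 (x + 3))).
  rewrite -[q ^ (- _)]mul1r -[X in X * _ * _]mulr1 -alt3Z.
  apply: eq_alt3 => x; rewrite ?mul1r //; exact: ubin_shift3.
rewrite alt3_shift //; last by move=> x xB; split; apply: ubin0; lia.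
rewrite (@eq_alt3 B _ (fun x => q ^ t1 * ubin (n1 - 1) (m1 + 1) t1 x)
  _ (fun x => q ^ t2 * ubin (n2 - 1) (m2 + 1) t2 x)
  _ (fun x => q ^ t3 * ubin (n3 - 1) (m3 + 1) t3 x)); try exact: ubinS.
rewrite alt3Z !mulrA -!qzD; congr (q ^ _ * _); ring.
Qed.

Lemma alt3_lin1 B x f f' g h :
  alt3 B (fun a => f a + x * f' a) g h = alt3 B f g h + x * alt3 B f' g h.
Proof. by rewrite /alt3 -tsumZ -tsumD; apply: eq_tsum => a b c _ _; ring. Qed.

Lemma alt3_lin2 B x f g g' h :
  alt3 B f (fun a => g a + x * g' a) h = alt3 B f g h + x * alt3 B f g' h.
Proof. by rewrite /alt3 -tsumZ -tsumD; apply: eq_tsum => a b c _ _; ring. Qed.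

Lemma alt3_lin3 B x f g h h' :
  alt3 B f g (fun a => h a + x * h' a) = alt3 B f g h + x * alt3 B f g h'.
Proof. by rewrite /alt3 -tsumZ -tsumD; apply: eq_tsum => a b c _ _; ring. Qed.

(** Four of the eight terms have a repeated entry. *)
Lemma alt3_expand4 B x y z f0 f1 f2 f3 :
  alt3 B (fun a => f0 a + x * f1 a) (fun a => f1 a + y * f2 a)
         (fun a => f2 a + z * f3 a) =
  alt3 B f0 f1 f2 + x * y * z * alt3 B f1 f2 f3 + z * alt3 B f0 f1 f3
    + y * z * alt3 B f0 f2 f3.
Proof.
rewrite alt3_lin1 !alt3_lin2 !alt3_lin3 !alt3_12 !alt3_23; ring.
Qed.

Lemma alt3_expand3 B x y z f g h :
  alt3 B (fun a => f a + x * g a) (fun a => g a + y * h a)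
         (fun a => g a + z * f a) = - y * (1 - x * z) * alt3 B f g h.
Proof.
rewrite alt3_lin1 !alt3_lin2 !alt3_lin3 !alt3_12 !alt3_23 !alt3_13.
rewrite (alt3_swap23 _ _ g) (alt3_swap23 _ _ f) (alt3_swap12 _ f); ring.
Qed.

Lemma alt3_expand2 B x y z f g h h' :
  alt3 B (fun a => f a + x * g a) (fun a => h a + y * h' a)
         (fun a => g a + z * f a) =
  - (1 - x * z) * (alt3 B f g h + y * alt3 B f g h').
Proof.
rewrite alt3_lin1 !alt3_lin2 !alt3_lin3 !alt3_13.
rewrite !(alt3_swap23 _ _ g) !(alt3_swap23 _ _ f) !(alt3_swap12 _ f); ring.
Qed.

(** With the factor - q^2 (q)_(n+m) this is [S00] at k = 2 and i = j = 1, as found in the proof of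
    [S11_init]. Each entry turns into the next one when n, m, t change by - 1, 1, 1, just as the two
    terms of the rule [ubin_pascal1] differ. *)
Definition A3 B n m : F :=
  alt3 B (ubin (n + 1) (m - 1) (- 1)) (ubin n m 0) (ubin (n - 1) (m + 1) 1).

(* The mixed triples of alt3_mixed1 and alt3_mixed2 are those produced by the
   q-Pascal rules. *)
Lemma alt3_mixed1 B n m : n + m - 1 != 0 ->
  alt3 B (ubin n (m - 1) (- 1)) (ubin (n - 1) m 0) (ubin n (m - 1) 0) =
  - q ^ m * A3 B (n - 1) (m - 1) / (1 - q ^ (n + m - 1)) ^+ 2.
Proof.
move=> nm0; have := subr_qz_neq0 nm0; set p := q ^ _ => p1.
have p3 : (1 - p) * (1 - p) * (1 - p) != 0 by rewrite !mulf_neq0.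
apply: (mulfI p3); rewrite -alt3Z.
(* With the rules 1, 1, 2 the three entries expand into only three functions, and [alt3_expand3]
   leaves a single determinant. *)
rewrite (@eq_alt3 B _
  (fun x => ubin n (m - 2) (- 1) x + q ^ (m - 1) * ubin (n - 1) (m - 1) 0 x)
  _ (fun x => ubin (n - 1) (m - 1) 0 x + q ^ m * ubin (n - 2) m 1 x)
  _ (fun x => ubin (n - 1) (m - 1) 0 x + q ^ n * ubin n (m - 2) (- 1) x)).
- rewrite alt3_expand3 /A3 !subrK (_ : n - 1 - 1 = n - 2); last by ring.
  rewrite (_ : m - 1 - 1 = m - 2); last by ring.
  rewrite -qzD (_ : m - 1 + n = n + m - 1) -/p; last by ring.
  by move: (alt3 _ _ _ _) => A; field.
- move=> x; rewrite /p (_ : n + m - 1 = n + (m - 1)); last by ring.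
  rewrite ubin_pascal1 (_ : m - 1 - 1 = m - 2); last by ring.
  by [].
- move=> x; rewrite /p (_ : n + m - 1 = n - 1 + m); last by ring.
  by rewrite ubin_pascal1 (_ : n - 1 - 1 = n - 2) //; ring.
- move=> x; rewrite /p (_ : n + m - 1 = n + (m - 1)); last by ring.
  by rewrite ubin_pascal2 (_ : m - 1 - 1 = m - 2) 1?addrC //; ring.
Qed.

Lemma alt3_mixed2 B n m : (2 <= B)%N -> n + 3 < B%:Z -> m + 3 < B%:Z ->
    n + m - 1 != 0 ->
  alt3 B (ubin n (m - 1) (- 1)) (ubin (n - 2) (m + 1) 1) (ubin n (m - 1) 0) =
  - q ^ (n - 1) * A3 B (n - 1) (m - 1) / (1 - q ^ (n + m - 1)) ^+ 2.
Proof.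
move=> B2 nB mB nm0; have := subr_qz_neq0 nm0; set p := q ^ _ => p1.
have p3 : (1 - p) * (1 - p) * (1 - p) != 0 by rewrite !mulf_neq0.
apply: (mulfI p3); rewrite -alt3Z.
rewrite (@eq_alt3 B _
  (fun x => ubin n (m - 2) (- 1) x + q ^ (m - 1) * ubin (n - 1) (m - 1) 0 x)
  _ (fun x => ubin (n - 3) (m + 1) 1 x + q ^ (n - 2) * ubin (n - 2) m 0 x)
  _ (fun x => ubin (n - 1) (m - 1) 0 x + q ^ n * ubin n (m - 2) (- 1) x)).
- rewrite alt3_expand2.
  (* After the translation the first and the third entry coincide. *)
  have -> : alt3 B (ubin n (m - 2) (- 1)) (ubin (n - 1) (m - 1) 0)
      (ubin (n - 3) (m + 1) 1) = 0.
    have := @alt3_ubin_shift B n (n - 1) n (m - 2) (m - 1) (m - 2) (- 1) 0 (- 1) B2.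
    rewrite (_ : m - 2 + 3 = m + 1); last by ring.
    rewrite (_ : - 1 + 2 = 1) // => ->; [|by split; lia..].
    by rewrite alt3_13 mulr0.
  (* The translated entries are those of [A3 B (n - 1) (m - 1)], permuted cyclically and with all
     linear weights lowered by 1, which does not matter as a + b + c = 0. *)
  have -> : alt3 B (ubin n (m - 2) (- 1)) (ubin (n - 1) (m - 1) 0)
      (ubin (n - 2) m 0) = q * A3 B (n - 1) (m - 1).
    have := @alt3_ubin_shift B n (n - 1) (n + 1) (m - 2) (m - 1) (m - 3) (- 1) 0 (- 2) B2.
    rewrite (_ : m - 3 + 3 = m); last by ring.
    rewrite (_ : n + 1 - 3 = n - 2); last by ring.
    rewrite (_ : - 2 + 2 = 0) // => ->; [|by split; lia..].
    rewrite -(@alt3_ubinD B 1) alt3_swap23 alt3_swap12.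
    rewrite /A3 !subrK addrK (_ : n - 1 - 1 = n - 2); last by ring.
    rewrite (_ : m - 2 + 1 = m - 1); last by ring.
    rewrite (_ : m - 3 + 1 = m - 2); last by ring.
    rewrite (_ : m - 1 - 1 = m - 2); last by ring.
    by rewrite (opprK (alt3 _ _ _ _)).
  rewrite -qzD (_ : m - 1 + n = n + m - 1) -/p; last by ring.
  rewrite (_ : n - 1 = n - 2 + 1) ?(qzD (n - 2)); last by ring.
  by move: (A3 _ _ _) (q ^ (n - 2)) => A Q; field.
- move=> x; rewrite /p (_ : n + m - 1 = n + (m - 1)); last by ring.
  rewrite ubin_pascal1 (_ : m - 1 - 1 = m - 2); last by ring.
  by [].
- move=> x; rewrite /p (_ : n + m - 1 = n - 2 + (m + 1)); last by ring.
  rewrite ubin_pascal2 (_ : n - 2 - 1 = n - 3); last by ring.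
  by rewrite addrC addrK.
- move=> x; rewrite /p (_ : n + m - 1 = n + (m - 1)); last by ring.
  by rewrite ubin_pascal2 (_ : m - 1 - 1 = m - 2) 1?addrC //; ring.
Qed.

(** The rule [ubin_pascal1] in all three entries yields four consecutive functions. Omitting the
    last or the first of them gives [A3] at a neighbouring point; the other two determinants are
    translated into the mixed ones. *)
Lemma A3_rec B n m : (2 <= B)%N -> n + 3 < B%:Z -> m + 3 < B%:Z ->
  (1 - q ^ (n + m)) ^+ 3 * A3 B n m =
  A3 B n (m - 1) + (q ^ m) ^+ 3 * A3 B (n - 1) m
  + q ^ (m - 2) *
      alt3 B (ubin n (m - 1) (- 1)) (ubin (n - 1) m 0) (ubin n (m - 1) 0)
  + q ^ (2 * m - 1) *
      alt3 B (ubin n (m - 1) (- 1)) (ubin (n - 2) (m + 1) 1) (ubin n (m - 1) 0).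
Proof.
move=> B2 nB mB.
rewrite !exprS expr0 mulr1 mulrA -alt3Z.
rewrite (@eq_alt3 B _
  (fun x => ubin (n + 1) (m - 2) (- 1) x + q ^ (m - 1) * ubin n (m - 1) 0 x)
  _ (fun x => ubin n (m - 1) 0 x + q ^ m * ubin (n - 1) m 1 x)
  _ (fun x => ubin (n - 1) m 1 x + q ^ (m + 1) * ubin (n - 2) (m + 1) 2 x)).
- rewrite alt3_expand4; congr (_ + _ + _ + _).
  + by rewrite /A3 subrK (_ : m - 1 - 1 = m - 2) //; ring.
  + rewrite /A3 !subrK -[in RHS](@alt3_ubinD B 1) (_ : n - 1 - 1 = n - 2); last by ring.
    rewrite (_ : - 1 + 1 = 0) // (_ : 1 + 1 = 2) // add0r; congr (_ * _).
    by rewrite (qzD m (- 1)) (qzD m 1) qzN expr1z; move: (q ^ m) => M; field.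
  + have := @alt3_ubin_shift B (n + 1) n (n + 1) (m - 2) (m - 1) (m - 2) (- 1) 0 0 B2.
    rewrite (_ : n + 1 - 3 = n - 2); last by ring.
    rewrite (_ : m - 2 + 3 = m + 1); last by ring.
    move=> ->; [|by split; lia..].
    rewrite (addrK 1 n) subrK (_ : m - 2 + 1 = m - 1); last by ring.
    by rewrite mulrA -qzD; congr (q ^ _ * _); ring.
  + have := @alt3_ubin_shift B (n + 1) (n - 1) (n + 1) (m - 2) m (m - 2) (- 1) 1 0 B2.
    rewrite (_ : n + 1 - 3 = n - 2); last by ring.
    rewrite (_ : m - 2 + 3 = m + 1); last by ring.
    move=> ->; [|by split; lia..].
    rewrite (addrK 1 n) (_ : m - 2 + 1 = m - 1); last by ring.
    rewrite (_ : n - 1 - 1 = n - 2); last by ring.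
    by rewrite mulrA -!qzD; congr (q ^ _ * _); ring.
- move=> x; rewrite (_ : n + m = n + 1 + (m - 1)); last by ring.
  rewrite ubin_pascal1 (_ : m - 1 - 1 = m - 2); last by ring.
  by rewrite addrK.
- by move=> x; rewrite ubin_pascal1.
- move=> x; rewrite (_ : n + m = n - 1 + (m + 1)); last by ring.
  rewrite ubin_pascal1 addrK (_ : n - 1 - 1 = n - 2); last by ring.
  by [].
Qed.

Lemma ubin_diag n t x : x != n -> ubin n (- n) t x = 0.
Proof. by move=> xn; apply: ubin0; lia. Qed.

Lemma ubin_diag1 n t : ubin n (- n) t n = q ^ (t * n).
Proof. by rewrite /ubin subrr addNr iq0 !mulr1. Qed.

(** Both outer entries are supported at the point n alone, while the sign vanishes for a = c. *)
Lemma alt3_diag B n m t t' g : n + m = 0 ->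
  alt3 B (ubin n m t) g (ubin n m t') = 0.
Proof.
move=> nm; have -> : m = - n by lia.
rewrite -(mul0r (alt3 B (ubin n m t) g (ubin n m t'))) -tsumZ.
apply: eq_tsum => a b c _ ac; rewrite mul0r.
have [an|an] := eqVneq a n; last by rewrite ubin_diag ?(mul0r, mulr0).
rewrite (@ubin_diag _ _ c) ?mulr0 //.
by apply: contra ac => /eqP->; rewrite an subrr.
Qed.

Lemma sum_zrange1 B (f : int -> F) x : `|x| <= B%:Z ->
    (forall y, y != x -> f y = 0) -> \sum_(y <- zrange B) f y = f x.
Proof.
move=> xB f0; rewrite (bigD1_seq x) ?zrange_uniq //=; last by rewrite mem_zrange; lia.
by rewrite big1 ?addr0.
Qed.

(** Every entry is supported at one point: n + 1, n and n - 1. Their sum 3 n must be 0, and (1, 0, -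
    1) has the sign - 1. *)
Lemma A3_00 B n : (2 <= B)%N -> A3 B n (- n) = - q ^ (- 2) * (n == 0)%:R.
Proof.
move=> B2; rewrite /A3 (_ : - n - 1 = - (n + 1)); last by ring.
rewrite (_ : - n + 1 = - (n - 1)); last by ring.
have [->|n0] := eqVneq n 0; last first.
  rewrite mulr0 -(mul0r (A3 B 0 0)) -tsumZ; apply: eq_tsum => a b c abc _.
  rewrite mul0r.
  have [an|an] := eqVneq a (n + 1); last by rewrite ubin_diag ?(mul0r, mulr0).
  have [bn|bn] := eqVneq b n; last by rewrite (@ubin_diag n) ?(mul0r, mulr0).
  by rewrite (@ubin_diag (n - 1)) ?mulr0 //; lia.
rewrite mulr1 add0r sub0r opprK oppr0 /alt3 /tsum.
rewrite (@sum_zrange1 _ _ 1); [|lia|]; last first.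
  move=> a a1; rewrite big1 // => b _; rewrite big1 // => c _.
  by rewrite ubin_diag // !(mul0r, mulr0) if_same.
rewrite (@sum_zrange1 _ _ 0); [|lia|]; last first.
  move=> b b1; rewrite big1 // => c _.
  by rewrite (@ubin_diag 0) // !(mul0r, mulr0) if_same.
rewrite (@sum_zrange1 _ _ (- 1)); [|lia|]; last first.
  move=> c c1; rewrite -{3}[1]opprK (@ubin_diag (- 1)) // !(mul0r, mulr0).
  by rewrite if_same.
rewrite (ubin_diag1 1) (ubin_diag1 0) (ubin_diag1 (- 1)).
rewrite (_ : chi3 (1 - - 1) = - 1) // (_ : qexp 1 (- 1) = 0) // eqxx.
by rewrite rmorphN1 mulN1r -!qzD.
Qed.

(** Induction on n + m. With the mixed determinants expressed by [A3 B (n - 1) (m - 1)], the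
    recurrence is closed, and the product satisfies it. *)
Lemma A3E B n m : n + 4 < B%:Z -> m + 4 < B%:Z -> 0 <= n + m ->
  A3 B n m = - q ^ (2 * (n * m) - 2) * (iq n * iq m * iq (n + m) ^+ 2).
Proof.
have [k] := ubnP (`|(n + m)%R|)%N.
elim: k => // k IH in n m * => hk nB mB nm0.
have B2 : (2 <= B)%N by lia.
have [nm|nm] := eqVneq (n + m) 0.
  have -> : m = - n by lia.
  rewrite A3_00 // addrN iq0 expr1n mulr1.
  have [->|n0] := eqVneq n 0; first by rewrite oppr0 iq0 !mulr1.
  have [nl|nl] := ltP n 0; first by rewrite (iq_lt0 nl) ?(mul0r, mulr0).
  by rewrite [iq (- n)]iq_lt0 ?(mul0r, mulr0) //; lia.
have P3 : (1 - q ^ (n + m)) ^+ 3 != 0 by rewrite expf_neq0 // subr_qz_neq0.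
apply: (mulfI P3); rewrite A3_rec //; [|lia|lia].
rewrite (IH n (m - 1)); [|lia|lia|lia|lia].
rewrite (IH (n - 1) m); [|lia|lia|lia|lia].
rewrite (_ : n - 1 + m = n + m - 1); last by ring.
rewrite (_ : n + (m - 1) = n + m - 1); last by ring.
rewrite !iq_pred.
have e1 : q ^ (2 * (n * (m - 1)) - 2) = q ^ (2 * (n * m) - 2) / (q ^ n) ^+ 2.
  by rewrite expr2 -!qzD -qzN -qzD; congr (q ^ _); ring.
have e2 : q ^ (2 * ((n - 1) * m) - 2) = q ^ (2 * (n * m) - 2) / (q ^ m) ^+ 2.
  by rewrite expr2 -!qzD -qzN -qzD; congr (q ^ _); ring.
(* For n + m = 1 the evaluation of the mixed determinants would divide by 0, but they vanish by
   [alt3_diag]. Only (0, 1) and (1, 0) give a nonzero product. *)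
have [nm1|nm1] := eqVneq (n + m - 1) 0.
  rewrite !alt3_diag ?mulr0 ?addr0; [|lia|lia].
  rewrite e1 e2 (_ : n + m = 1); last by lia.
  have mE : q ^ m = q / q ^ n.
    by rewrite (_ : m = 1 - n) ?qzD ?qzN ?expr1z //; lia.
  move: (q ^ (2 * (n * m) - 2)) => E; rewrite !expr1z.
  have [n0|n0] := eqVneq n 0.
    by rewrite mE n0 expr0z; field; rewrite ?q_neq0 ?oner_eq0.
  have [m0|m0] := eqVneq m 0.
    have n1 : n = 1 by lia.
    by rewrite m0 n1 expr0z expr1z; field; rewrite ?q_neq0 ?oner_eq0.
  have [nl|nl] := ltP n 0; first by rewrite (iq_lt0 nl); ring.
  by rewrite [iq m]iq_lt0; [ring | lia].
rewrite alt3_mixed1 ?(alt3_mixed2 _ _ _ nm1) //; [|lia|lia].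
rewrite (IH (n - 1) (m - 1)); [|lia|lia|lia|lia].
rewrite (_ : n - 1 + (m - 1) = n + m - 1 - 1); last by ring.
rewrite !iq_pred e1 e2.
have e3 : q ^ (2 * ((n - 1) * (m - 1)) - 2) =
    q ^ (2 * (n * m) - 2) * q ^+ 2 / ((q ^ n) ^+ 2 * (q ^ m) ^+ 2).
  rewrite (_ : q ^+ 2 = q ^ 2) // !expr2 -!qzD -qzN -qzD.
  by congr (q ^ _); ring.
have f1 : q ^ (m - 2) = q ^ m / q ^+ 2 by rewrite qzD qzN.
have f2 : q ^ (2 * m - 1) = (q ^ m) ^+ 2 / q.
  by rewrite (_ : 2 * m - 1 = m + m - 1) ?qzD ?qzN ?expr1z //; ring.
have f3 : q ^ (n - 1) = q ^ n / q by rewrite qzD qzN expr1z.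
have f4 : q ^ (n + m - 1) = q ^ (n + m) / q by rewrite (qzD _ (- 1)) qzN expr1z.
have p1 : 1 - q ^ (n + m) / q != 0 by rewrite -f4 subr_qz_neq0.
rewrite e3 f1 f2 f3 f4 (qzD n m) in p1 *.
have := qz_neq0 n; have := qz_neq0 m.
move: (q ^ (2 * (n * m) - 2)) (iq n) (iq m) (iq (n + m)) => E I J K.
move: (q ^ n) (q ^ m) p1 => X Y p1 Y0 X0.
have p2 : q - X * Y != 0.
  by rewrite (_ : q - X * Y = q * (1 - X * Y / q)) ?mulf_neq0 //; field.
field.
by rewrite ?X0 ?Y0 ?q_neq0 ?p2 ?oner_eq0.
Qed.

Lemma S11_init B (r s : nat) : (r + 5 < B)%N -> (s + 5 < B)%N ->
  S11 B 2 1 1 r s = q ^+ (2 * (r * s)) * (iq r * iq s * iq (r + s + 1)%N).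
Proof.
move=> rB sB.
have h1 : r%:Z + s%:Z + 1 != 0 by lia.
have h2 : r%:Z + s%:Z + 1 + 1 != 0 by lia.
apply: (mulfI (subr_qz_neq0 h1)); rewrite S11_S00 //.
transitivity (- q ^+ 2 * qfac (r + s) * A3 B r s).
  (* In [S00] the entries of [A3] stand in reverse order; this odd permutation accounts for the
     sign, and the constants in (a + 1) + (1 - c) for q^2. *)
  rewrite /A3 alt3_swap12 alt3_swap23 alt3_swap12 opprK !mulrN !mulNr opprK.
  rewrite /alt3 -tsumZ.
  apply: eq_tsum => a b c abc _; rewrite /kern /wt /ubin.
  rewrite (_ : r%:Z - (a + 1) = r%:Z - 1 - a); last by ring.
  rewrite (_ : s%:Z + (a + 1) = s%:Z + 1 + a); last by ring.
  rewrite (_ : r%:Z - (c - 1) = r%:Z + 1 - c); last by ring.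
  rewrite (_ : s%:Z + (c - 1) = s%:Z - 1 + c); last by ring.
  rewrite (_ : qfacz _ = qfac (r + s)) // (_ : _ + 1 * (1 - c) =
    2 * qexp a c + 2 + 1 * a + 0 * b + - 1 * c); last by ring.
  rewrite (qzD _ (- 1 * c)) (qzD _ (0 * b)) (qzD _ (1 * a)) (qzD _ 2); ring.
rewrite A3E; [|lia|lia|lia].
rewrite (_ : iq (r%:Z + s%:Z) = (qfac (r + s))^-1) //.
rewrite (_ : iq (r + s + 1)%N = (1 - q ^ (r%:Z + s%:Z + 1))^-1 * (qfac (r + s))^-1);
  last by rewrite -invfM addn1 /iq qfacS -addn1 !PoszD.
rewrite (_ : q ^ (2 * (r%:Z * s%:Z) - 2) = q ^+ (2 * (r * s)) / q ^+ 2); last first.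
  by rewrite qzD qzN.
have := subr_qz_neq0 h1; have := qfac_neq0 (r + s).
move: (qfac _) (1 - q ^ _) (iq r) (iq s) (q ^+ (2 * _)) => f p I J E f0 p0.
by field; rewrite f0 p0 q_neq0.
Qed.

(** * Triple sums with the linear exponents of the profiles *)

Lemma eq_qsum N i j (f g : int -> int -> F) n m :
    (forall r s : int, 0 <= r < N%:Z -> 0 <= s < N%:Z -> f r s = g r s) ->
  qsum N i j f n m = qsum N i j g n m.
Proof.
move=> fg; apply: eq_bigr => r _; apply: eq_bigr => s _; rewrite fg //.
  by have := ltn_ord r; lia.
by have := ltn_ord s; lia.
Qed.

(** Turns a difference of two steps with different linear exponents into one step applied to a
    combination, which a contiguous relation can simplify. *)
Lemma qsumB N i j d e (x : F) (f g : int -> int -> F) n m :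
  qsum N i j f n m - x * qsum N (i + d) (j + e) g n m =
  qsum N i j (fun r s => f r s - x * q ^ (d * r + e * s) * g r s) n m.
Proof.
rewrite /qsum mulr_sumr -sumrB; apply: eq_bigr => r _.
rewrite mulr_sumr -sumrB; apply: eq_bigr => s _.
rewrite (_ : _ + (j + e) * s%:Z = r%:Z * r%:Z - r%:Z * s%:Z + s%:Z * s%:Z
  + i * r%:Z + j * s%:Z + (d * r%:Z + e * s%:Z)); last by ring.
by rewrite (qzD (_ + j * s%:Z)); ring.
Qed.

Definition beta0 (r s : int) : F :=
  q ^ (2 * (r * s)) * (iq r * iq s * iq (r + s + 1)).

(* The triple sum with linear exponent r_(a+1) + ... + r_3 + s_(b+1) + ... + s_3. *)
Definition profile_sum N (a b : nat) (n m : int) : F :=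
  qsum N (a < 1)%N (b < 1)%N
    (qsum N (a < 2)%N (b < 2)%N (qsum N (a < 3)%N (b < 3)%N beta0)) n m.

Section ProfileSums.
Variables N B : nat.
Hypothesis NB : (N + 5 < B)%N.

Let agree (f g : int -> int -> F) : Prop :=
  forall r s : int, 0 <= r < N%:Z -> 0 <= s < N%:Z -> f r s = g r s.

Let agree_trans f g h : agree f g -> agree g h -> agree f h.
Proof. by move=> fg gh r s rN sN; rewrite fg // gh. Qed.

Let agree_qsum i j f g h : agree f g -> agree (qsum N i j g) h ->
  agree (qsum N i j f) h.
Proof. by move=> fg gh r s rN sN; rewrite -gh //; apply: eq_qsum. Qed.

Let agree_beta0 : agree beta0 (S11 B 2 1 1).
Proof.
by case=> // r [] // s rN sN; rewrite S11_init; [|lia|lia].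
Qed.

Let agree11 k f : agree f (S11 B k 1 1) ->
  agree (qsum N 1 1 f) (S11 B (k + 3) 1 1).
Proof.
by move=> fk; apply: agree_qsum fk _ => r s rN sN; rewrite qsum_S11 //; lia.
Qed.

Let agree01 k j f : agree f (S01 B k 1 j) ->
  agree (qsum N 0 1 f) (S01 B (k + 3) 1 (j + 1)).
Proof.
by move=> fk; apply: agree_qsum fk _ => r s rN sN; rewrite qsum_S01 //; lia.
Qed.

Let agree00 k i j f : agree f (S00 B k i j) ->
  agree (qsum N 0 0 f) (S00 B (k + 3) (i + 1) (j + 1)).
Proof.
by move=> fk; apply: agree_qsum fk _ => r s rN sN; rewrite qsum_S00 //; lia.
Qed.

Let agree_step f k : agree f (S11 B k 1 1) -> agree f (S01 B k 1 1).
Proof.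
by move=> fk; apply: agree_trans fk _ => r s rN sN; rewrite S11_S01 //; lia.
Qed.

Let combine11 k f g : agree f (S11 B k 1 1) -> agree g (S11 B k 1 1) ->
  agree (fun r s => qsum N 0 0 f r s - q * qsum N 1 1 g r s) (S00 B (k + 3) 2 2).
Proof.
move=> fk gk n m nN mN; rewrite (qsumB N 0 0 1 1).
apply: (@agree00 k 1 1) => // r s rN sN.
rewrite fk // gk // -S11_S00; [|lia|lia].
by rewrite !mul1r (qzD _ 1) expr1z; ring.
Qed.

Let combine01 k j f g : agree f (S01 B k 1 (j + 1)) -> agree g (S01 B k 1 j) ->
  agree (fun r s => qsum N 0 0 f r s - q * qsum N 0 1 g r s)
    (S00 B (k + 3) 2 (j + 2)).
Proof.
move=> fk gk n m nN mN; rewrite (qsumB N 0 0 0 1).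
rewrite (_ : j + 2 = j + 1 + 1); last by ring.
apply: (@agree00 k 1 (j + 1)) => // r s rN sN.
rewrite fk // gk // -S01_S00; last by lia.
by rewrite mul0r add0r mul1r (qzD s 1) expr1z; ring.
Qed.

Let combine00 k i j f g :
    agree (fun r s => f r s - q * g r s) (S00 B k i j) ->
  agree (fun r s => qsum N 0 0 f r s - q * qsum N 0 0 g r s)
    (S00 B (k + 3) (i + 1) (j + 1)).
Proof.
move=> fg n m nN mN; rewrite (qsumB N 0 0 0 0); apply: agree00 => // r s rN sN.
by rewrite -fg // !mul0r expr0z mulr1.
Qed.

(** The innermost 3 - a steps carry both exponents and keep [S11] with i = j = 1. After the passage
    to [S01], each of the a outer steps lacks the exponent r and raises j by 1. *)
Lemma profile_sum0 (a : nat) n m : (a <= 3)%N ->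
    0 <= n < N%:Z -> 0 <= m < N%:Z ->
  profile_sum N a 0 n m = S01 B 11 1 (a%:Z + 1) n m.
Proof.
move: n m; rewrite /profile_sum => n m; case: a => [|[|[|[|//]]]] _ /=; move: n m.
- exact: agree_step (agree11 (agree11 (agree11 agree_beta0))).
- exact: agree01 (agree_step (agree11 (agree11 agree_beta0))).
- exact: agree01 (agree01 (agree_step (agree11 agree_beta0))).
- exact: agree01 (agree01 (agree01 (agree_step agree_beta0))).
Qed.

(** The linear exponents of the two sums differ by r_(a+1) + s_(b+1), so the difference inserts the
    factor 1 - q^(r_(a+1) + s_(b+1) + 1). It collapses to [S00] at level b + 1 and passes unchanged
    in form through the b outer steps. *)
Lemma profile_sumS (a b : nat) n m : (b <= a)%N -> (a <= 2)%N ->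
    0 <= n < N%:Z -> 0 <= m < N%:Z ->
  profile_sum N a.+1 b.+1 n m - q * profile_sum N a b n m =
  S00 B 11 (b%:Z + 2) (a%:Z + 2) n m.
Proof.
rewrite /profile_sum.
case: a b => [|[|[|//]]] [|[|[|//]]] //= _ _; move: n m.
- exact: combine11 (agree11 (agree11 agree_beta0)) (agree11 (agree11 agree_beta0)).
- exact: combine01 (agree01 (agree_step (agree11 agree_beta0)))
                   (agree_step (agree11 (agree11 agree_beta0))).
- exact: combine00 (combine11 (agree11 agree_beta0) (agree11 agree_beta0)).
- exact: combine01 (agree01 (agree01 (agree_step agree_beta0)))
                   (agree01 (agree_step (agree11 agree_beta0))).
- exact: combine00 (combine01 (agree01 (agree_step agree_beta0))
                              (agree_step (agree11 agree_beta0))).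
- exact: combine00 (combine00 (combine11 agree_beta0 agree_beta0)).
Qed.

End ProfileSums.

(** * A finite form of the Jacobi triple product *)

Definition jtp_term (a : F) (n m x : int) : F :=
  (sgnz x)%:~R * q ^ (tri x) * a ^ x * (iq (n - x) * iq (m + x)).

Definition jtp_sum B (a : F) (n m : int) : F :=
  qfacz (n + m) * \sum_(x <- zrange B) jtp_term a n m x.

(** Write 1 - q^(n+m+1) as (1 - q^(n+1-x)) + q^(n+1-x) (1 - q^(m+x)). The first part yields the sum
    at n; the second, called [g], yields - a q^n times that sum after the shift of x by 1. *)
Lemma jtp_sumSl B a n m : a != 0 -> 0 <= n + m -> n + 1 < B%:Z -> m < B%:Z ->
  jtp_sum B a (n + 1) m = (1 - a * q ^ n) * jtp_sum B a n m.
Proof.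
move=> a0 nm0 nB mB; have aD x y : a ^ (x + y) = a ^ x * a ^ y by exact: expfzDr.
pose g x : F := (sgnz x)%:~R * q ^ (tri x) * a ^ x * q ^ (n + 1 - x) *
  (iq (n + 1 - x) * iq (m - 1 + x)).
have gS : \sum_(x <- zrange B) g x =
    - (a * q ^ n) * \sum_(x <- zrange B) jtp_term a n m x.
  rewrite -(@sum_zrange_shift B 1 g) ?mulr_sumr; [|lia|]; last first.
    move=> x xB; rewrite /g; have [h|h] := ltP (n + 1 - x) 0.
      by rewrite (iq_lt0 h) !(mul0r, mulr0).
    by rewrite (@iq_lt0 (m - 1 + x)) ?mulr0 //; lia.
  apply: eq_bigr => x _; rewrite /g /jtp_term sgnzS rmorphN triS aD expr1z.
  rewrite (_ : n + 1 - (x + 1) = n - x); last by ring.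
  rewrite (_ : m - 1 + (x + 1) = m + x); last by ring.
  rewrite !qzD qzN; have := qz_neq0 x; set Y := q ^ x => Y0.
  by move: (iq _) (iq _) (q ^ tri x) (a ^ x) => I J T A; field.
have key : (1 - q ^ (n + m + 1)) * \sum_(x <- zrange B) jtp_term a (n + 1) m x =
    \sum_(x <- zrange B) jtp_term a n m x + \sum_(x <- zrange B) g x.
  rewrite mulr_sumr -big_split; apply: eq_bigr => x _ /=.
  rewrite /jtp_term /g (_ : n - x = n + 1 - x - 1); last by ring.
  rewrite (_ : m - 1 + x = m + x - 1) ?iq_pred; last by ring.
  rewrite (_ : q ^ (n + m + 1) = q ^ (n + 1 - x) * q ^ (m + x)); first by ring.
  by rewrite -qzD; congr (q ^ _); ring.
rewrite /jtp_sum (_ : n + 1 + m = n + m + 1); last by ring.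
rewrite qfacz_pred ?addrK; last by lia.
by rewrite mulrAC key gS; ring.
Qed.

Lemma jtp_sumSr B a n m : a != 0 -> 0 <= n + m -> n < B%:Z -> m + 1 < B%:Z ->
  jtp_sum B a n (m + 1) = (1 - q ^ (m + 1) / a) * jtp_sum B a n m.
Proof.
move=> a0 nm0 nB mB; have aD x y : a ^ (x + y) = a ^ x * a ^ y by exact: expfzDr.
pose g x : F := (sgnz x)%:~R * q ^ (tri x) * a ^ x * q ^ (m + 1 + x) *
  (iq (n - 1 - x) * iq (m + 1 + x)).
have gS : \sum_(x <- zrange B) g x =
    - (q ^ (m + 1) / a) * \sum_(x <- zrange B) jtp_term a n m x.
  rewrite -(@sum_zrange_shift B (- 1) g) ?mulr_sumr; [|lia|]; last first.
    move=> x xB; rewrite /g; have [h|h] := ltP (n - 1 - x) 0.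
      by rewrite (iq_lt0 h) !(mul0r, mulr0).
    by rewrite (@iq_lt0 (m + 1 + x)) ?mulr0 //; lia.
  apply: eq_bigr => x _; rewrite /g /jtp_term sgnzB1 rmorphN aD.
  rewrite (_ : a ^ (- 1) = a^-1) // (_ : tri (x - 1) = tri x - x + 1); last first.
    by rewrite -{2}[x](subrK 1) triS; ring.
  rewrite (_ : n - 1 - (x - 1) = n - x); last by ring.
  rewrite (_ : m + 1 + (x - 1) = m + x); last by ring.
  rewrite !qzD qzN; have := qz_neq0 x; set Y := q ^ x => Y0.
  by move: (iq _) (iq _) (q ^ tri x) (a ^ x) => I J T A; field; rewrite a0.
have key : (1 - q ^ (n + m + 1)) * \sum_(x <- zrange B) jtp_term a n (m + 1) x =
    \sum_(x <- zrange B) jtp_term a n m x + \sum_(x <- zrange B) g x.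
  rewrite mulr_sumr -big_split; apply: eq_bigr => x _ /=.
  rewrite /jtp_term /g (_ : m + x = m + 1 + x - 1); last by ring.
  rewrite (_ : n - 1 - x = n - x - 1) ?iq_pred; last by ring.
  rewrite (_ : q ^ (n + m + 1) = q ^ (n - x) * q ^ (m + 1 + x)); first by ring.
  by rewrite -qzD; congr (q ^ _); ring.
rewrite /jtp_sum (_ : n + (m + 1) = n + m + 1); last by ring.
rewrite qfacz_pred ?addrK; last by lia.
by rewrite mulrAC key gS; ring.
Qed.

Lemma jtp_finite B (a : F) (N M : nat) : a != 0 -> (N + M < B)%N ->
  jtp_sum B a N M =
  \prod_(0 <= k < N) (1 - a * q ^+ k) * \prod_(0 <= k < M) (1 - q / a * q ^+ k).
Proof.
move=> a0; elim: N => [|N IHN] NB; last first.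
  rewrite big_nat_recr //= -addn1 PoszD jtp_sumSl ?IHN //; [|lia..].
  by rewrite mulrAC mulrC.
rewrite [X in _ = X * _]big_nil mul1r.
elim: M NB => [|M IHM] NB; last first.
  rewrite big_nat_recr //= -addn1 PoszD jtp_sumSr ?IHM //; [|lia..].
  rewrite mulrC (_ : q ^ (M%:Z + 1) = q * q ^+ M); first by congr (_ * _); ring.
  by rewrite -exprS -exprnP addn1.
rewrite big_nil /jtp_sum (@sum_zrange1 _ _ 0); [|by lia|].
  rewrite /jtp_term (_ : iq (0%:Z - 0) = 1) ?iq0 // ?(_ : iq (0%:Z + 0) = 1) ?iq0 //.
  by rewrite (_ : tri 0 = 0) // !expr0z !mulr1 /= /qfac big_ord0.
move=> y y0; rewrite /jtp_term.
have [h|h] := ltP y 0; first by rewrite (@iq_lt0 (_ + y)) ?mulr0 //; lia.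
by rewrite (@iq_lt0 (_ - y)) ?(mul0r, mulr0) //; lia.
Qed.

End QField.

(** * Passage to the field of fractions *)

Section FpsIntegral.
Variable R : idomainType.
Implicit Types f g : fps R.

Lemma fps_ord f : f != 0 ->
  exists n, f n != 0 /\ forall k, (k < n)%N -> f k = 0.
Proof.
move=> f0; have [n fn] : exists n, f n != 0.
  apply: contrapT => h; case/eqP: f0; apply/fpsP => n.
  by apply/eqP; apply: contra_notT h => fn; exists n.
have [m fm min] := ex_minnP (ex_intro (fun n => f n != 0) n fn).
by exists m; split=> // k km; apply/eqP; apply: contraTT km => /min; rewrite -leqNgt.
Qed.

(** The product of the lowest nonzero coefficients is a coefficient of f g. This gives Z[[q]] a
    field of fractions, where the identities with negative powers of q make sense. *)
Fact fps_integral f g : f * g = 0 -> (f == 0) || (g == 0).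
Proof.
move=> fg; apply/orP; have [f0|f0] := eqVneq f 0; first by left.
have [g0|g0] := eqVneq g 0; first by right.
have [n [fn fl]] := fps_ord f0; have [m [gm gl]] := fps_ord g0.
have /fpsP/(_ (n + m)%N)/eqP := fg; rewrite coef_fpsM coef_fps0.
have nm : (n < (n + m).+1)%N by rewrite ltnS leq_addr.
rewrite (bigD1 (Ordinal nm)) //= addKn big1 ?addr0.
  by rewrite mulf_eq0 (negPf fn) (negPf gm).
move=> i /eqP ni; have [lt|ge] := ltnP i n; first by rewrite fl ?mul0r.
rewrite gl ?mulr0 // ltn_subLR; last by rewrite -ltnS.
rewrite ltn_add2r ltn_neqAle ge andbT; apply/eqP => e; case: ni.
exact/val_inj.
Qed.

HB.instance Definition _ :=
  GRing.ComUnitRing_isIntegral.Build (fps R) fps_integral.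

End FpsIntegral.

Local Notation X := (fpsX int).
Local Notation FF := {fraction fps int}.
Local Notation toF := (@FracField.tofrac (fps int)).
Local Notation qF := (toF X).

Lemma coef_fpsXn k n : (X ^+ k) n = (n == k)%:R.
Proof.
elim: k n => [|k IH] n; first by rewrite expr0 coef_fps1.
by rewrite exprS coef_fpsXM; case: n => [|n]; rewrite ?IH.
Qed.

Lemma coef_Xn_mul_lt k (f : fps int) n : (n < k)%N -> (X ^+ k * f) n = 0.
Proof. exact: coef_fpsX_small. Qed.

Lemma qF_neq0 : qF != 0.
Proof.
rewrite tofrac_eq0; apply/eqP => /fpsP/(_ 1%N) /=.
by move/eqP; rewrite oner_eq0.
Qed.

Lemma qF_free k : (0 < k)%N -> qF ^+ k != 1.
Proof.
case: k => // k _; rewrite -tofracXn -tofrac1 tofrac_eq.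
apply/eqP => /fpsP/(_ 0%N)/eqP; rewrite coef_fpsXn coef_fps1 /= eq_sym oner_eq0.
by [].
Qed.

Lemma FF_two_neq0 : 2%:R != 0 :> FF.
Proof.
rewrite (_ : 2%:R = toF 2%:R); last by rewrite rmorph_nat.
rewrite tofrac_eq0.
by apply/eqP => /fpsP/(_ 0%N).
Qed.

Lemma qF_gen : generic qF.
Proof. by split; [exact: qF_neq0 | exact: qF_free | exact: FF_two_neq0]. Qed.

Lemma coef0_prod (I : Type) (s : seq I) (f : I -> fps int) :
  (forall i, f i 0%N = 1) -> (\prod_(i <- s) f i) 0%N = 1.
Proof.
move=> f1; elim: s => [|i s IH]; first by rewrite big_nil.
by rewrite big_cons coef_fpsM big_ord_recl big_ord0 addr0 /= f1 IH mulr1.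
Qed.

Lemma coef0M (f g : fps int) : (f * g) 0%N = f 0%N * g 0%N.
Proof. by rewrite coef_fpsM big_ord_recl big_ord0 addr0. Qed.

Lemma coef0_qpoch (a q : fps int) L : a 0%N = 0 -> (qpoch a q L) 0%N = 1.
Proof.
by move=> a0; apply: coef0_prod => i; rewrite coef_fpsB coef0M a0 mul0r subr0.
Qed.

Lemma qpoch_unit (a q : fps int) L : a 0%N = 0 -> qpoch a q L \is a GRing.unit.
Proof. by move=> a0; apply: fps_unitP; apply: coef0_qpoch. Qed.

Lemma coef0_qpoch_inf (a q : fps int) : a 0%N = 0 -> q 0%N = 0 ->
  (qpoch_inf a q) 0%N = 1.
Proof.
move=> a0 q0; have [N /(_ N (leqnn N)) <-] := qpoch_inf_cvg a q0 0.
exact: coef0_qpoch.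
Qed.

Lemma qpoch_inf_unit (a q : fps int) : a 0%N = 0 -> q 0%N = 0 ->
  qpoch_inf a q \is a GRing.unit.
Proof. by move=> a0 q0; apply: fps_unitP; apply: coef0_qpoch_inf. Qed.

Lemma fps_cvgV (u : nat -> fps int) l : (forall L, u L \is a GRing.unit) ->
  l \is a GRing.unit -> fps_cvg u l -> fps_cvg (fun L => (u L)^-1) l^-1.
Proof.
move=> uu lu ul n; have [N HN] := fps_cvg_le n ul; exists N => L NL.
rewrite -[(u L)^-1](mulrK lu) -[l^-1 in RHS]mul1r -[1](mulVr (uu L)).
apply: eq_coef_fpsM => // k kn; apply: eq_coef_fpsM => // j jk.
by rewrite HN // (leq_trans jk).
Qed.

Lemma fps_cvg_cst (l : fps int) : fps_cvg (fun=> l) l.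
Proof. by move=> n; exists 0%N. Qed.

Lemma fps_cvg_shift (u v : nat -> fps int) l (k : nat) : 
  (forall L, (k <= L)%N -> exists2 M, (L <= M + k)%N & v L = u M) ->
  fps_cvg u l -> fps_cvg v l.
Proof.
move=> vu ul n; have [N HN] := ul n; exists (N + k)%N => L NL.
have [M LM ->] := vu L (leq_trans (leq_addl _ _) NL); apply: HN.
by rewrite -(leq_add2r k) (leq_trans NL).
Qed.

(** * Power series counterparts of the q-factorials and their limits *)

Definition iqx (q : fps int) (z : int) : fps int :=
  if z is Posz k then (qpoch q q k)^-1 else 0.

Lemma iqx_lt0 q z : z < 0 -> iqx q z = 0.
Proof. by case: z. Qed.

Lemma iqx_cvg (q : fps int) (d : int) : q 0%N = 0 ->
  fps_cvg (fun L => iqx q (L%:Z + d)) (qpoch_inf q q)^-1.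
Proof.
move=> q0; apply: (@fps_cvg_shift (fun k => (qpoch q q k)^-1) _ _ `|d|%N).
  move=> L dL; exists `|(L%:Z + d)%R|%N; first by lia.
  by rewrite /iqx -{1}[L%:Z + d]gez0_abs //; lia.
apply: fps_cvgV; [| |exact: qpoch_inf_cvg].
  by move=> L; apply: qpoch_unit.
exact: qpoch_inf_unit.
Qed.

Definition facx (q : fps int) (z : int) : fps int :=
  if z is Posz k then qpoch q q k else 0.

Lemma facx_cvg (q : fps int) (d : int) : q 0%N = 0 ->
  fps_cvg (fun L => facx q (L%:Z + L%:Z + d)) (qpoch_inf q q).
Proof.
move=> q0; apply: (@fps_cvg_shift (fun k => qpoch q q k) _ _ `|d|%N).
  move=> L dL; exists `|(L%:Z + L%:Z + d)%R|%N; first by lia.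
  by rewrite /facx -{1}[L%:Z + L%:Z + d]gez0_abs //; lia.
exact: qpoch_inf_cvg.
Qed.

Lemma toF_qpoch (a q : fps int) L :
  toF (qpoch a q L) = \prod_(0 <= k < L) (1 - toF a * toF q ^+ k).
Proof.
rewrite /qpoch rmorph_prod; apply: eq_bigr => i _.
by rewrite rmorphB rmorph1 rmorphM rmorphXn.
Qed.

Lemma toF_qfac (q : fps int) L : toF (qpoch q q L) = qfac (toF q) L.
Proof.
rewrite toF_qpoch big_mkord; apply: eq_bigr => i _; by rewrite exprS.
Qed.

Lemma toF_facx q z : toF (facx q z) = qfacz (toF q) z.
Proof. by case: z => k /=; rewrite ?rmorph0 ?toF_qfac. Qed.

Lemma toF_iqx (q : fps int) z : q 0%N = 0 -> toF (iqx q z) = iq (toF q) z.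
Proof.
move=> q0; case: z => k /=; rewrite ?rmorph0 // -toF_qfac.
have u : qpoch q q k \is a GRing.unit by exact: qpoch_unit.
have nz : toF (qpoch q q k) != 0.
  rewrite tofrac_eq0; apply/eqP => e; move: u; rewrite e.
  by rewrite unitr0.
by apply: (mulIf nz); rewrite mulVf // -rmorphM mulVr ?rmorph1.
Qed.

Lemma toF_inj : injective toF.
Proof. by move=> f g /eqP; rewrite tofrac_eq => /eqP. Qed.

Lemma toF_Xz (z : int) : 0 <= z -> toF (X ^+ `|z|%N) = qF ^ z.
Proof. by case: z => // k _; rewrite rmorphXn. Qed.

Arguments iqx : simpl never.
Arguments facx : simpl never.

(** * Theta functions and Macdonald's identity *)

(** The exponent of X in the general term of the triple product with base X^M and argument X^al. *)
Definition jexp (M al x : int) : int := M * tri x + al * x.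

Lemma jexp_ge (M al x : int) : 0 < al < M -> `|x| <= jexp M al x.
Proof.
rewrite /jexp => /andP[al0 alM]; have tE := triE x.
have [x0|x0] := leP 0 x.
  have t0 : 0 <= tri x by nia.
  rewrite ger0_norm //; nia.
have tx : - x <= tri x by nia.
rewrite ltr0_norm //; nia.
Qed.

Lemma summable_Xn (I : choiceType) (c : I -> fps int) (h : I -> nat)
    (s : nat -> seq I) :
  (forall n i, i \notin s n -> (n < h i)%N) -> summable (fun i => c i * X ^+ h i).
Proof.
move=> hs n; exists (undup (s n)); split; first exact: undup_uniq.
move=> i; rewrite mem_undup => /hs nh k kn; rewrite mulrC coef_Xn_mul_lt //.
exact: leq_ltn_trans nh.
Qed.

Lemma coef0_Xn k : (0 < k)%N -> (X ^+ k) 0%N = 0.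
Proof. by rewrite coef_fpsXn; case: k. Qed.

Definition jterm (M al : nat) (x : int) : fps int :=
  (sgnz x)%:~R * X ^+ `|jexp M al x|%N.

Lemma summable_jterm M al : (0 < al < M)%N -> summable (jterm M al).
Proof.
move=> aM; apply: (@summable_Xn _ _ _ (fun n => zrange n)) => n x.
rewrite mem_zrange => h; have := @jexp_ge M al x; lia.
Qed.

Lemma qpow_gen (M : nat) : (0 < M)%N -> generic (toF (X ^+ M)).
Proof.
move=> M0; split; [|move=> k k0|exact: FF_two_neq0].
  by rewrite rmorphXn expf_neq0 // qF_neq0.
by rewrite rmorphXn -exprM qF_free // muln_gt0 M0.
Qed.

Lemma toF_sgn x (n : int) : 0 <= n ->
  toF ((sgnz x)%:~R * X ^+ `|n|%N) = (sgnz x)%:~R * qF ^ n.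
Proof. by move=> n0; rewrite rmorphM /= rmorph_int toF_Xz. Qed.

(** The limit of [jtp_finite] with both lengths equal to L; the factor (Q; Q)_(2 L) stays on the
    left until the limit is taken. *)
Lemma jtp_fps M al : (0 < al < M)%N ->
  fsum (jterm M al) = qpoch_inf (X ^+ M) (X ^+ M) *
    (qpoch_inf (X ^+ al) (X ^+ M) * qpoch_inf (X ^+ (M - al)) (X ^+ M)).
Proof.
move=> aM; have /andP[a0 alM] := aM; have M0 : (0 < M)%N by lia.
set Q := X ^+ M; have Q0 : Q 0%N = 0 by exact: coef0_Xn.
pose P := qpoch_inf Q Q; have Pu : P \is a GRing.unit by exact: qpoch_inf_unit.
have fin L : facx Q (L%:Z + L%:Z + 0) *
    fsum (fun x => iqx Q (L%:Z + - x) * iqx Q (L%:Z + x) * jterm M al x) =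
    qpoch (X ^+ al) Q L * qpoch (X ^+ (M - al)) Q L.
  apply: toF_inj; have nz : toF (X ^+ al) != 0 by case: (qpow_gen a0).
  have BL : (L + L < L + L + 1)%N by lia.
  have := jtp_finite (qpow_gen M0) nz BL.
  rewrite addr0 !tofracM toF_facx !toF_qpoch -/Q => e.
  transitivity (\prod_(0 <= k < L) (1 - toF (X ^+ al) * toF Q ^+ k) *
    \prod_(0 <= k < L) (1 - toF Q / toF (X ^+ al) * toF Q ^+ k)); last first.
    congr (_ * _); apply: eq_bigr => k _; congr (1 - _ * _).
    apply: (mulIf nz); rewrite mulfVK // -tofracM -exprD; congr (toF (X ^+ _)).
    by lia.
  rewrite -e /jtp_sum; congr (_ * _).
  rewrite (@fsum_seq _ _ _ (zrange (L + L + 1))) ?zrange_uniq //.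
    rewrite rmorph_sum /=; apply: eq_bigr => x _; rewrite /jterm /jtp_term.
    rewrite [iqx _ _ * iqx _ _ * _]mulrC tofracM toF_sgn; last by have := @jexp_ge M al x; lia.
    rewrite tofracM !toF_iqx //; congr (_ * _); rewrite -mulrA; congr (_ * _).
    rewrite /Q !tofracXn /jexp !exprnP !exprz_exp.
    by rewrite -expfzDr ?qF_neq0.
  move=> x; rewrite mem_zrange => h.
  have [h1|h1] := ltP (L%:Z - x) 0; first by rewrite iqx_lt0 // !mul0r.
  by rewrite [iqx Q (L%:Z + x)]iqx_lt0 ?mulr0 ?mul0r //; lia.
have lhs := fps_cvgM (facx_cvg 0 Q0) (fsum_cvg (summable_jterm aM)
  (fun x => fps_cvgM (iqx_cvg (- x) Q0) (iqx_cvg x Q0))).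
have rhs := fps_cvgM (qpoch_inf_cvg (X ^+ al) Q0)
                     (qpoch_inf_cvg (X ^+ (M - al)) Q0).
rewrite (funext fin) in lhs; rewrite -(fps_cvg_unique lhs rhs) -/P -fsumZ.
  by rewrite !mulrA mulrK // divrr // mul1r.
exact: summable_jterm.
Qed.

Lemma jexp_ge0 (M al x : int) : 0 < al < M -> 0 <= jexp M al x.
Proof. by move=> h; apply: le_trans (jexp_ge x h). Qed.

Lemma qpoch_cat (a q : fps int) m n :
  qpoch a q (m + n) = qpoch a q m * qpoch (a * q ^+ m) q n.
Proof.
elim: n => [|n IH]; first by rewrite addn0 /qpoch (big_geq (leqnn 0)) mulr1.
by rewrite addnS !qpochS IH -!mulrA exprD.
Qed.

Lemma qpoch_dissect (M k L : nat) : qpoch (X ^+ M) (X ^+ M) (k * L) =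
  \prod_(i < k) qpoch (X ^+ (M * i.+1)) (X ^+ (M * k)) L.
Proof.
elim: L => [|L IH].
  rewrite muln0 /qpoch (big_geq (leqnn 0)) big1 // => i _.
  by rewrite (big_geq (leqnn 0)).
rewrite mulnS addnC qpoch_cat IH; under [RHS]eq_bigr => i _ do rewrite qpochS.
rewrite [RHS]big_split /=; congr (_ * _); rewrite /qpoch big_mkord.
apply: eq_bigr => i _; rewrite -!exprM -!exprD; congr (1 - X ^+ _); lia.
Qed.

Lemma fps_cvg_prod (I : Type) (s : seq I) (u : I -> nat -> fps int) l :
  (forall i, fps_cvg (u i) (l i)) ->
  fps_cvg (fun L => \prod_(i <- s) u i L) (\prod_(i <- s) l i).
Proof.
move=> ul; elim: s => [|i s IH].
  rewrite big_nil (_ : (fun _ => _) = fun=> 1); first exact: fps_cvg_cst.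
  by apply/funext => L; rewrite big_nil.
rewrite big_cons (_ : (fun _ => _) = fun L => u i L * \prod_(j <- s) u j L).
  exact: fps_cvgM.
by apply/funext => L; rewrite big_cons.
Qed.

Lemma qpoch_inf_dissect (M k : nat) : (0 < M)%N -> (0 < k)%N ->
  qpoch_inf (X ^+ M) (X ^+ M) =
  \prod_(i < k) qpoch_inf (X ^+ (M * i.+1)) (X ^+ (M * k)).
Proof.
move=> M0 k0.
have Mk0 : (0 < M * k)%N by rewrite muln_gt0 M0.
have h1 := @fps_cvg_shift _ (fun L => qpoch (X ^+ M) (X ^+ M) (k * L)) _ 0 _
  (qpoch_inf_cvg (X ^+ M) (coef0_Xn M0)).
apply: (fps_cvg_unique (h1 _)).
  move=> L _; exists (k * L)%N => //; nia.
rewrite (funext (qpoch_dissect M k)); apply: fps_cvg_prod => i.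
exact/qpoch_inf_cvg/coef0_Xn.
Qed.

Local Notation Q11 := (X ^+ 11).

Lemma theta_jterm al : (0 < al < 11)%N ->
  fsum (jterm 11 al) = qpoch_inf Q11 Q11 * theta (X ^+ al) Q11.
Proof.
by move=> h; rewrite jtp_fps // /theta fps_quotX //; case/andP: h => _ /ltnW.
Qed.

(** The pentagonal number theorem in X^M: the three products given by the Jacobi identity in base
    X^(3 M) are the residue classes modulo 3 of (X^M; X^M)_oo. *)
Lemma pentagonal_jterm (M al : nat) : (0 < M)%N -> al = (M * 1)%N \/ al = (M * 2)%N ->
  fsum (jterm (M * 3) al) = qpoch_inf (X ^+ M) (X ^+ M).
Proof.
move=> M0 h; rewrite jtp_fps; last by lia.
rewrite [RHS](qpoch_inf_dissect M0 (isT : 0 < 3)%N) !big_ord_recl big_ord0 mulr1.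
rewrite [LHS]mulrC -mulrA.
by case: h => ->; [rewrite (_ : M * 3 - M * 1 = M * 2)%N; [|lia]
                 | rewrite (_ : M * 3 - M * 2 = M * 1)%N; [rewrite mulrCA|lia]].
Qed.

Lemma jexp2E (M al x : int) : 2 * jexp M al x = M * (x * (x - 1)) + 2 * al * x.
Proof. by rewrite /jexp -triE; ring. Qed.

(** On the line z = t + k the linear parts i (A - z) + j (C - z) + (i + j) z do not depend on z;
    this is the reason for the third argument i + j. Only the quadratic parts depend on k. *)
Lemma jexp_sum (i j A C t r k : int) : A + C = 3 * t + r ->
  jexp 11 i (A - (t + k)) + (jexp 11 j (C - (t + k)) + jexp 11 (i + j) (t + k)) =
  jexp 11 i (A - t) + jexp 11 j (C - t) + jexp 11 (i + j) t
  + jexp 33 (22 - 11 * r) k.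
Proof.
move=> /(canRL (addKr _)) ->; apply: (@mulfI int (2 : int)) => //.
rewrite mulrDr [2 * (jexp _ _ _ + jexp _ _ _)]mulrDr [RHS]mulrDr.
rewrite [2 * (jexp _ _ _ + _ + _)]mulrDr [2 * (jexp _ _ _ + jexp _ _ _)]mulrDr.
by rewrite !jexp2E; ring.
Qed.

(** Six times the two sides differ by a multiple of r^2 - r, which is 0 in both cases for r. *)
Lemma jexp_qexp (i j A C a c t r : int) : a = A - 1 -> c = 1 - C ->
    A + C = 3 * t + r -> r = 0 \/ r = 1 -> chi3 (a - c) != 0 ->
  jexp 11 i (A - t) + jexp 11 j (C - t) + jexp 11 (i + j) t =
  11 * qexp a c + i * (a + 1) + j * (1 - c).
Proof.
move=> aA cC AC r01 /qexpE nz; apply: (@mulfI int (6 : int)) => //.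
transitivity (3 * (2 * jexp 11 i (A - t) + 2 * jexp 11 j (C - t)
  + 2 * jexp 11 (i + j) t)); first by ring.
transitivity (22 * (3 * qexp a c) + 6 * (i * (a + 1) + j * (1 - c))); last by ring.
rewrite !jexp2E nz aA cC; have -> : C = - A + (3 * t + r) by lia.
by case: r01 => ->; ring.
Qed.

(** The absolute value merely converts the exponent to nat: for the i and j in use it is nonnegative
    wherever the sign is nonzero, by [wtx_sum0]. *)
Definition wtx (i j : nat) (x : int * int) : fps int :=
  (chi3 (x.1 - x.2))%:~R *
  X ^+ `|(11 * qexp x.1 x.2 + i%:Z * (x.1 + 1) + j%:Z * (1 - x.2))%R|%N.

Lemma wtxE (i j : nat) (a c : int) : wtx i j (a, c) = (chi3 (a - c))%:~R *
  X ^+ `|(11 * qexp a c + i%:Z * (a + 1) + j%:Z * (1 - c))%R|%N.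
Proof. by []. Qed.

Section Macdonald.
Variables i j : nat.
Hypothesis i0 : (0 < i)%N.
Hypothesis j0 : (0 < j)%N.
Hypothesis ij : (i + j < 11)%N.

Let triple (A C z : int) : fps int :=
  jterm 11 i (A - z) * (jterm 11 j (C - z) * jterm 11 (i + j) z).

Lemma tripleE A C z : triple A C z = (sgnz (A + C - z))%:~R *
  X ^+ `|(jexp 11 i (A - z) + (jexp 11 j (C - z) + jexp 11 (i + j)%N z))%R|%N.
Proof.
have e1 : 0 <= jexp 11 i (A - z) by apply: jexp_ge0; lia.
have e2 : 0 <= jexp 11 j (C - z) by apply: jexp_ge0; lia.
have e3 : 0 <= jexp 11 (i + j)%N z by apply: jexp_ge0; lia.
rewrite (_ : `|_|%N = (`|jexp 11 i (A - z)%R| + (`|jexp 11 j (C - z)%R| +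
  `|jexp 11 (i + j)%N z|))%N); last by lia.
rewrite !exprD /triple /jterm (_ : sgnz (A + C - z) = sgnz (A - z) * (sgnz (C - z) * sgnz z)).
  by rewrite !intrM; ring.
by rewrite -!sgnzD; congr sgnz; ring.
Qed.

Lemma summable_triple : summable (fun x : int * int * int => triple x.1.1 x.1.2 x.2).
Proof.
pose s n := [seq (a, z) | a <- [seq (A, C) | A <- zrange (n + n),
  C <- zrange (n + n)], z <- zrange (n + n)].
rewrite (_ : (fun _ => _) = (fun x => (sgnz (x.1.1 + x.1.2 - x.2))%:~R *
  X ^+ `|(jexp 11 i (x.1.1 - x.2) + (jexp 11 j (x.1.2 - x.2) +
          jexp 11 (i + j)%N x.2))%R|%N)); last by apply/funext => x; rewrite tripleE.
have bnd A C z : let m := `|(jexp 11 i (A - z) + (jexp 11 j (C - z) +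
    jexp 11 (i + j)%N z))%R|%N in
    [&& `|A| <= (m + m)%N, `|C| <= (m + m)%N & `|z| <= (m + m)%N].
  have e1 : `|A - z| <= jexp 11 i (A - z) by apply: jexp_ge; lia.
  have e2 : `|C - z| <= jexp 11 j (C - z) by apply: jexp_ge; lia.
  have e3 : `|z| <= jexp 11 (i + j)%N z by apply: jexp_ge; lia.
  by move=> m; rewrite /m; lia.
apply: (@summable_Xn _ _ _ s) => n [[A C] z] /=; move: (bnd A C z) => /=.
move: `|_|%N => m /and3P[Am Cm zm] h; rewrite ltnNge; apply: contra h => mn.
apply/allpairsP; exists ((A, C), z); split; [|by rewrite mem_zrange /=; lia|by []].
by apply/allpairsP; exists (A, C); split; [rewrite mem_zrange /=; lia..|].
Qed.

(* The exponent of triple A C z, as a function of z, is a pentagonal number up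
   to a constant; if A + C = -1 modulo 3, the terms cancel in pairs. *)
Lemma fsum_triple A C : fsum (triple A C) =
  wtx i j (A - 1, 1 - C) * qpoch_inf Q11 Q11.
Proof.
have [t [r [ACt r3]]] : exists t r, A + C = 3 * t + r /\ [\/ r = 0, r = 1 | r = - 1].
  have [t [r [ACt h]]] := chi3_mod (A + C); exists t, r; split=> //.
  by case: h => -[-> _]; [apply: Or31 | apply: Or32 | apply: Or33].
pose E := jexp 11 i (A - t) + jexp 11 j (C - t) + jexp 11 (i + j)%N t.
have E0 : 0 <= E.
  have e1 : 0 <= jexp 11 i (A - t) by apply: jexp_ge0; lia.
  have e2 : 0 <= jexp 11 j (C - t) by apply: jexp_ge0; lia.
  have e3 : 0 <= jexp 11 (i + j)%N t by apply: jexp_ge0; lia.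
  by rewrite /E; lia.
have tE k : triple A C (t + k) = (sgnz (r + k))%:~R *
    X ^+ `|(E + jexp 33 (22 - 11 * r) k)%R|%N.
  rewrite tripleE ACt PoszD (jexp_sum i j k ACt); congr (_%:~R * _).
  rewrite (_ : 3 * t + r - (t + k) = t + t + (r - k)); last by ring.
  by rewrite !sgnzD sgnz_sqr mul1r sgnzN.
have bt : bijective (fun k => t + k).
  by exists (fun k => k - t) => k /=; ring.
rewrite (fsum_reindex _ bt) (@eq_fsum _ _ _ (fun k => (sgnz (r + k))%:~R *
    X ^+ `|(E + jexp 33 (22 - 11 * r) k)%R|%N)); last by move=> k /=; rewrite tE.
(* The residues 0 and 1 give the two forms of the pentagonal series, with linear coefficients 22 and
   11. The sign at z = t is (- 1)^r, which is the value of [chi3] there. *)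
have main r' al : r = r' -> r' = 0 \/ r' = 1 -> 22 - 11 * r' = al%:Z ->
    al = (11 * 1)%N \/ al = (11 * 2)%N ->
  fsum (fun k => (sgnz (r + k))%:~R * X ^+ `|(E + jexp 33 (22 - 11 * r) k)%R|%N) =
    wtx i j (A - 1, 1 - C) * qpoch_inf Q11 Q11.
  move=> rr r01 alE al2.
  rewrite -(@pentagonal_jterm 11 al) // fsumZ; last by apply: summable_jterm; lia.
  apply: eq_fsum => k; rewrite /jterm rr alE.
  have k0 : 0 <= jexp 33 al k by apply: jexp_ge0; lia.
  rewrite (_ : `|_|%N = (`|E| + `|jexp 33 al k|)%N); last by lia.
  have c : chi3 (A - 1 - (1 - C)) = sgnz r'.
    rewrite (@chi3D (r' + 1) _ (1 - t)); last by lia.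
    by case: r01 => ->.
  have nz : chi3 (A - 1 - (1 - C)) != 0 by rewrite c; case: r01 => ->.
  rewrite /wtx /= c sgnzD intrM exprD.
  rewrite -(@jexp_qexp i j A C _ _ t r' erefl erefl _ _ nz) -?rr //.
    by rewrite -/E; ring.
  by rewrite rr.
case: (r3) => rE.
- exact: (main _ 22%N rE (or_introl erefl) erefl (or_intror erefl)).
- exact: (main _ 11%N rE (or_intror erefl) erefl (or_introl erefl)).
have c0 : chi3 (A - 1 - (1 - C)) = 0 by rewrite (@chi3D 0 _ (1 - t)) //; lia.
rewrite /wtx /= c0 !mul0r; set G := fun k : int => _; set S := fsum _.
suff : S = - S.
  move=> SS; apply/fpsP => n; rewrite coef_fps0.
  have /fpsP/(_ n)/eqP := SS; rewrite coef_fpsN -subr_eq0 opprK -mulr2n.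
  by rewrite mulrn_eq0 => /eqP.
have sG : summable G.
  rewrite (_ : G = (fun x : int * int * int => triple x.1.1 x.1.2 x.2) \o
    (fun k => (A, C, t + k))); last by apply/funext => k /=; rewrite tE.
  apply: (@summable_comp _ _ _ _ (fun x => x.2 - t)) summable_triple.
  by move=> k /=; ring.
(* For r = - 1 the exponent is 33 k (k + 1) / 2 plus a constant, invariant under k -> - 1 - k, while
   the sign changes. *)
have bk : bijective (fun k : int => - 1 - k) by exists (fun k => - 1 - k) => k; ring.
rewrite -mulN1r (fsumZ _ sG) {1}/S (fsum_reindex _ bk); apply: eq_fsum => k /=.
rewrite /G rE mulN1r -mulNr -mulrNz; congr (_%:~R * X ^+ `|_|%N).
  rewrite (_ : - 1 + (- 1 - k) = - k + (- 1) - 1); last by ring.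
  by rewrite sgnzB1 sgnzD sgnzN [- 1 + k]addrC sgnzD.
congr (E + _); apply: (@mulfI int (2 : int)) => //; rewrite !jexp2E; ring.
Qed.

(** By [jexp_qexp] the exponent is a sum of three triple product exponents, each of which bounds the
    absolute value of its argument by [jexp_ge]. *)
Lemma wtx_sum0 (a c : int) : chi3 (a - c) != 0 ->
  let E := 11 * qexp a c + i%:Z * (a + 1) + j%:Z * (1 - c) in
  0 <= E /\ `|a| + `|c| <= 4 * E + 4.
Proof.
move=> nz E.
have [t [r [ACt h]]] := chi3_mod (a + 1 + (1 - c)).
have r01 : r = 0 \/ r = 1.
  case: h => -[rE _]; [by left | by right | ].
  by move: nz; rewrite (@chi3D 0 _ (1 - t)) //; lia.
have aE : a = a + 1 - 1 by lia.
have cE : c = 1 - (1 - c) by lia.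
rewrite /E -(@jexp_qexp i j (a + 1) (1 - c) a c t r aE cE ACt r01 nz).
have e1 : `|a + 1 - t| <= jexp 11 i (a + 1 - t) by apply: jexp_ge; lia.
have e2 : `|1 - c - t| <= jexp 11 j (1 - c - t) by apply: jexp_ge; lia.
have e3 : `|t| <= jexp 11 (i%:Z + j%:Z) t by apply: jexp_ge; lia.
move: (jexp _ _ _) (jexp _ _ _) (jexp _ _ _) e1 e2 e3 => x y z e1 e2 e3; lia.
Qed.

Lemma summable_wtx : summable (wtx i j).
Proof.
pose s n := [seq (a, c) | a <- zrange (4 * n + 4), c <- zrange (4 * n + 4)].
move=> n; exists (undup (s n)); split; first exact: undup_uniq.
case=> a c; rewrite mem_undup => h k kn; rewrite wtxE.
have [->|nz] := eqVneq (chi3 (a - c)) 0; first by rewrite mulr0z mul0r.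
rewrite mulrC coef_Xn_mul_lt //; apply: leq_ltn_trans kn _.
have [_] := wtx_sum0 nz; move: (_ + _ * (1 - c)) => E ac.
rewrite ltnNge; apply: contra h => En; apply/allpairsP; exists (a, c).
by split; [rewrite mem_zrange /=; lia..|].
Qed.

(** Three triple products bring three factors (q^11; q^11)_oo. One of them is also produced by every
    line sum, hence the multiplication by it at the outset. *)
Lemma macdonald : fsum (wtx i j) = qpoch_inf Q11 Q11 ^+ 2 *
  (theta (X ^+ i) Q11 * (theta (X ^+ j) Q11 * theta (X ^+ (i + j)) Q11)).
Proof.
have Pu : qpoch_inf Q11 Q11 \is a GRing.unit.
  by apply: qpoch_inf_unit; exact: coef0_Xn.
apply: (mulIr Pu).
transitivity (fsum (jterm 11 i) * (fsum (jterm 11 j) * fsum (jterm 11 (i + j)))); last first.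
  rewrite !theta_jterm; [|lia..]; move: (qpoch_inf Q11 Q11) => P.
  by move: (theta (X ^+ i) _) (theta (X ^+ j) _) (theta (X ^+ (i + j)) _) => a b c; ring.
have s1 : summable (jterm 11 i) by apply: summable_jterm; lia.
have s2 : summable (jterm 11 j) by apply: summable_jterm; lia.
have s3 : summable (jterm 11 (i + j)) by apply: summable_jterm; lia.
rewrite (fsum_prod s2 s3) (fsum_prod s1 (summable_prod s2 s3)).
(* Coordinates (A, C, z) in which the lines of summation are those with A and C fixed. *)
have b1 : bijective (fun x : int * int * int => (x.1.1 - x.2, (x.1.2 - x.2, x.2))).
  exists (fun x => (x.1 + x.2.2, x.2.1 + x.2.2, x.2.2)).
    by case=> [[A C] z] /=; congr (_, _, _); ring.
  by case=> [x [y z]] /=; congr (_, (_, _)); ring.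
rewrite (fsum_reindex _ b1) (_ : _ \o _ =
  (fun x : int * int * int => triple x.1.1 x.1.2 x.2)) //.
rewrite (fsum_pair summable_triple).
have b2 : bijective (fun x : int * int => (x.1 - 1, 1 - x.2)).
  exists (fun x => (x.1 + 1, 1 - x.2)); first by case=> a c /=; congr (_, _); ring.
  by case=> a c /=; congr (_, _); ring.
rewrite (fsum_reindex _ b2) mulrC fsumZ.
  by apply: eq_fsum => -[A C] /=; rewrite fsum_triple mulrC.
apply: (@summable_comp _ _ _ _ (fun x => (x.1 + 1, 1 - x.2))) summable_wtx.
by case=> a c /=; congr (_, _); ring.
Qed.
End Macdonald.

(** * The limits of the finite identities *)

Local Notation idx := ((nat * nat * nat) * (nat * nat * nat))%type.

(** Built from integer differences, it vanishes outside [index_set], so that all sums may run over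
    six unrestricted indices. *)
Definition denom (x : idx) : fps int :=
  let: ((r1, r2, r3), (s1, s2, s3)) := x in
  iqx X (r1%:Z - r2%:Z) * iqx X (r2%:Z - r3%:Z) * iqx X r3 *
  (iqx X (s1%:Z - s2%:Z) * iqx X (s2%:Z - s3%:Z) * iqx X s3) *
  iqx X (r3%:Z + s3%:Z + 1).

Definition quad (x : idx) : nat :=
  let: ((r1, r2, r3), (s1, s2, s3)) := x in quad_form r1 r2 r3 s1 s2 s3.

Definition lin (a b : nat) (x : idx) : nat :=
  let: ((r1, r2, r3), (s1, s2, s3)) := x in
  ((a < 1) * r1 + (b < 1) * s1 + ((a < 2) * r2 + (b < 2) * s2)
   + ((a < 3) * r3 + (b < 3) * s3))%N.

Definition appl (p : factor) (x : idx) : fps int :=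
  let: ((r1, r2, r3), (s1, s2, s3)) := x in p r1 r2 r3 s1 s2 s3 X.

Definition fstr (x : idx) : nat := x.1.1.1.
Definition fsts (x : idx) : nat := x.2.1.1.

Lemma denom_out x : x \notin index_set -> denom x = 0.
Proof.
case: x => [[[r1 r2] r3] [[s1 s2] s3]]; rewrite /index_set notin_setE /= => h.
have [h1|h1] := ltP (r1%:Z - r2%:Z) 0; first by rewrite iqx_lt0 // !mul0r.
have [h2|h2] := ltP (r2%:Z - r3%:Z) 0.
  by rewrite [iqx X (r2%:Z - _)]iqx_lt0 // !(mul0r, mulr0).
have [h3|h3] := ltP (s1%:Z - s2%:Z) 0.
  by rewrite [iqx X (s1%:Z - _)]iqx_lt0 // !(mul0r, mulr0).
have [h4|h4] := ltP (s2%:Z - s3%:Z) 0.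
  by rewrite [iqx X (s2%:Z - _)]iqx_lt0 // !(mul0r, mulr0).
by case: h; lia.
Qed.

Lemma summandE p (x : idx) :
  (if x \in index_set then summand p X x else 0) =
  X ^+ quad x * appl p x * denom x.
Proof.
case: ifPn => [xi|/denom_out->]; last by rewrite mulr0.
case: x xi => [[[r1 r2] r3] [[s1 s2] s3]]; rewrite inE /index_set /= => xi.
have u k : qpoch X X k \is a GRing.unit by apply: qpoch_unit.
have iE m n : (n <= m)%N -> iqx X (m%:Z - n%:Z) = (qpoch X X (m - n))^-1.
  by move=> nm; rewrite subzn.
rewrite !iE; [|lia..].
have iE' k : iqx X (Posz k) = (qpoch X X k)^-1 by [].
rewrite (_ : r3%:Z + s3%:Z + 1 = (r3 + s3 + 1)%N%:Z) // !iE'.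
rewrite !invrM ?unitrM ?u //; congr (_ * _).
move: ((qpoch X X (r1 - r2))^-1) ((qpoch X X (r2 - r3))^-1) ((qpoch X X r3)^-1).
move: ((qpoch X X (s1 - s2))^-1) ((qpoch X X (s2 - s3))^-1) ((qpoch X X s3)^-1).
move: ((qpoch X X (r3 + s3 + 1))^-1) => a b c d e f g; ring.
Qed.

Lemma quad_ge (x : idx) : x \in index_set -> forall n, (quad x <= n)%N ->
  let: ((r1, r2, r3), (s1, s2, s3)) := x in
  [/\ (r1 <= n)%N /\ (s1 <= n)%N, (r2 <= n)%N /\ (s2 <= n)%N
    & (r3 <= n)%N /\ (s3 <= n)%N].
Proof.
case: x => [[[r1 r2] r3] [[s1 s2] s3]]; rewrite inE /index_set /quad /quad_form /=.
move=> /and4P[h1 h2 h3 h4] n h.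
have h0 : (r1 ^ 2 + s1 ^ 2 - r1 * s1 <= n)%N by lia.
have [r1n s1n] : (r1 <= n)%N /\ (s1 <= n)%N.
  have e : (r1 ^ 2 + s1 ^ 2 <= n + r1 * s1)%N by lia.
  have bnd (u v : nat) : (u * u + v * v <= n + u * v)%N -> (u <= n)%N.
    (* By 4 (u^2 - u v + v^2) = 3 u^2 + (2 v - u)^2. *)
    move=> uv; have sq : 0 <= (2 * v%:Z - u%:Z) * (2 * v%:Z - u%:Z) by rewrite -expr2 sqr_ge0.
    have u2 : (3 * (u * u) <= 4 * n)%N by lia.
    by case: u {uv sq} u2 => [|[|u]] //; nia.
  by split; [apply: (@bnd _ s1) | apply: (@bnd _ r1)]; lia.
by split; lia.
Qed.

Lemma summable_term (c : idx -> fps int) :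
  summable (fun x => X ^+ quad x * c x * denom x).
Proof.
move=> n; pose I := index_iota 0 n.+1.
pose T := [seq (ab, w) | ab <- [seq (a, b) | a <- I, b <- I], w <- I].
exists (undup [seq (r, s) | r <- T, s <- T]); split; first exact: undup_uniq.
move=> x; rewrite mem_undup => xs k kn.
have [xi|/denom_out->] := boolP (x \in index_set); last by rewrite mulr0.
rewrite -mulrA coef_Xn_mul_lt //; apply: leq_ltn_trans kn _.
rewrite ltnNge; apply: contra xs => /(quad_ge xi) {xi}.
case: x => [[[r1 r2] r3] [[s1 s2] s3]] [[a1 b1] [a2 b2] [a3 b3]].
have mT u v w : (u <= n)%N -> (v <= n)%N -> (w <= n)%N -> (u, v, w) \in T.
  move=> un vn wn; apply/allpairsP; exists ((u, v), w).
  split=> //; last by rewrite mem_index_iota.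
  by apply/allpairsP; exists (u, v); rewrite !mem_index_iota.
by apply/allpairsP; exists ((r1, r2, r3), (s1, s2, s3)); rewrite !mT.
Qed.

Definition box (N : nat) : seq (nat * nat) :=
  [seq (r, s) | r <- index_iota 0 N, s <- index_iota 0 N].

Lemma mem_box N r s : ((r, s) \in box N) = (r < N)%N && (s < N)%N.
Proof.
apply/allpairsP/andP => [[[u v] /= []]|[rN sN]].
  by rewrite !mem_index_iota => /= uN vN [-> ->].
by exists (r, s); rewrite !mem_index_iota.
Qed.

Lemma box_uniq N : uniq (box N).
Proof. by apply: allpairs_uniq; rewrite ?iota_uniq // => -[u v] [u' v'] _ _ [-> ->]. Qed.

Definition lvl (i j r s : nat) : int :=
  r%:Z * r%:Z - r%:Z * s%:Z + s%:Z * s%:Z + i%:Z * r%:Z + j%:Z * s%:Z.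

Lemma qsum_box N (i j : nat) f (n m : int) : qsum qF N i j f n m =
  \sum_(x <- box N) qF ^ lvl i j x.1 x.2 *
    (iq qF (n - x.1%:Z) * iq qF (m - x.2%:Z)) * f x.1 x.2.
Proof.
rewrite big_allpairs_dep big_mkord; apply: eq_bigr => r _ /=.
by rewrite big_mkord.
Qed.

Lemma quad_lin a b r1 r2 r3 s1 s2 s3 :
  let x := ((r1, r2, r3), (s1, s2, s3)) in
  (quad x + lin a b x)%N%:Z = lvl (a < 1)%N (b < 1)%N r1 s1 +
    (lvl (a < 2)%N (b < 2)%N r2 s2 + (lvl (a < 3)%N (b < 3)%N r3 s3 + 2 * (r3%:Z * s3%:Z))).
Proof.
rewrite /lvl /quad /lin /quad_form /= !expnS !expn0 !muln1.
have h (u v : nat) : (u * v <= u * u + v * v)%N by nia.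
have := h r1 s1; have := h r2 s2; lia.
Qed.

(** * Transfer of the finite identities to power series *)

(** The nested [profile_sum] as one sum over all six indices. Only the two factors in front depend
    on n and m, which prepares the use of [fsum_cvg]. *)
Definition fin_lhs (a b : nat) (n m : int) : fps int :=
  fsum (fun x => iqx X (n - (fstr x)%:Z) * iqx X (m - (fsts x)%:Z) *
                 (X ^+ quad x * X ^+ lin a b x * denom x)).

Lemma profile_sumE N a b (n m : nat) : (n < N)%N -> (m < N)%N ->
  profile_sum qF N a b n m = toF (fin_lhs a b n m).
Proof.
move=> nN mN; rewrite /fin_lhs /profile_sum.
(* Groups the indices into the pairs (r1, s1), (r2, s2), (r3, s3), the order in which the steps are
   nested. *)
pose h (y : (nat * nat) * ((nat * nat) * (nat * nat))) : idx :=
  ((y.1.1, y.2.1.1, y.2.2.1), (y.1.2, y.2.1.2, y.2.2.2)).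
have bh : bijective h.
  exists (fun x : idx => ((x.1.1.1, x.2.1.1), ((x.1.1.2, x.2.1.2), (x.1.2, x.2.2)))).
    by case=> [[r1 s1] [[r2 s2] [r3 s3]]].
  by case=> [[[r1 r2] r3] [[s1 s2] s3]].
rewrite (fsum_reindex _ bh).
pose L := [seq (u, w) | u <- box N, w <- [seq (v, w) | v <- box N, w <- box N]].
rewrite (@fsum_seq _ _ _ L).
- rewrite rmorph_sum big_allpairs qsum_box; apply: eq_bigr => -[r1 s1] _ /=.
  rewrite big_allpairs qsum_box mulr_sumr; apply: eq_bigr => -[r2 s2] _ /=.
  rewrite qsum_box !mulr_sumr; apply: eq_bigr => -[r3 s3] _ /=.
  rewrite /h /= /fstr /fsts /= -exprD -[X ^+ _]/(X ^+ `|(_ + _)%N%:Z|%N).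
  rewrite !tofracM toF_Xz // quad_lin.
  move: (lvl _ _ r1 s1) (lvl _ _ r2 s2) (lvl _ _ r3 s3) => e1 e2 e3.
  rewrite !expfzDr ?qF_neq0 //.
  rewrite !toF_iqx // /beta0.
  move: (qF ^ e1) (qF ^ e2) (qF ^ e3).
  move: (qF ^ (2 * _)) (iq qF (n%:Z - r1%:Z)) (iq qF (m%:Z - s1%:Z)).
  move: (iq qF (r1%:Z - r2%:Z)) (iq qF (r2%:Z - r3%:Z)) (iq qF r3).
  move: (iq qF (s1%:Z - s2%:Z)) (iq qF (s2%:Z - s3%:Z)) (iq qF s3).
  by move: (iq qF (r3%:Z + s3%:Z + 1)) => *; ring.
- apply: allpairs_uniq; rewrite ?box_uniq //.
    by apply: allpairs_uniq; rewrite ?box_uniq // => -[u v] [u' v'] _ _ [-> ->].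
  by move=> [u v] [u' v'] _ _ [-> ->].
case=> [[r1 s1] [[r2 s2] [r3 s3]]] nL /=; rewrite /h /fstr /fsts /=.
have [h1|h1] := ltP (n%:Z - r1%:Z) 0; first by rewrite (iqx_lt0 _ h1) !mul0r.
have [h2|h2] := ltP (m%:Z - s1%:Z) 0.
  by rewrite (iqx_lt0 _ h2) !(mulr0, mul0r).
have [h3|h3] := ltP (r1%:Z - r2%:Z) 0; first by rewrite (iqx_lt0 _ h3) !(mulr0, mul0r).
have [h4|h4] := ltP (r2%:Z - r3%:Z) 0; first by rewrite (iqx_lt0 _ h4) !(mulr0, mul0r).
have [h5|h5] := ltP (s1%:Z - s2%:Z) 0; first by rewrite (iqx_lt0 _ h5) !(mulr0, mul0r).
have [h6|h6] := ltP (s2%:Z - s3%:Z) 0; first by rewrite (iqx_lt0 _ h6) !(mulr0, mul0r).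
case/negP: nL; apply/allpairsP; exists ((r1, s1), ((r2, s2), (r3, s3))).
split=> //=; first by rewrite mem_box; lia.
apply/allpairsP; exists ((r2, s2), (r3, s3)).
by split=> //=; rewrite mem_box; lia.
Qed.

(** A g supported in the hexagon makes the finite sum of fractions the image of an unrestricted sum
    of power series over (a, c), with b = - a - c. *)
Lemma tsum_fsum B (i j : nat) (g : int -> int -> int -> fps int) :
    (0 < i)%N -> (0 < j)%N -> (i + j < 11)%N ->
    (forall a b c, a + b + c = 0 -> g a b c != 0 ->
       [&& `|a| <= B%:Z, `|b| <= B%:Z & `|c| <= B%:Z]) ->
  tsum B (fun a b c => wt qF 11 i j a c * toF (g a b c)) =
  toF (fsum (fun x => g x.1 (- x.1 - x.2) x.2 * wtx i j x)).
Proof.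
move=> i0 j0 ij gB.
have gout a b c : a + b + c = 0 ->
    ~~ [&& `|a| <= B%:Z, `|b| <= B%:Z & `|c| <= B%:Z] -> g a b c = 0.
  by move=> abc h; apply/eqP; apply: contraNT h => /(gB _ _ _ abc).
have ac0 (a c : int) : a + (- a - c) + c = 0 by ring.
rewrite (@fsum_seq _ _ _ [seq (a, c) | a <- zrange B, c <- zrange B]).
- rewrite rmorph_sum big_allpairs /tsum; apply: eq_bigr => a _.
  rewrite exchange_big; apply: eq_bigr => c _ /=.
  have iE : toF (g a (- a - c) c * wtx i j (a, c)) =
      (chi3 (a - c))%:~R * (wt qF 11 i j a c * toF (g a (- a - c) c)).
    rewrite wtxE !tofracM rmorph_int.
    have [->|nz] := eqVneq (chi3 (a - c)) 0; first by rewrite !mulr0z !(mul0r, mulr0).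
    by rewrite toF_Xz /wt; [ring | case: (wtx_sum0 i0 j0 ij nz)].
  rewrite iE; have [bB|bB] := boolP (`|(- a - c)| <= B%:Z).
    rewrite (@sum_zrange1 _ _ _ (- a - c)) //.
      by rewrite ac0 eqxx.
    by move=> b ab; case: eqP => // e; case/eqP: ab; lia.
  rewrite (gout a) ?ac0 ?(negPf bB) ?andbF // tofrac0 !mulr0 big1_seq // => b /andP[_].
  by rewrite mem_zrange => h; case: eqP => // e; lia.
- by apply: allpairs_uniq; rewrite ?zrange_uniq // => -[u v] [u' v'] _ _ [-> ->].
move=> [a c] acB /=; rewrite gout ?ac0 ?mul0r //; apply: contra acB => /and3P[aB _ cB].
by apply/allpairsP; exists (a, c); split=> //=; rewrite mem_zrange; lia.
Qed.

Definition kx (n m a b c : int) : fps int :=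
  facx X (n + m) * (iqx X (n - a) * iqx X (n - b) * iqx X (n - c) *
                    (iqx X (m + a) * iqx X (m + b) * iqx X (m + c))).

Lemma toF_kx n m a b c : toF (kx n m a b c) = kern qF n m a b c.
Proof. by rewrite /kx !tofracM toF_facx !toF_iqx. Qed.

Lemma kx_neq0 n m a b c : kx n m a b c != 0 ->
  [&& a <= n, b <= n, c <= n, - m <= a, - m <= b & - m <= c].
Proof.
apply: contraTT; rewrite negbK -(inj_eq toF_inj) tofrac0 toF_kx => h.
by rewrite kern_out //; lia.
Qed.

Lemma iqx_cvgD (q : fps int) (f : nat -> int) (d : int) : q 0%N = 0 ->
  (forall L : nat, f L = L%:Z + d) ->
  fps_cvg (fun L => iqx q (f L)) (qpoch_inf q q)^-1.
Proof. by move=> q0 /funext->; exact: iqx_cvg. Qed.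

Local Notation P := (qpoch_inf X X).

(** Six factors 1 / (q)_oo against one factor (q)_oo. *)
Lemma kx_cvg (d e a b c : int) :
  fps_cvg (fun L => kx (L%:Z + d) (L%:Z + e) a b c) (P^-1 ^+ 5).
Proof.
have Pu : P \is a GRing.unit by exact: qpoch_inf_unit.
rewrite (_ : P^-1 ^+ 5 = P * (P^-1 * P^-1 * P^-1 * (P^-1 * P^-1 * P^-1))).
  apply: fps_cvgM.
    rewrite (_ : (fun _ => _) = fun L : nat => facx X (L%:Z + L%:Z + (d + e))).
      exact: facx_cvg.
    by apply/funext => L; congr (facx X _); ring.
  by do !apply: fps_cvgM; apply: iqx_cvgD => // L; rewrite -!addrA.
by rewrite !mulrA divrr // mul1r !exprS expr0 mulr1 !mulrA.
Qed.

Lemma fin_lhs0 (a n m : nat) : (a <= 3)%N -> fin_lhs a 0 n m =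
  fsum (fun x => kx n (m%:Z + 1) x.1 (- x.1 - x.2) (x.2 - 1) * wtx 1 a.+1 x).
Proof.
(* The cut N = n + m + 1 exceeds n and m, and the hexagon B = N + 6 contains the supports needed for
   the initial sequence. *)
move=> a3; apply: toF_inj; have NB : ((n + m).+1 + 5 < n + m + 7)%N by lia.
rewrite -(@profile_sumE (n + m).+1); [|lia..].
rewrite (profile_sum0 qF_gen NB); [|lia..].
rewrite -(@tsum_fsum (n + m + 7) _ _ (fun a b c => kx n (m%:Z + 1) a b (c - 1))) //.
- by apply: eq_tsum => u v w _ _; rewrite toF_kx [a%:Z + 1]addrC -intS.
- by lia.
by move=> u v w _ /kx_neq0; lia.
Qed.

Lemma fin_lhsS (a b n m : nat) : (b <= a)%N -> (a <= 2)%N ->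
  fin_lhs a.+1 b.+1 n m - X * fin_lhs a b n m =
  fsum (fun x => kx n m (x.1 + 1) (- x.1 - x.2) (x.2 - 1) * wtx b.+2 a.+2 x).
Proof.
move=> ba a2; apply: toF_inj; have NB : ((n + m).+1 + 5 < n + m + 7)%N by lia.
rewrite tofracB tofracM -!(@profile_sumE (n + m).+1); [|lia..].
rewrite (profile_sumS qF_gen NB); [|lia..].
rewrite -(@tsum_fsum (n + m + 7) _ _ (fun a b c => kx n m (a + 1) b (c - 1))) //.
- apply: eq_tsum => u v w _ _; rewrite toF_kx /wt; congr (qF ^ _ * _).
  by rewrite -[b.+2]addn2 -[a.+2]addn2 !PoszD.
- by lia.
by move=> u v w _ /kx_neq0; lia.
Qed.

(** * The limits n, m -> oo *)

Definition lsum (c : idx -> fps int) : fps int :=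
  fsum (fun x => X ^+ quad x * c x * denom x).

Lemma fin_lhs_cvg a b :
  fps_cvg (fun L => fin_lhs a b L L) (P^-1 ^+ 2 * lsum (fun x => X ^+ lin a b x)).
Proof.
have s : summable (fun x => X ^+ quad x * X ^+ lin a b x * denom x).
  exact: summable_term.
rewrite /lsum fsumZ //; apply: fsum_cvg => // x; rewrite expr2.
by apply: fps_cvgM; apply: iqx_cvgD.
Qed.

Lemma fps_cvgB (u v : nat -> fps int) l l' :
  fps_cvg u l -> fps_cvg v l' -> fps_cvg (fun L => u L - v L) (l - l').
Proof.
move=> ul vl n; have [N HN] := ul n; have [N' HN'] := vl n.
exists (maxn N N') => L; rewrite geq_max => /andP[NL N'L].
by rewrite !coef_fpsB HN ?HN'.
Qed.

Lemma cancel_P2 (S W : fps int) : P^-1 ^+ 2 * S = P^-1 ^+ 5 * W -> S = P^-1 ^+ 3 * W.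
Proof.
have Pu : P^-1 ^+ 2 \is a GRing.unit by rewrite unitrX // unitrV qpoch_inf_unit.
by move=> e; apply: (mulrI Pu); rewrite e mulrA -exprD.
Qed.

(** The two factors of [fin_lhs] contribute (q)_oo^-2 and the kernels (q)_oo^-5, which leaves the
    exponent - 3. *)
Lemma lsum0 (a : nat) : (a <= 3)%N ->
  lsum (fun x => X ^+ lin a 0 x) = P^-1 ^+ 3 * fsum (wtx 1 a.+1).
Proof.
move=> a3; apply: cancel_P2; have sw : summable (wtx 1 a.+1) by apply: summable_wtx; lia.
apply: (fps_cvg_unique (@fin_lhs_cvg a 0)).
rewrite (_ : (fun _ => _) = fun L : nat => fsum (fun x =>
  kx L (L%:Z + 1) x.1 (- x.1 - x.2) (x.2 - 1) * wtx 1 a.+1 x)); last first.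
  by apply/funext => L; exact: fin_lhs0.
rewrite fsumZ //; apply: fsum_cvg => // x.
rewrite (_ : (fun _ => _) = fun L : nat =>
  kx (L%:Z + 0) (L%:Z + 1) x.1 (- x.1 - x.2) (x.2 - 1)); first exact: kx_cvg.
by apply/funext => L; rewrite addr0.
Qed.

Lemma lsumB (c d : idx -> fps int) :
  lsum (fun x => c x - X * d x) = lsum c - X * lsum d.
Proof.
rewrite /lsum -mulNr fsumZ; last exact: summable_term.
rewrite -fsumD; [|exact: summable_term|].
  by apply: eq_fsum => x; ring.
by apply: summableM; exact: summable_term.
Qed.

Lemma lsumS (a b : nat) : (b <= a)%N -> (a <= 2)%N ->
  lsum (fun x => X ^+ lin a.+1 b.+1 x - X * X ^+ lin a b x) =
  P^-1 ^+ 3 * fsum (wtx b.+2 a.+2).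
Proof.
move=> ba a2; apply: cancel_P2.
have sw : summable (wtx b.+2 a.+2) by apply: summable_wtx; lia.
rewrite lsumB mulrBr mulrCA.
apply: (fps_cvg_unique (fps_cvgB (@fin_lhs_cvg a.+1 b.+1)
  (fps_cvgM (fps_cvg_cst X) (@fin_lhs_cvg a b)))).
rewrite (_ : (fun _ => _) = fun L : nat => fsum (fun x =>
  kx L L (x.1 + 1) (- x.1 - x.2) (x.2 - 1) * wtx b.+2 a.+2 x)); last first.
  by apply/funext => L; exact: fin_lhsS.
rewrite fsumZ //; apply: fsum_cvg => // x.
rewrite (_ : (fun _ => _) = fun L : nat =>
  kx (L%:Z + 0) (L%:Z + 0) (x.1 + 1) (- x.1 - x.2) (x.2 - 1)); first exact: kx_cvg.
by apply/funext => L; rewrite addr0.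
Qed.

(** * Reduction of theta quotients modulo 11 *)

Local Notation th k := (theta (X ^+ k) Q11).

Lemma thE k : (k <= 11)%N -> th k = qpoch_inf (X ^+ k) Q11 * qpoch_inf (X ^+ (11 - k)) Q11.
Proof. by move=> k11; rewrite /theta fps_quotX. Qed.

Lemma th_sym k : (k <= 11)%N -> th (11 - k) = th k.
Proof. by move=> k11; rewrite !thE ?leq_subr // subKn // mulrC. Qed.

(** Dissection modulo 11, with the residues k and 11 - k paired. *)
Lemma qpoch_inf_theta :
  P = qpoch_inf Q11 Q11 * (th 1 * th 2 * th 3 * th 4 * th 5).
Proof.
rewrite -[P]/(qpoch_inf (X ^+ 1) (X ^+ 1)) (@qpoch_inf_dissect 1 11) //.
pose f k := qpoch_inf (X ^+ k) Q11.
have th_f k : (k <= 11)%N -> th k = f k * f (11 - k)%N by exact: thE.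
rewrite !th_f // -/(f 11%N).
transitivity (\prod_(i < 11) f i.+1).
  by apply: eq_bigr => i _; rewrite !mul1n.
move: f {th_f} => f; rewrite !big_ord_recl big_ord0 mulr1 /bump /=; ring.
Qed.

(** By [qpoch_inf_theta] two of the three factors 1 / (q)_oo turn the product of three theta
    functions into the reciprocal of the complementary factors of (th 1 ... th 5)^2, listed in s. *)
Lemma macdonald_quot i j (s : seq nat) : (0 < i)%N -> (0 < j)%N -> (i + j < 11)%N ->
    th i * (th j * th (i + j)) * \prod_(k <- s) th k =
      (th 1 * th 2 * th 3 * th 4 * th 5) ^+ 2 ->
  P^-1 ^+ 3 * fsum (wtx i j) = P^-1 * (thetas [seq X ^+ k | k <- s] Q11)^-1.
Proof.
move=> i0 j0 ij; rewrite macdonald // /thetas big_map.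
have Pu : P \is a GRing.unit by exact: qpoch_inf_unit.
move: qpoch_inf_theta Pu; move: (th 1 * _ * _ * _ * _) => T.
move: (qpoch_inf Q11 Q11) (th i * _) (\prod_(k <- s) _) => Q W S.
move=> -> Pu e.
have [Qu Tu] : Q \is a GRing.unit /\ T \is a GRing.unit.
  by apply/andP; rewrite -unitrM.
have Su : S \is a GRing.unit.
  by have := unitrX 2 Tu; rewrite -e unitrM => /andP[].
apply: (mulIr Su); rewrite mulrVK // -[LHS]mulrA -[_ * W * S]mulrA e -exprMn.
by rewrite exprS -mulrA -exprMn mulVr // expr1n mulr1.
Qed.

(** * The profile (4, 4, 0) *)

(** The exponent on the right does not single out a or b, so the right-hand side is symmetric in
    them and disappears from the alternating sum. The four terms on the left are the summands of
    [telescope_step]. *)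
Lemma wt15_step (F : fieldType) (q : F) (n a b c : int) :
    generic q -> a + b + c = 0 ->
  let u x y z := iq q x * iq q y * iq q z in
  wt q 11 1 5 a c * u (n - a) (n - b) (n + 1 - c)
  - wt q 11 1 5 a c * u (n - 1 - a) (n - 1 - b) (n - 1 + 1 - c)
  - q ^ n * (wt q 11 2 4 a c * u (n - (a + 1)) (n - b) (n - (c - 1)))
  - q ^ n * (wt q 11 1 6 a c * u (n - 1 - a) (n - 1 - b) (n + 1 - c)) =
  q ^ (11 * qexp a c + 6 - 5 * c + n) * u (n - a) (n - b) (n + 1 - c).
Proof.
move=> gq abc u; have q0 := q_neq0 gq; rewrite /u.
have -> : n - 1 - a = n - a - 1 by ring.
have -> : n - 1 - b = n - b - 1 by ring.
have -> : n - 1 + 1 - c = n + 1 - c - 1 by ring.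
have -> : n - (a + 1) = n - a - 1 by ring.
have -> : n - (c - 1) = n + 1 - c by ring.
have pred z : iq q (z - 1) = (1 - q ^ z) * iq q z.
  exact: iq_pred.
rewrite !pred; move: (iq q _) (iq q _) (iq q _) => U V W.
rewrite /wt.
have -> : n - b = n + a + c by lia.
have -> : 11 * qexp a c + 1 * (a + 1) + 5 * (1 - c) =
  11 * qexp a c + 6 + a - (c + c + c + c + c) by ring.
have -> : 11 * qexp a c + 2 * (a + 1) + 4 * (1 - c) =
  11 * qexp a c + 6 + a + a - (c + c + c + c) by ring.
have -> : 11 * qexp a c + 1 * (a + 1) + 6 * (1 - c) =
  11 * qexp a c + 6 + 1 + a - (c + c + c + c + c + c) by ring.
have -> : 11 * qexp a c + 6 - 5 * c + n =
  11 * qexp a c + 6 - (c + c + c + c + c) + n by ring.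
have qD (x y : int) : q ^ (x + y) = q ^ x * q ^ y by rewrite expfzDr ?q0.
have qN (x : int) : q ^ (- x) = (q ^ x)^-1 by rewrite -invr_expz.
move: (11 * qexp a c + 6) => e; rewrite !(qD, qN) expr1z.
have c0 : q ^ c != 0 by rewrite expfz_neq0 ?q0.
have a0 : q ^ a != 0 by rewrite expfz_neq0 ?q0.
move: (q ^ c) (q ^ a) (q ^ n) (q ^ e) c0 a0 => C A N E c0 a0.
by field; rewrite ?c0 ?a0.
Qed.

Definition wsum (i j : nat) (g : int -> int -> int -> fps int) : fps int :=
  fsum (fun x => g x.1 (- x.1 - x.2) x.2 * wtx i j x).

(** What is left of the kernels when one of n, m is fixed and the other tends to infinity: [gF]
    comes from [S00] for (4,3,1), [gS] from [S01] for (5,0,3), and [gT] is a reflected [gS]. With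
    the weight (1, 5), [gD] gives the telescoping sequence whose limit is the wanted theta
    series. *)
Definition gD (n a b c : int) : fps int :=
  iqx X (n - a) * iqx X (n - b) * iqx X (n + 1 - c).
Definition gF (n a b c : int) : fps int :=
  iqx X (n - (a + 1)) * iqx X (n - b) * iqx X (n - (c - 1)).
Definition gT (n a b c : int) : fps int :=
  iqx X (n - 1 - a) * iqx X (n - 1 - b) * iqx X (n + 1 - c).
Definition gS (n a b c : int) : fps int :=
  iqx X (n + 1 + a) * iqx X (n + 1 + b) * iqx X (n + 1 + (c - 1)).

Lemma iqx3_neq0 (x y z : int) : iqx X x * iqx X y * iqx X z != 0 ->
  [&& 0 <= x, 0 <= y & 0 <= z].
Proof.
apply: contraTT => h; rewrite negbK.
have [x0|x0] := ltP x 0; first by rewrite iqx_lt0 ?mul0r.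
have [y0|y0] := ltP y 0; first by rewrite [iqx X y]iqx_lt0 ?mulr0 ?mul0r.
by rewrite [iqx X z]iqx_lt0 ?mulr0 //; move: h; rewrite x0 y0 /=; lia.
Qed.

Lemma wsum0 i j g : (forall a b c, a + b + c = 0 -> g a b c = 0) -> wsum i j g = 0.
Proof.
move=> g0; rewrite /wsum (@fsum_seq _ _ _ [::]) ?big_nil // => -[a c] _ /=.
by rewrite g0 ?mul0r //; ring.
Qed.

Lemma telescope_step (n : nat) :
  wsum 1 5 (gD n) - wsum 1 5 (gD (n%:Z - 1)) =
  X ^+ n * (wsum 2 4 (gF n) + wsum 1 6 (gT n)).
Proof.
apply: toF_inj; rewrite tofracB tofracM tofracD.
have bnd i j (g : int -> int -> int -> fps int) : (0 < i)%N -> (0 < j)%N -> (i + j < 11)%N ->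
    (forall a b c, g a b c != 0 -> [&& a <= n%:Z, b <= n%:Z & c <= n%:Z + 1]) ->
  toF (wsum i j g) = tsum (n + n + 5) (fun a b c => wt qF 11 i j a c * toF (g a b c)).
  by move=> i0 j0 ij gn; rewrite tsum_fsum // => a b c abc /gn; lia.
rewrite !bnd //; try by move=> a b c /iqx3_neq0; lia.
apply/eqP; rewrite -subr_eq0 mulrDr opprD addrA tofracXn -!tsumZ -!tsumB; apply/eqP.
(* The factor of the sign is symmetric in a and b, and the sign is not. *)
apply: (tsum_sym12 qF_gen) => a b c abc _.
rewrite /gD /gF /gT !tofracM !toF_iqx // exprnP.
rewrite !(wt15_step _ qF_gen) //; last by rewrite -abc; ring.
by rewrite (qexp_sum0 abc); congr (_ * (_ * _)); rewrite mulrC.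
Qed.

(* By the reflection (a, b, c) -> (- 1 - b, - 1 - a, 2 - c). *)
Lemma gT_gS (n : int) : wsum 1 6 (gT n) = wsum 1 4 (gS (n - 1)).
Proof.
have bh : bijective (fun x : int * int => (x.1 + x.2 - 1, 2 - x.2)).
  by exists (fun x : int * int => (x.1 + x.2 - 1, 2 - x.2)) => -[a c] /=; congr (_, _); ring.
rewrite /wsum (fsum_reindex _ bh); apply: eq_fsum => -[a c] /=; congr (_ * _).
  rewrite /gT /gS [iqx _ (n - 1 - _) * iqx _ _]mulrC.
  by congr (iqx X _ * iqx X _ * iqx X _); ring.
rewrite !wtxE (@chi3D (a - c) _ (1 - c)); last by ring.
have -> : qexp (a + c - 1) (2 - c) = qexp a c + (1 - c).
  rewrite /qexp (_ : _ - 1 = (1 - c) * 3 + (a * a + a * c + c * c - 1)); last by ring.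
  by rewrite divzMDl // addrC.
by congr (_ * X ^+ `|_|%N); ring.
Qed.

(** With D, S the sums of [gD], [gS], the summand is D_n - D_(n-1) + q^(n+1) S_n - q^n S_(n-1), by
    [telescope_step] and [gT_gS]. *)
Lemma telescope (N : nat) :
  \sum_(n < N) X ^+ n * (wsum 2 4 (gF n) + X * wsum 1 4 (gS n)) =
  wsum 1 5 (gD (N%:Z - 1)) + X ^+ N * wsum 1 4 (gS (N%:Z - 1)).
Proof.
elim: N => [|N IH].
  (* At n = - 1 the three arguments in [gD], and those in [gS], have a negative sum, so one of the
     factors is 0. *)
  rewrite big_ord0 !wsum0 ?mulr0 ?addr0 // => a b c abc.
    by apply/eqP; apply: contraT => /iqx3_neq0; lia.
  by apply/eqP; apply: contraT => /iqx3_neq0; lia.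
rewrite big_ord_recr /= IH (_ : N.+1%:Z - 1 = N); last by lia.
have := telescope_step N; rewrite gT_gS => /eqP; rewrite subr_eq => /eqP->.
by rewrite exprSr; ring.
Qed.

Lemma facx_cvg1 (q : fps int) (d : int) : q 0%N = 0 ->
  fps_cvg (fun L => facx q (L%:Z + d)) (qpoch_inf q q).
Proof.
move=> q0; apply: (@fps_cvg_shift (fun k => qpoch q q k) _ _ `|d|%N).
  move=> L dL; exists `|(L%:Z + d)%R|%N; first by lia.
  by rewrite /facx -{1}[L%:Z + d]gez0_abs //; lia.
exact: qpoch_inf_cvg.
Qed.

Definition swap (x : idx) : idx := (x.2, x.1).

Lemma swap_bij : bijective swap.
Proof. by exists swap => -[]. Qed.

Lemma quad_swap x : quad (swap x) = quad x.
Proof.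
case: x => [[[r1 r2] r3] [[s1 s2] s3]]; rewrite /swap /quad /quad_form /=.
by rewrite ![(s1 * _)%N]mulnC ![(s2 * _)%N]mulnC ![(s3 * _)%N]mulnC; lia.
Qed.

Lemma denom_swap x : denom (swap x) = denom x.
Proof.
case: x => [[[r1 r2] r3] [[s1 s2] s3]]; rewrite /swap /denom /=.
by rewrite [s3%:Z + _]addrC [X in X * _ = _]mulrC.
Qed.

Lemma lin_swap a b x : lin a b (swap x) = lin b a x.
Proof. by case: x => [[[r1 r2] r3] [[s1 s2] s3]]; rewrite /swap /lin /=; lia. Qed.

(** The exchange of r and s yields the rows whose profiles differ in the order of the last two
    parts. *)
Lemma lsum_swap c : lsum c = lsum (c \o swap).
Proof.
rewrite /lsum (fsum_reindex _ swap_bij); apply: eq_fsum => x.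
by rewrite -(quad_swap x) -(denom_swap x).
Qed.

Definition lsumr (n : int) (c : idx -> fps int) : fps int :=
  lsum (fun x => iqx X (n - (fstr x)%:Z) * c x).

Lemma lsumrE n c : lsumr n c =
  fsum (fun x => iqx X (n - (fstr x)%:Z) * (X ^+ quad x * c x * denom x)).
Proof. by apply: eq_fsum => x; ring. Qed.

Lemma cancel_P1 (S W : fps int) : P^-1 * S = P^-1 ^+ 2 * W -> S = P^-1 * W.
Proof.
have Pu : P^-1 \is a GRing.unit by rewrite unitrV qpoch_inf_unit.
by move=> e; apply: (mulrI Pu); rewrite e mulrA.
Qed.

Lemma P_P3 : P * (P^-1 * P^-1 * P^-1) = P^-1 ^+ 2.
Proof. by rewrite !mulrA divrr ?mul1r // qpoch_inf_unit. Qed.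

Lemma fin_lhs_cvgr a b (n : nat) :
  fps_cvg (fun L => fin_lhs a b n L) (P^-1 * lsumr n (fun x => X ^+ lin a b x)).
Proof.
have s : summable (fun x => X ^+ quad x * X ^+ lin a b x * denom x).
  exact: summable_term.
rewrite lsumrE fsumZ; last exact: summableM.
rewrite (_ : fsum _ = fsum (fun x => iqx X (n%:Z - (fstr x)%:Z) * P^-1 *
  (X ^+ quad x * X ^+ lin a b x * denom x))); last by apply: eq_fsum => x; ring.
apply: fsum_cvg => // x.
by apply: fps_cvgM; [exact: fps_cvg_cst | exact: iqx_cvgD].
Qed.

Lemma fin_lhs_cvgs a b (n : nat) :
  fps_cvg (fun L => fin_lhs a b L n) (P^-1 * lsumr n (fun x => X ^+ lin b a x)).
Proof.
rewrite (_ : (fun L : nat => fin_lhs a b L n) = fun L : nat => fin_lhs b a n L).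
  exact: fin_lhs_cvgr.
apply/funext => L; rewrite /fin_lhs (fsum_reindex _ swap_bij); apply: eq_fsum => x.
by rewrite -(quad_swap x) -(denom_swap x) -(lin_swap a b x) [iqx X (n%:Z - _) * _]mulrC.
Qed.

Lemma lsumr_gF (n : nat) : lsumr n (fun x => X ^+ lin 3 1 x - X * X ^+ lin 2 0 x) =
  P^-1 * wsum 2 4 (gF n).
Proof.
apply: cancel_P1; have sw : summable (wtx 2 4) by apply: summable_wtx.
have -> : lsumr n (fun x => X ^+ lin 3 1 x - X * X ^+ lin 2 0 x) =
    lsumr n (fun x => X ^+ lin 3 1 x) - X * lsumr n (fun x => X ^+ lin 2 0 x).
  rewrite -lsumB; apply: eq_fsum => x; ring.
rewrite mulrBr mulrCA.
apply: (fps_cvg_unique (fps_cvgB (@fin_lhs_cvgr 3 1 n)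
  (fps_cvgM (fps_cvg_cst X) (@fin_lhs_cvgr 2 0 n)))).
rewrite (_ : (fun _ => _) = fun L : nat => fsum (fun x =>
  kx n L (x.1 + 1) (- x.1 - x.2) (x.2 - 1) * wtx 2 4 x)); last first.
  by apply/funext => L; exact: (@fin_lhsS 2 0).
rewrite fsumZ; last exact: summableM.
rewrite (_ : fsum _ = fsum (fun x => P * (gF n x.1 (- x.1 - x.2) x.2 *
  (P^-1 * P^-1 * P^-1)) * wtx 2 4 x)); last first.
  by apply: eq_fsum => x; rewrite -P_P3; ring.
apply: fsum_cvg => // x; apply: fps_cvgM.
  rewrite (_ : (fun _ => _) = fun L : nat => facx X (L%:Z + n)); first exact: facx_cvg1.
  by apply/funext => L; rewrite addrC.
apply: fps_cvgM; first exact: fps_cvg_cst.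
by do 2?apply: fps_cvgM; exact: iqx_cvgD.
Qed.

(** The sum behind (5,3,0) with its first bound tending to infinity and its second bound fixed; the
    exchange of r and s makes the fixed bound one on r1. *)
Lemma lsumr_gS (n : nat) : lsumr n (fun x => X ^+ lin 0 3 x) = P^-1 * wsum 1 4 (gS n).
Proof.
apply: cancel_P1; have sw : summable (wtx 1 4) by apply: summable_wtx.
apply: (fps_cvg_unique (@fin_lhs_cvgs 3 0 n)).
rewrite (_ : (fun _ => _) = fun L : nat => fsum (fun x =>
  kx L (n%:Z + 1) x.1 (- x.1 - x.2) (x.2 - 1) * wtx 1 4 x)); last first.
  by apply/funext => L; exact: fin_lhs0.
rewrite fsumZ; last exact: summableM.
rewrite (_ : fsum _ = fsum (fun x => P * (P^-1 * P^-1 * P^-1 *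
  gS n x.1 (- x.1 - x.2) x.2) * wtx 1 4 x)); last first.
  by apply: eq_fsum => x; rewrite -P_P3; ring.
apply: fsum_cvg => // x; apply: fps_cvgM; first exact: facx_cvg1.
apply: fps_cvgM; last exact: fps_cvg_cst.
by do 2?apply: fps_cvgM; exact: iqx_cvgD.
Qed.

Lemma iqx_pred (r N : nat) :
  X ^+ r * iqx X (N%:Z - 1 - r%:Z) + X ^+ N * iqx X (N%:Z - r%:Z) =
  X ^+ r * iqx X (N%:Z - r%:Z).
Proof.
apply: toF_inj; rewrite tofracD !tofracM !toF_iqx // !tofracXn.
rewrite (_ : N%:Z - 1 - r%:Z = N%:Z - r%:Z - 1); last by ring.
rewrite (iq_pred qF_gen).
have -> : qF ^+ N = qF ^+ r * qF ^ (N%:Z - r%:Z).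
  by rewrite !exprnP -expfzDr ?qF_neq0 //; congr (qF ^ _); ring.
by ring.
Qed.

Lemma lsumr_telescope (N : nat) c : \sum_(n < N) X ^+ n * lsumr n c =
  lsumr (N%:Z - 1) (fun x => X ^+ fstr x * c x).
Proof.
elim: N => [|N IH].
  rewrite big_ord0 lsumrE (@fsum_seq _ _ _ [::]) ?big_nil // => x _.
  by rewrite iqx_lt0 ?mul0r //; lia.
have s d : summable (fun x => iqx X (N%:Z - (fstr x)%:Z) * (X ^+ quad x * d x * denom x)).
  by apply: summableM; exact: summable_term.
rewrite big_ord_recr /= IH !lsumrE (_ : N.+1%:Z - 1 = N); last by lia.
rewrite fsumZ // -fsumD; [|by apply: summableM; exact: summable_term|exact: summableM].
apply: eq_fsum => x; have := iqx_pred (fstr x) N.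
move: (iqx X (N%:Z - _)) (iqx X _) (X ^+ fstr x) (X ^+ N) => u v r w e.
transitivity ((r * u) * (X ^+ quad x * c x * denom x)); last by ring.
by rewrite -e; ring.
Qed.

Lemma lsumr_cvg c : fps_cvg (fun N => lsumr (N%:Z - 1) c) (P^-1 * lsum c).
Proof.
have s : summable (fun x => X ^+ quad x * c x * denom x) by exact: summable_term.
rewrite (_ : (fun _ => _) = fun N : nat =>
  fsum (fun x => iqx X (N%:Z - 1 - (fstr x)%:Z) * (X ^+ quad x * c x * denom x))).
  by rewrite fsumZ //; apply: fsum_cvg => // x; apply: iqx_cvgD => // L; rewrite -addrA.
by apply/funext => N; rewrite lsumrE.
Qed.

Lemma fps_cvgD (u v : nat -> fps int) l l' :
  fps_cvg u l -> fps_cvg v l' -> fps_cvg (fun L => u L + v L) (l + l').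
Proof.
move=> ul vl n; have [N HN] := ul n; have [N' HN'] := vl n.
exists (maxn N N') => L; rewrite geq_max => /andP[NL N'L].
by rewrite !coef_fpsD HN ?HN'.
Qed.

Lemma fps_cvg_Xn : fps_cvg (fun N => X ^+ N) 0.
Proof.
move=> n; exists n.+1 => N nN; rewrite coef_fpsXn coef_fps0.
by rewrite ltn_eqF.
Qed.

Lemma wsum_gD_cvg :
  fps_cvg (fun N => wsum 1 5 (gD (N%:Z - 1))) (P^-1 ^+ 3 * fsum (wtx 1 5)).
Proof.
have sw : summable (wtx 1 5) by apply: summable_wtx.
rewrite fsumZ // !exprS expr0 mulr1 mulrA; apply: fsum_cvg => // x.
by do 2?apply: fps_cvgM; apply: iqx_cvgD => // L; rewrite -!addrA.
Qed.

Lemma wsum_gS_cvg :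
  fps_cvg (fun N => wsum 1 4 (gS (N%:Z - 1))) (P^-1 ^+ 3 * fsum (wtx 1 4)).
Proof.
have sw : summable (wtx 1 4) by apply: summable_wtx.
rewrite fsumZ // !exprS expr0 mulr1 mulrA; apply: fsum_cvg => // x.
by do 2?apply: fps_cvgM; apply: iqx_cvgD => // L; rewrite -!addrA.
Qed.

(** The boundary term of [telescope] carries X^N and tends to 0; the theta series with (i, j) = (1,
    5) is the limit of the [gD] part. *)
Lemma lsum440 :
  lsum (fun x => X ^+ fstr x *
    (X ^+ lin 3 1 x - X * X ^+ lin 2 0 x + X * X ^+ lin 0 3 x)) =
  P^-1 ^+ 3 * fsum (wtx 1 5).
Proof.
have Pu : P^-1 \is a GRing.unit by rewrite unitrV qpoch_inf_unit.
set c1 := fun x => X ^+ lin 3 1 x - X * X ^+ lin 2 0 x.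
set c2 := fun x => X ^+ lin 0 3 x.
have fin N : lsumr (N%:Z - 1) (fun x => X ^+ fstr x * c1 x) +
    X * lsumr (N%:Z - 1) (fun x => X ^+ fstr x * c2 x) =
  P^-1 * (wsum 1 5 (gD (N%:Z - 1)) + X ^+ N * wsum 1 4 (gS (N%:Z - 1))).
  rewrite -!lsumr_telescope -telescope !mulr_sumr -big_split; apply: eq_bigr => n _ /=.
  by rewrite lsumr_gF lsumr_gS; ring.
have := fps_cvgM (fps_cvg_cst P^-1)
  (fps_cvgD wsum_gD_cvg (fps_cvgM fps_cvg_Xn wsum_gS_cvg)).
rewrite mul0r addr0 -(funext fin) => /fps_cvg_unique.
have := fps_cvgD (lsumr_cvg (fun x => X ^+ fstr x * c1 x))
  (fps_cvgM (fps_cvg_cst X) (lsumr_cvg (fun x => X ^+ fstr x * c2 x))).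
move=> /[swap] /[apply] e; apply: (mulrI Pu); rewrite e mulrCA -mulrDr; congr (_ * _).
rewrite /lsum fsumZ; last exact: summable_term.
rewrite -fsumD; [|exact: summable_term|by apply: summableM; exact: summable_term].
by apply: eq_fsum => x; rewrite /c1 /c2; ring.
Qed.

(** * The fifteen rows *)

Definition product_form (p : factor) (s : seq nat) : Prop :=
  fps_summable index_set (summand p X) /\
  fps_sum index_set (summand p X) = P^-1 * (thetas [seq X ^+ k | k <- s] Q11)^-1.

(** In all rows i + j is at most 7, so the only reflections needed are theta_6 = theta_5 and theta_7
    = theta_4. With f in place of the theta functions, the product side of a row is a polynomial
    identity in f 1, ..., f 5. *)
Lemma product_formP (p : factor) (s : seq nat) (c : idx -> fps int) (i j k : nat) :
    appl p =1 c -> lsum c = P^-1 ^+ 3 * fsum (wtx i j) ->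
    (0 < i)%N -> (0 < j)%N -> k = (i + j)%N -> (k < 11)%N ->
    (forall f : nat -> fps int, f 6%N = f 5%N -> f 7%N = f 4%N ->
       f i * (f j * f k) * \prod_(l <- s) f l = (f 1%N * f 2%N * f 3%N * f 4%N * f 5%N) ^+ 2) ->
  product_form p s.
Proof.
move=> pc cE i0 j0 kE k11 sE; have cE' x : X ^+ quad x * appl p x * denom x =
    X ^+ quad x * c x * denom x by rewrite pc.
rewrite /product_form; split.
  apply: summableP; rewrite (funext (summandE p)); exact: summable_term.
rewrite fps_sum_cond (eq_fsum (summandE p)) (eq_fsum cE') -[fsum _]/(lsum c) cE.
apply: macdonald_quot => //; first by rewrite -kE.
by rewrite -kE; apply: (sE (fun l => th l)); rewrite -(th_sym (_ : _ <= 11)%N).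
Qed.

Lemma lsum0_swap (a : nat) : (a <= 3)%N ->
  lsum (fun x => X ^+ lin 0 a x) = P^-1 ^+ 3 * fsum (wtx 1 a.+1).
Proof.
by move=> a3; rewrite lsum_swap -lsum0 //; apply: eq_fsum => x; rewrite -(lin_swap 0 a x).
Qed.

Lemma lsumS_swap (a b : nat) : (b <= a)%N -> (a <= 2)%N ->
  lsum (fun x => X ^+ lin b.+1 a.+1 x - X * X ^+ lin b a x) =
  P^-1 ^+ 3 * fsum (wtx b.+2 a.+2).
Proof.
move=> ba a2; rewrite lsum_swap -lsumS //; apply: eq_fsum => x.
by rewrite -(lin_swap b.+1 a.+1 x) -(lin_swap b a x).
Qed.

Theorem theorem4p4 (c : nat * nat * nat) (p : factor) (i : seq nat) :
  table c p i ->
  let q := fpsX int in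
  fps_summable index_set (summand p q) /\
  fps_sum index_set (summand p q)
    = (qpoch_inf q q)^-1 * (thetas [seq q ^+ j | j <- i] (q ^+ 11))^-1.
Proof.
move=> h q; rewrite -/(product_form p i).
(* All factors p_c except that of (4,4,0) have one of the shapes treated by [e0] and [eS], up to the
   exchange of r and s. *)
have e0 a b (x : idx) k : k = lin a b x -> X ^+ k = X ^+ lin a b x by move->.
have eS a b (x : idx) k l : k = lin a.+1 b.+1 x -> (k + l)%N = (lin a b x).+1 ->
    X ^+ k * (1 - X ^+ l) = X ^+ lin a.+1 b.+1 x - X * X ^+ lin a b x.
  by move=> -> kl; rewrite mulrBr mulr1 -exprD kl exprS.
case: h.
- apply: (product_formP (k := 2)) (@lsum0 0 isT) _ _ _ _ _ => //.
    by case=> [[[r1 r2] r3] [[s1 s2] s3]]; apply: e0; rewrite /lin /=; lia.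
  by move=> f f6 f7; rewrite !big_cons big_nil; ring.
- apply: (product_formP (k := 3)) (@lsum0 1 isT) _ _ _ _ _ => //.
    by case=> [[[r1 r2] r3] [[s1 s2] s3]]; apply: e0; rewrite /lin /=; lia.
  by move=> f f6 f7; rewrite !big_cons big_nil; ring.
- apply: (product_formP (k := 3)) (@lsum0_swap 1 isT) _ _ _ _ _ => //.
    by case=> [[[r1 r2] r3] [[s1 s2] s3]]; apply: e0; rewrite /lin /=; lia.
  by move=> f f6 f7; rewrite !big_cons big_nil; ring.
- apply: (product_formP (k := 4)) (@lsum0 2 isT) _ _ _ _ _ => //.
    by case=> [[[r1 r2] r3] [[s1 s2] s3]]; apply: e0; rewrite /lin /=; lia.
  by move=> f f6 f7; rewrite !big_cons big_nil; ring.
- apply: (product_formP (k := 4)) (@lsumS 0 0 isT isT) _ _ _ _ _ => //.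
    by case=> [[[r1 r2] r3] [[s1 s2] s3]]; apply: eS; rewrite /lin /=; lia.
  by move=> f f6 f7; rewrite !big_cons big_nil; ring.
- apply: (product_formP (k := 4)) (@lsum0_swap 2 isT) _ _ _ _ _ => //.
    by case=> [[[r1 r2] r3] [[s1 s2] s3]]; apply: e0; rewrite /lin /=; lia.
  by move=> f f6 f7; rewrite !big_cons big_nil; ring.
- apply: (product_formP (k := 5)) (@lsum0 3 isT) _ _ _ _ _ => //.
    by case=> [[[r1 r2] r3] [[s1 s2] s3]]; apply: e0; rewrite /lin /=; lia.
  by move=> f f6 f7; rewrite !big_cons big_nil; ring.
- apply: (product_formP (k := 5)) (@lsumS 1 0 isT isT) _ _ _ _ _ => //.
    by case=> [[[r1 r2] r3] [[s1 s2] s3]]; apply: eS; rewrite /lin /=; lia.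
  by move=> f f6 f7; rewrite !big_cons big_nil; ring.
- apply: (product_formP (k := 5)) (@lsumS_swap 1 0 isT isT) _ _ _ _ _ => //.
    by case=> [[[r1 r2] r3] [[s1 s2] s3]]; apply: eS; rewrite /lin /=; lia.
  by move=> f f6 f7; rewrite !big_cons big_nil; ring.
- apply: (product_formP (k := 5)) (@lsum0_swap 3 isT) _ _ _ _ _ => //.
    by case=> [[[r1 r2] r3] [[s1 s2] s3]]; apply: e0; rewrite /lin /=; lia.
  by move=> f f6 f7; rewrite !big_cons big_nil; ring.
- apply: (product_formP (k := 6)) (@lsumS 2 0 isT isT) _ _ _ _ _ => //.
    by case=> [[[r1 r2] r3] [[s1 s2] s3]]; apply: eS; rewrite /lin /=; lia.
  by move=> f f6 f7; rewrite !big_cons big_nil f6; ring.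
- apply: (product_formP (k := 6)) (@lsumS 1 1 isT isT) _ _ _ _ _ => //.
    by case=> [[[r1 r2] r3] [[s1 s2] s3]]; apply: eS; rewrite /lin /=; lia.
  by move=> f f6 f7; rewrite !big_cons big_nil f6; ring.
- apply: (product_formP (k := 6)) (@lsumS_swap 2 0 isT isT) _ _ _ _ _ => //.
    by case=> [[[r1 r2] r3] [[s1 s2] s3]]; apply: eS; rewrite /lin /=; lia.
  by move=> f f6 f7; rewrite !big_cons big_nil f6; ring.
- apply: (product_formP (k := 7)) (@lsumS 2 1 isT isT) _ _ _ _ _ => //.
    by case=> [[[r1 r2] r3] [[s1 s2] s3]]; apply: eS; rewrite /lin /=; lia.
  by move=> f f6 f7; rewrite !big_cons big_nil f7; ring.
- apply: (product_formP (k := 6)) lsum440 _ _ _ _ _ => //.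
    case=> [[[r1 r2] r3] [[s1 s2] s3]]; rewrite /appl /lin /fstr /= -!exprS.
    by congr (X ^+ _ * (X ^+ _ - X ^+ _ + X ^+ _)); lia.
  by move=> f f6 f7; rewrite !big_cons big_nil f6; ring.
Qed.
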